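(* For every finite matroid $M$, $M$ is $4$-entropic if and only if $M$ is representable over the four-element field $\mathbb F_4$.
   Context: Let $M=(E,r)$ be a finite matroid with ground set $E$ and rank function $r$. For a finite random variable $X$ with distribution $p$, the Shannon entropy is $H(X)=-\sum_x p(x)\log p(x)$, with one logarithm base fixed throughout. For a tuple $(X_e)_{e\in E}$ of jointly distributed random variables and $A\subseteq E$, write $X_A=(X_e:e\in A)$. For an integer $q\ge 2$, the matroid $M=(E,r)$ is $q$-entropic if there are jointly distributed random variables $(X_e)_{e\in E}$ taking values in a common $q$-element alphabet such that $H(X_A)=r(A)\log q$ for every $A\subseteq E$. For a field $\mathbb F$, $M$ is representable over $\mathbb F$ if there is a family of vectors $(v_e)_{e\in E}$ in a finite-dimensional vector space over $\mathbb F$ such that $r(A)=\dim_{\mathbb F}\operatorname{span}\{v_e:e\in A\}$ for every $A\subseteq E$. *)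

(* Defs.v *)
From HB Require Import structures.
From mathcomp Require Import all_boot all_order all_algebra.
From mathcomp Require Import all_classical all_reals all_analysis.

Set Implicit Arguments.
Unset Strict Implicit.
Unset Printing Implicit Defensive.

Import Order.TTheory GRing.Theory Num.Theory.

Local Open Scope classical_set_scope.
Local Open Scope ring_scope.

Record matroid (E : finType) := Matroid {
  mrank :> {set E} -> nat;
  mrank_card : forall A : {set E}, (mrank A <= #|A|)%N;
  mrank_mono : forall A B : {set E}, A \subset B -> (mrank A <= mrank B)%N;
  mrank_submod : forall A B : {set E},
    (mrank (A :|: B) + mrank (A :&: B) <= mrank A + mrank B)%N
}.

(* Measurability with respect to the discrete sigma-algebra on the finite
   type S, stated on points, which suffices since S is finite. *)
Definition finite_random_variable (d : measure_display) (T : measurableType d)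
    (S : finType) (X : T -> S) : Prop :=
  forall s : S, measurable (X @^-1` [set s]).

Definition finite_law (d : measure_display) (T : measurableType d)
    (R : realType) (P : probability T R) (S : finType) (X : T -> S) (s : S) : R :=
  fine (P (X @^-1` [set s])).

(* Entropy in nats. The convention 0 * log 0 = 0 holds because of the
   factor 0. *)
Definition entropy (d : measure_display) (T : measurableType d)
    (R : realType) (P : probability T R) (S : finType) (X : T -> S) : R :=
  - \sum_(s : S) finite_law P X s * ln (finite_law P X s).

Definition subtuple (E : finType) (T : Type) (S : finType) (X : E -> T -> S)
    (A : {set E}) (t : T) : {ffun {e : E | e \in A} -> S} :=
  [ffun e => X (val e) t].

Definition entropic (R : realType) (q : nat) (E : finType) (M : matroid E) : Prop :=
  exists (d : measure_display) (T : measurableType d) (P : probability T R)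
         (S : finType) (X : E -> T -> S),
    [/\ #|S| = q,
        forall e : E, finite_random_variable (X e)
      & forall A : {set E}, entropy P (subtuple X A) = (M A)%:R * ln q%:R].

Definition representable (F : fieldType) (E : finType) (M : matroid E) : Prop :=
  exists (V : vectType F) (v : E -> V),
    forall A : {set E}, M A = \dim <<[seq v e | e in A]>>%VS.

(* Main.v *)
(* Let p be the joint law of variables witnessing that M is 4-entropic and C its
   support. Comparing the entropies of X_A and X_(A + e), by monotonicity of ln
   and by ln t <= t - 1, shows that over a word of C the value at e is determined
   by those on A when e lies in the closure of A, and takes all four values
   otherwise; so C is a code of M. A linear code of M over F gives back both a
   representation (evaluations at the coordinates) and, with the uniform law, an
   entropic family. The point is thus to turn a code into a linear one, which is
   done by induction on the number of nonloops.

   If M is not vertically 3-connected, it is a direct sum or a 2-sum of two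
   contractions, and linear codes of these can be glued. If no coline of M lies in
   four hyperplanes, M is binary and its fundamental matrices, read over F, give
   a linear code. In the remaining case, fixing the coordinates of a flat A in C
   relates the values at two elements that are parallel in M / A by a permutation
   of F. Permutations of F are of the form a x + b or a x^2 + b, whence a sign.
   The claim is that the sign for f and g is o(f) + o(g) for some o : E -> F_2;
   then conjugating the coordinates with o(e) = 1 makes all these permutations
   affine and C a translate of a linear code. The claim is trivial in rank 1, and
   it lifts from M / e to M if M / e and the deletion of the parallel class of e
   are connected, because a Latin square of order 4 with an orthogonal mate is the
   Cayley table of F_2^2, not of Z/4. In rank at least 3, a splitter theorem
   provides e on a coline lying in four hyperplanes such that M / e is again
   vertically 3-connected. *)

(* Order four is special because every permutation of F is affine up to squaring. The affine ones
   form the alternating group, so the sign is the parity, with values in F_2. The obstacle is that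
   the sign of a pair depends a priori on the flat and on the word that fixes its coordinates. It
   really does for the Cayley table of Z/4, a code of the rank-2 matroid with three points that no
   relabelling makes linear. This is why C is discarded in the binary case and a code is built
   afresh, and why separations, behind which such a part can hide, are split off first. A fourth
   class over a coline supplies the orthogonal mate that excludes Z/4. In the lift from M / e, the
   words with value c at e form a code of M / e with a function o_c of its own. The two connectivity
   conditions spread local equalities of signs until o_c - o_c' is constant off the parallel class
   of e. The splitter has to keep e on a coline with four hyperplanes so that M / e stays
   nonbinary. *)
Require Import Defs.
From mathcomp Require Import all_boot all_order all_algebra finfield zify ring.
From mathcomp Require boolp.

Set Implicit Arguments.
Unset Strict Implicit.
Unset Printing Implicit Defensive.

Import GRing.Theory.

(** * Rank and closure *)

Ltac stauto :=
  let z := fresh "z" in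
  first [apply/subsetP => z; apply/implyP | apply/setP => z];
  repeat match goal with
  | H : is_true (?x \in ?A) |- _ => move: H; rewrite -sub1set => H
  end;
  repeat match goal with
  | H : is_true (?A \subset ?B) |- _ => move/subsetP/(_ z)/implyP: H
  end;
  rewrite ?inE;
  repeat match goal with
  | |- context [in_mem z ?A] => generalize (in_mem z A)
  | |- context [z == ?a] => generalize (z == a)
  end;
  repeat (let b := fresh "b" in intro b; match type of b with bool => case: b => // end).

(* lia on the rank and cardinality inequalities of the context alone: zify
   is very slow in the presence of many membership hypotheses. *)
Ltac rlia :=
  repeat match goal with
  | H : is_true (leq _ _) |- _ => revert H
  | H : @eq ?T _ _ |- _ => unify T nat; revert H
  end;
  repeat match goal with
  | |- context [mrank ?M ?A] => generalize (mrank M A)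
  end;
  repeat match goal with H : _ |- _ => clear H end;
  intros; lia.

Lemma set_ind1 (T : finType) (P : {set T} -> Prop) :
  P set0 -> (forall x A, P A -> P (x |: A)) -> forall A, P A.
Proof.
move=> P0 PU A; rewrite -[A]set_enum; elim: (enum A) => [|x s IH].
  by rewrite set_nil.
by rewrite set_cons; exact: PU.
Qed.

Section Rank.

Variables (E : finType) (M : matroid E).
Implicit Types (A B I U X Y Z : {set E}) (e f : E).

Lemma rank0 : M set0 = 0.
Proof. by apply/eqP; rewrite -leqn0 -(cards0 E) mrank_card. Qed.

Lemma rank_mono A B : A \subset B -> M A <= M B.
Proof. exact: mrank_mono. Qed.

Lemma rank_submod U I A B :
  U \subset A :|: B -> I \subset A :&: B -> M U + M I <= M A + M B.
Proof.
move=> sU sI; apply: leq_trans (mrank_submod M A B).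
by rewrite leq_add ?rank_mono.
Qed.

Lemma rankU1 e A : M (e |: A) <= (M A).+1.
Proof.
have := @rank_submod (e |: A) set0 [set e] A (subxx _) (sub0set _).
have := mrank_card M [set e]; rewrite cards1 rank0; rlia.
Qed.

Lemma rankU1_ge e A : M A <= M (e |: A).
Proof. by rewrite rank_mono ?subsetU1. Qed.

Definition cl A := [set e | M (e |: A) == M A].

Lemma clP e A : reflect (M (e |: A) = M A) (e \in cl A).
Proof. by rewrite inE; exact: eqP. Qed.

Lemma notin_cl e A : e \notin cl A -> M (e |: A) = (M A).+1.
Proof. by rewrite inE => /eqP; have := rankU1 e A; have := rankU1_ge e A; rlia. Qed.

Lemma notin_clI e A : M (e |: A) = (M A).+1 -> e \notin cl A.
Proof. by rewrite inE => ->; apply/eqP; rlia. Qed.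

Lemma sub_cl A : A \subset cl A.
Proof. by apply/subsetP => e eA; apply/clP; rewrite setUC (setUidPl _) ?sub1set. Qed.

Lemma mem_cl e A : e \in A -> e \in cl A.
Proof. exact: (subsetP (sub_cl A)). Qed.

Lemma mem_cl1 e : e \in cl [set e].
Proof. by apply: mem_cl; rewrite inE. Qed.

Lemma clS A B : A \subset B -> cl A \subset cl B.
Proof.
move=> sAB; apply/subsetP => e /clP eA; apply/clP.
have := @rank_submod (e |: B) A (e |: A) B; rewrite eA.
have := rankU1_ge e B.
have s1 : e |: B \subset e |: A :|: B by stauto.
have s2 : A \subset (e |: A) :&: B by stauto.
by move=> h /(_ s1 s2); rlia.
Qed.

Lemma rankU_cl A B : B \subset cl A -> M (A :|: B) = M A.
Proof.
elim/set_ind1: B => [|e B IH]; first by rewrite setU0.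
rewrite subUset sub1set => /andP [eA sB].
have -> : A :|: (e |: B) = e |: (A :|: B) by stauto.
by rewrite -IH //; apply/clP; apply: (subsetP (clS (subsetUl A B))).
Qed.

Lemma rank_sub_cl A B : B \subset cl A -> M B <= M A.
Proof. by move=> s; rewrite -(rankU_cl s) rank_mono ?subsetUr. Qed.

Lemma rank_cl A : M (cl A) = M A.
Proof.
by apply/eqP; rewrite eqn_leq rank_sub_cl // rank_mono ?sub_cl.
Qed.

Lemma cl_idem A : cl (cl A) = cl A.
Proof.
apply/eqP; rewrite eqEsubset sub_cl andbT; apply/subsetP => e /clP h.
apply/clP; have := rankU1_ge e A.
have : M (e |: A) <= M (e |: cl A) by rewrite rank_mono ?setUS ?sub_cl.
rewrite h rank_cl; rlia.
Qed.

Lemma cl_sub A B : A \subset cl B -> cl A \subset cl B.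
Proof. by move/clS; rewrite cl_idem. Qed.

Lemma cl_eq A B : A \subset cl B -> B \subset cl A -> cl A = cl B.
Proof. by move=> sA sB; apply/eqP; rewrite eqEsubset !cl_sub. Qed.

Lemma cl_eq_rank A B : A \subset B -> M B <= M A -> B \subset cl A.
Proof.
move=> sAB le; apply/subsetP => e eB; apply/clP.
have := rankU1_ge e A; have : M (e |: A) <= M B by rewrite rank_mono //; stauto.
rlia.
Qed.

Lemma sub_cl_rank A B : M (A :|: B) <= M A -> B \subset cl A.
Proof.
by move=> h; apply: subset_trans (cl_eq_rank (subsetUl A B) h); apply: subsetUr.
Qed.

Definition indep A := M A == #|A|.

Lemma indep_sub A B : A \subset B -> indep B -> indep A.
Proof.
move=> sAB /eqP iB; rewrite /indep eqn_leq mrank_card /=.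
have := @rank_submod B set0 A (B :\: A); rewrite rank0.
have := cardsID A B; rewrite (setIidPr sAB).
have := mrank_card M (B :\: A).
have s1 : B \subset A :|: B :\: A by stauto.
move=> h1 h2 /(_ s1 (sub0set _)); rlia.
Qed.

Lemma indep0 : indep set0.
Proof. by rewrite /indep rank0 cards0. Qed.

Lemma indepU1 e A : indep A -> e \notin cl A -> indep (e |: A).
Proof.
move=> /eqP iA ne; rewrite /indep notin_cl // iA cardsU1.
by case: (boolP (e \in A)) => // /mem_cl h; rewrite h in ne.
Qed.

Lemma indep_ext I A : I \subset A -> indep I ->
  exists2 J : {set E}, I \subset J /\ J \subset A & indep J /\ M J = M A.
Proof.
move=> sIA iI.
have [n le] : exists n, M A <= M I + n by exists (M A); rlia.
elim: n => [|n IH] in I sIA iI le *.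
  exists I => //; split=> //; have := rank_mono sIA; rlia.
have [sA|] := boolP (A \subset cl I).
  exists I => //; split=> //; have := rank_sub_cl sA; have := rank_mono sIA; rlia.
case/subsetPn => e eA ne; have re := notin_cl ne.
have [||//|J [s1 s2] iJ] := IH (e |: I); [by stauto|exact: indepU1|rlia|].
by exists J => //; split=> //; stauto.
Qed.

Lemma rank_basis A : exists2 I : {set E}, I \subset A & indep I /\ M I = M A.
Proof. by have [I [_ s] h] := indep_ext (sub0set A) indep0; exists I. Qed.

Lemma notin_cl_indep e A : indep A -> e \in A -> e \notin cl (A :\ e).
Proof.
move=> iA eA; apply: notin_clI; rewrite setD1K //.
have /eqP := indep_sub (subsetDl A [set e]) iA.
by move/eqP: iA => -> ->; rewrite (cardsD1 e A) eA.
Qed.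

Definition is_basis I := indep I /\ M I = M setT.

Lemma indep_extend_basis I : indep I -> exists2 B : {set E}, I \subset B & is_basis B.
Proof. by case/(indep_ext (subsetT _)) => B [sB _] bB; exists B. Qed.

Lemma card_basis I : is_basis I -> #|I| = M setT.
Proof. by case=> /eqP <-. Qed.

Lemma rankD1_basis I h : is_basis I -> h \in I -> (M (I :\ h)).+1 = M setT.
Proof.
by case=> iI <- hI; rewrite -(notin_cl (notin_cl_indep iI hI)) setD1K.
Qed.

Lemma basis_swap I h h' : is_basis I -> h \in I -> h' \notin cl (I :\ h) ->
  is_basis (h' |: (I :\ h)).
Proof.
move=> bI hI hh'; have [iI rI] := bI; split.
  by apply: indepU1 hh'; apply: indep_sub iI; apply: subsetDl.
by rewrite notin_cl // rankD1_basis.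
Qed.

(** The basis exchange graph is connected: an element of I outside J is replaced by an element of J
    off the hyperplane spanned by the rest of I, which brings I closer to J. *)
Lemma basis_chain (R : {set E} -> {set E} -> Prop) :
  (forall I, is_basis I -> R I I) ->
  (forall I J K, is_basis J -> R I J -> R J K -> R I K) ->
  (forall I h h', is_basis I -> h \in I -> h' \notin cl (I :\ h) ->
     R I (h' |: (I :\ h))) ->
  forall I J, is_basis I -> is_basis J -> R I J.
Proof.
move=> R0 Rt Rs I J bI bJ.
have [n le] : exists n, #|I :\: J| <= n by exists #|I :\: J|.
elim: n => [|n IH] in I bI le *.
  have sIJ : I \subset J by rewrite -setD_eq0 -cards_eq0; move: le; rewrite leqn0.
  suff -> : I = J by exact: R0.
  by apply/eqP; rewrite eqEcard sIJ (card_basis bI) (card_basis bJ) leqnn.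
have [I0|[h]] := set_0Vmem (I :\: J); first by apply: IH; rewrite // I0 cards0.
rewrite inE => /andP[hJ hI].
have [sub|] := boolP (J \subset cl (I :\ h)).
  by have := rank_sub_cl sub; have := rankD1_basis bI hI; case: bJ => _ ->; rlia.
case/subsetPn => h' h'J nh.
apply: Rt (basis_swap bI hI nh) (Rs _ _ _ bI hI nh) (IH _ (basis_swap bI hI nh) _).
have : #|(h' |: I :\ h) :\: J| < #|I :\: J|.
  apply: proper_card; apply/properP; split.
    apply/subsetP => z; rewrite !inE => /andP[zJ].
    by case/orP => [/eqP zh|/andP[_ zI]]; rewrite zJ //; move: zJ; rewrite zh h'J.
  exists h; first by rewrite !inE hJ hI.
  by rewrite !inE hJ eqxx /= orbF; apply: contraNneq hJ => ->.
by move/leq_trans/(_ le).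
Qed.

(* If every hyperplane of H over Z contains P or contains Q, then H splits over
   Z into a part carrying P and a part carrying Q. The splittings obtained by
   contracting and by deleting an element of H are uncrossed. *)
Lemma linking (H Z P Q : {set E}) :
  (forall L : {set E}, L \subset H -> (M (L :|: Z)).+1 = M (H :|: Z) ->
     P \subset cl (L :|: Z) \/ Q \subset cl (L :|: Z)) ->
  P \subset cl (H :|: Z) -> Q \subset cl (H :|: Z) ->
  exists2 X : {set E}, X \subset H &
    M (X :|: Z :|: P) + M (H :\: X :|: Z :|: Q) <= M (H :|: Z) + M Z.
Proof.
have [n le] : exists n, #|H| <= n by exists #|H|.
elim: n => [|n IH] in H Z le *.
  move: le; rewrite leqn0 cards_eq0 => /eqP -> _; rewrite set0U => sP sQ.
  by exists set0; rewrite // setD0 set0U !rankU_cl.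
have [->|[g gH]] := set_0Vmem H.
  rewrite set0U => _ sP sQ.
  by exists set0; rewrite // setD0 set0U !rankU_cl.
move=> hyp sP sQ; set H' := H :\ g.
have card' : #|H'| <= n by move: le; rewrite (cardsD1 g H) gH.
have eHg : H' :|: (g |: Z) = H :|: Z.
  by rewrite setUA [H' :|: _]setUC setD1K.
have [|||Y sY rY] := IH H' (g |: Z) card'; rewrite ?eHg //.
  move=> L sL; rewrite setUA [L :|: _]setUC => rL; apply: hyp => //.
  by rewrite subUset sub1set gH (subset_trans sL) ?subsetDl.
have egH : g |: (H' :|: Z) = H :|: Z by rewrite -eHg; stauto.
have rgZ := rankU1 g Z; rewrite eHg in rY.
have [rH'|rH'] := eqVneq (M (H' :|: Z)) (M (H :|: Z)).
  have cH' : H :|: Z \subset cl (H' :|: Z).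
    by apply: cl_eq_rank; [rewrite setSU ?subsetDl|rewrite rH'].
  have [||| X sX rX] := IH H' Z card'.
  - by move=> L sL; rewrite rH' => rL; apply: hyp => //; rewrite (subset_trans sL) ?subsetDl.
  - exact: subset_trans sP (cl_sub cH').
  - exact: subset_trans sQ (cl_sub cH').
  have k1 : M ((X :&: Y) :|: Z :|: P) + M (g |: (X :|: Y) :|: Z :|: P)
    <= M (X :|: Z :|: P) + M (Y :|: (g |: Z) :|: P).
    by rewrite addnC; apply: rank_submod; stauto.
  have k2 : M (((H' :\: X) :&: (H' :\: Y)) :|: Z :|: Q) +
            M (g |: (H' :\: X :|: H' :\: Y) :|: Z :|: Q)
    <= M (H' :\: X :|: Z :|: Q) + M (H' :\: Y :|: (g |: Z) :|: Q).
    by rewrite addnC; apply: rank_submod; stauto.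
  have e1 : H :\: (X :&: Y) = g |: (H' :\: X :|: H' :\: Y).
    apply/setP => z; move/subsetP/(_ z): sX; move/subsetP/(_ z): sY.
    rewrite !inE; case: eqP => [->|_] /=; rewrite ?gH.
      by case: (g \in X); case: (g \in Y); intuition.
    by case: (z \in H); case: (z \in X); case: (z \in Y).
  have e2 : H :\: (g |: (X :|: Y)) = (H' :\: X) :&: (H' :\: Y).
    by apply/setP => z; rewrite !inE; case: (z \in H); case: (z \in X);
       case: (z \in Y); case: eqP.
  (* By [k1] and [k2] the two candidate splittings together cost at most twice the bound plus one,
     the extra one coming from [M (g |: Z) <= M Z + 1]; so the cheaper of them meets the bound. *)
  have [l1|l1] := leqP (M ((X :&: Y) :|: Z :|: P) +
     M (g |: (H' :\: X :|: H' :\: Y) :|: Z :|: Q)) (M (H :|: Z) + M Z).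
    exists (X :&: Y); last by rewrite e1.
    by apply: subset_trans (subsetDl H [set g]); stauto.
  exists (g |: (X :|: Y)); last by rewrite e2; rlia.
  by rewrite subUset sub1set gH; apply: subset_trans (subsetDl H [set g]); stauto.
(* Now g is a coloop of H over Z, so H' spans a hyperplane, whose closure contains P or Q by
   hypothesis; g joins the side of the other one. *)
have rH : M (H :|: Z) = (M (H' :|: Z)).+1.
  have := rankU1 g (H' :|: Z); have := rankU1_ge g (H' :|: Z).
  rewrite egH.
  move/eqP: rH'; rlia.
have cg (V : {set E}) : V \subset H' -> M (V :|: (g |: Z)) = (M (V :|: Z)).+1.
  move=> sV; have -> : V :|: (g |: Z) = g |: (V :|: Z) by stauto.
  apply: notin_cl; apply/negP => gV; have : g \in cl (H' :|: Z).
    by move: gV; apply/subsetP; rewrite clS // setSU.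
  by move/clP; rewrite egH rH; rlia.
have gz : M (g |: Z) = (M Z).+1.
  by have := cg set0 (sub0set _); rewrite !set0U.
have key (V R : {set E}) W : V \subset H' -> M (V :|: (g |: Z) :|: R) + W <= M (H :|: Z) + M (g |: Z) ->
   R \subset cl (H' :|: Z) -> M (V :|: Z :|: R) + W <= M (H :|: Z) + M Z.
  move=> sV h sR.
  have := @rank_submod (H :|: Z) (V :|: Z :|: R) (V :|: (g |: Z) :|: R) (H' :|: Z :|: R).
  rewrite (rankU_cl sR) => k.
  have s1 : H :|: Z \subset V :|: (g |: Z) :|: R :|: (H' :|: Z :|: R).
    by rewrite -eHg; stauto.
  have s2 : V :|: Z :|: R \subset (V :|: (g |: Z) :|: R) :&: (H' :|: Z :|: R) by stauto.
  have := k s1 s2; rlia.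
have sD : H' :\: Y \subset H' by exact: subsetDl.
case: (hyp H' (subsetDl _ _) (esym rH)) => s.
  exists Y; first by rewrite (subset_trans sY) ?subsetDl.
  have -> : H :\: Y :|: Z :|: Q = H' :\: Y :|: (g |: Z) :|: Q.
    apply/setP => z; move/subsetP/(_ z): sY; rewrite !inE.
    case: eqP => [->|_] /=; last by case: (z \in Y).
    by rewrite gH; case: (g \in Y); intuition.
  exact: (key Y P _ sY rY s).
exists (g |: Y); first by rewrite subUset sub1set gH (subset_trans sY) ?subsetDl.
have -> : H :\: (g |: Y) = H' :\: Y.
  by apply/setP => z; rewrite !inE; case: (z \in H); case: (z \in Y); case: eqP.
have -> : g |: Y :|: Z :|: P = Y :|: (g |: Z) :|: P by stauto.
by rewrite addnC in rY; rewrite addnC; exact: (key _ Q _ sD rY s).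
Qed.

End Rank.

(** * Minors and vertical connectivity *)

Section Minors.

Variables (E : finType) (M : matroid E).
Implicit Types (A B I S X : {set E}).

(** Contraction and restriction keep the ground set: the elements of I, respectively those outside
    S, become loops. All minors live on E, and words over E serve for each of them. *)
Definition contract_rank I A := M (A :|: I) - M I.

Lemma contract_rankE I A : contract_rank I A + M I = M (A :|: I).
Proof. by rewrite subnK // rank_mono ?subsetUr. Qed.

Lemma contract_card I A : contract_rank I A <= #|A|.
Proof.
have := contract_rankE I A; have := mrank_card M A.
have := @rank_submod _ M (A :|: I) set0 A I (subxx _) (sub0set _); rlia.
Qed.

Lemma contract_mono I A B :
  A \subset B -> contract_rank I A <= contract_rank I B.
Proof.
move=> s; have := contract_rankE I A; have := contract_rankE I B.
by have := rank_mono M (setSU I s); rlia.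
Qed.

Lemma contract_submod I A B :
  contract_rank I (A :|: B) + contract_rank I (A :&: B) <=
  contract_rank I A + contract_rank I B.
Proof.
have := contract_rankE I A; have := contract_rankE I B.
have := contract_rankE I (A :|: B); have := contract_rankE I (A :&: B).
have s1 : A :|: B :|: I \subset (A :|: I) :|: (B :|: I) by stauto.
have s2 : (A :&: B) :|: I \subset (A :|: I) :&: (B :|: I) by stauto.
by have := rank_submod M s1 s2; rlia.
Qed.

Definition contract I : matroid E :=
  Matroid (contract_card I) (@contract_mono I) (contract_submod I).

Lemma contractE I A : contract I A + M I = M (A :|: I).
Proof. exact: contract_rankE. Qed.

Lemma cl_contract I A : cl (contract I) A = cl M (A :|: I).
Proof.
apply/setP => e; rewrite !inE; have := contractE I A.
have := contractE I (e |: A); rewrite -setUA; rlia.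
Qed.

Definition restrict_rank S A := M (A :&: S).

Lemma restrict_card S A : restrict_rank S A <= #|A|.
Proof.
apply: leq_trans (mrank_card M _) _; apply: subset_leq_card; exact: subsetIl.
Qed.

Lemma restrict_mono S A B :
  A \subset B -> restrict_rank S A <= restrict_rank S B.
Proof. by move=> s; apply: rank_mono; apply: setSI. Qed.

Lemma restrict_submod S A B :
  restrict_rank S (A :|: B) + restrict_rank S (A :&: B) <=
  restrict_rank S A + restrict_rank S B.
Proof. by apply: rank_submod; stauto. Qed.

Definition restrict S : matroid E :=
  Matroid (restrict_card S) (@restrict_mono S) (restrict_submod S).

(* Vertical 3-connectivity, which ignores loops and parallel elements. *)
Definition vconn3 := [forall X : {set E},
  (M X < M setT) ==> (M (~: X) < M setT) ==> (M setT + 2 <= M X + M (~: X))].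

Lemma vconn3P : reflect (forall X, M X < M setT -> M (~: X) < M setT ->
  M setT + 2 <= M X + M (~: X)) vconn3.
Proof.
apply: (iffP forallP) => h X; last by apply/implyP => h1; apply/implyP; apply: h.
by move=> h1 h2; move: (h X); rewrite h1 h2.
Qed.

(** In M / F, the elements a and b are nonloops and not parallel. *)
Definition ind2 F a b := M (a |: (b |: F)) == (M F).+2.

Lemma ind2C F a b : ind2 F a b = ind2 F b a.
Proof. by rewrite /ind2 setUCA. Qed.

Lemma ind2_ge F a b : ind2 F a b = ((M F).+2 <= M (a |: (b |: F))).
Proof.
rewrite /ind2; have := rankU1 M a (b |: F); have := rankU1 M b F; rlia.
Qed.

(* Coline F such that the rank-2 contraction M / F has at least four
   parallel classes, i.e. is not binary. *)
Definition wide F := ((M F).+2 == M setT) && [exists a, exists b, exists c,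
  exists d, [&& ind2 F a b, ind2 F a c, ind2 F a d, ind2 F b c, ind2 F b d
              & ind2 F c d]].

Lemma wideP F : reflect ((M F).+2 = M setT /\ exists a b c d,
  [/\ ind2 F a b, ind2 F a c, ind2 F a d, ind2 F b c & ind2 F b d /\ ind2 F c d])
  (wide F).
Proof.
apply: (iffP andP) => -[/eqP rF h]; split=> //.
  move: h => /existsP[a /existsP[b /existsP[c /existsP[d /and5P[h1 h2 h3 h4 /andP[h5 h6]]]]]].
  by exists a, b, c, d; split.
case: h => a [b [c [d [h1 h2 h3 h4 [h5 h6]]]]].
apply/existsP; exists a; apply/existsP; exists b; apply/existsP; exists c.
by apply/existsP; exists d; rewrite h1 h2 h3 h4 h5 h6.
Qed.

(** Any two of the four directions span M together with F, so each of X and X' contains at most one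
    of them; two directions remain. *)
Lemma wide_pair F X X' : wide F -> M (X :|: F) < M setT -> M (X' :|: F) < M setT ->
  exists p q, [/\ p \notin X :|: X', q \notin X :|: X' & ind2 F p q].
Proof.
move=> /wideP[rF [a [b [c [d [h1 h2 h3 h4 [h5 h6]]]]]]] hX hX'.
have nb (Z : {set E}) p q : M (Z :|: F) < M setT -> ind2 F p q ->
    ~~ ((p \in Z) && (q \in Z)).
  rewrite -rF ind2_ge => hZ h; apply/negP => /andP[pZ qZ].
  have : M (p |: (q |: F)) <= M (Z :|: F) by rewrite rank_mono //; stauto.
  by rlia.
pose ok p q := (p \notin X :|: X') && (q \notin X :|: X').
have : [|| ok a b, ok a c, ok a d, ok b c, ok b d | ok c d].
  move: (nb X a b hX h1) (nb X a c hX h2) (nb X a d hX h3).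
  move: (nb X b c hX h4) (nb X b d hX h5) (nb X c d hX h6).
  move: (nb X' a b hX' h1) (nb X' a c hX' h2) (nb X' a d hX' h3).
  move: (nb X' b c hX' h4) (nb X' b d hX' h5) (nb X' c d hX' h6).
  rewrite /ok !inE.
  case: (a \in X); case: (b \in X); case: (c \in X); case: (d \in X) => //=;
  by case: (a \in X'); case: (b \in X'); case: (c \in X'); case: (d \in X').
by case/or4P => [||| /or3P[]] /andP[ok1 ok2];
  [exists a, b|exists a, c|exists a, d|exists b, c|exists b, d|exists c, d].
Qed.

End Minors.

(** * Splitter theorem: contracting an element of a wide coline *)

Section Splitter.

Variables (E : finType) (M : matroid E).
Implicit Types (A B F P T X Y : {set E}) (e f t : E).

Hypothesis M3 : vconn3 M.
Hypothesis simple : forall x y, M [set x] = 1 -> M [set y] = 1 ->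
  M [set x; y] <= 1 -> x = y.

Local Notation r := (M setT).

(* A witness, with guts element e and small side X, that M / e is not
   vertically 3-connected. *)
Definition config F e X :=
  [/\ wide M F /\ cl M F = F, e \in F /\ M [set e] = 1,
      [/\ M X < r, M (~: X) < r & M X + M (~: X) <= r + 2],
      e \in cl M X /\ e \in cl M (~: X) & M (X :|: F) < r].

Lemma sep_ge X : M X < r -> M (~: X) < r -> r + 2 <= M X + M (~: X).
Proof. by move/vconn3P: M3; apply. Qed.

Lemma pair_rank x y : x != y -> M [set x] = 1 -> M [set y] = 1 -> M [set x; y] = 2.
Proof.
move=> xy hx hy; have := rankU1 M x [set y].
have := contraNN (fun h => introT eqP (simple hx hy h)) xy; rlia.
Qed.

(** Passing to the closure of [~: X] keeps the ranks of both sides, since a drop on the side of X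
    would violate vertical 3-connectivity. *)
Lemma config_closed F e X : config F e X -> config F e (~: cl M (~: X)).
Proof.
case=> hF he [h1 h2 h3] [g1 g2] hs.
have sX : ~: cl M (~: X) \subset X by rewrite setCS sub_cl || rewrite -setCS setCK sub_cl.
have rX : M (~: cl M (~: X)) = M X.
  have := @sep_ge (~: cl M (~: X)); rewrite setCK rank_cl.
  have := rank_mono M sX; rlia.
split=> //; rewrite ?setCK ?rX ?rank_cl ?cl_idem //.
- split=> //; have /subsetP -> // : cl M X \subset cl M (~: cl M (~: X)).
  by apply: cl_sub; apply: cl_eq_rank; rewrite ?rX.
- by apply: leq_ltn_trans (rank_mono M _) hs; apply: setSU.
Qed.

Lemma config_of F e : wide M F -> cl M F = F -> e \in F -> M [set e] = 1 ->
  ~~ vconn3 (contract M [set e]) -> exists X, config F e X.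
Proof.
move=> wF cF eF re /forallPn[X]; rewrite !negb_imply -ltnNge.
have eT : setT :|: [set e] = setT by stauto.
have cT := contractE M [set e] setT; rewrite eT re in cT.
have c1 := contractE M [set e] X; have c2 := contractE M [set e] (~: X).
rewrite re in c1 c2; move=> /and3P[h1 h2 h3].
have m1 : M X <= M (X :|: [set e]) by rewrite rank_mono ?subsetUl.
have m2 : M (~: X) <= M (~: X :|: [set e]) by rewrite rank_mono ?subsetUl.
have := @sep_ge X.
have [|lX] := leqP r (M X); first rlia.
have [|lX'] := leqP r (M (~: X)); first rlia.
move=> /(_ isT isT) g.
have e1 : e \in cl M X by apply/clP; rewrite setUC; rlia.
have e2 : e \in cl M (~: X) by apply/clP; rewrite setUC; rlia.
(* The three submodular inequalities add up to [M (X :|: F) + M (~: X :|: F) <= 2r - 1]; the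
   decisive -1 is the rank of e, which F shares with the closures of both sides. *)
have small : M (X :|: F) < r \/ M (~: X :|: F) < r.
  have /wideP[rF _] := wF.
  have s1 := @rank_submod _ M (X :|: F) ((e |: X) :&: F) (e |: X) F.
  have s2 := @rank_submod _ M (~: X :|: F) ((e |: ~: X) :&: F) (e |: ~: X) F.
  have s3 := @rank_submod _ M F [set e] ((e |: X) :&: F) ((e |: ~: X) :&: F).
  move/clP: e1 => e1; move/clP: e2 => e2; rewrite e1 e2 re in s1 s2 s3.
  have {s1}s1 := s1 ltac:(stauto) (subxx _).
  have {s2}s2 := s2 ltac:(stauto) (subxx _).
  have {s3}s3 := s3 ltac:(stauto) ltac:(stauto).
  rlia.
case: small => sm; [exists X|exists (~: X)]; split=> //; rewrite ?setCK; split => //; rlia.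
Qed.

Lemma loopless X x : cl M (~: X) = ~: X -> x \in X -> M [set x] = 1.
Proof.
move=> cX xX; apply/eqP; rewrite eqn_leq.
have := rankU1 M x set0; rewrite setU0 rank0 => -> /=; rewrite lt0n.
apply/negP => /eqP h; have : x \in cl M (~: X).
  by apply: (subsetP (clS M (sub0set _))); apply/clP; rewrite setU0 rank0.
by rewrite cX inE xX.
Qed.

Section Minimal.

Variables (X : {set E}) (e : E).
Hypothesis closedX : cl M (~: X) = ~: X.
Hypothesis minX : forall F' e' X', #|X'| < #|X| -> ~ config F' e' X'.

(** Uncrossing of the separations X and P: since the corner outside both has rank at least 2, the
    opposite corner T satisfies [M (~: T) + M (e' |: T) <= r + 2]. If [~: T] did not span, T would
    give a configuration smaller than X; hence T and e' lie in rank 2. *)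
Lemma cut_side F e' P : config F e X -> e' \in X -> e' \in F ->
  [/\ M P < r, M (~: P) < r & M P + M (~: P) <= r + 2] ->
  e' \in cl M P -> e' \in cl M (~: P) -> 2 <= M (~: X :&: ~: P) ->
  M (X :&: P :\ e') <= 2 /\ M (e' |: (X :&: P :\ e')) <= 2.
Proof.
move=> [hF he [x1 x2 x3] [g1 g2] hs] e'X e'F [p1 p2 p3] q1 q2 hY.
set T := X :&: P :\ e'; set P0 := P :\ e'.
have cP0 : ~: P0 = e' |: ~: P by rewrite /P0; stauto.
have rP0 : M P0 = M P.
  have := @sep_ge P0; rewrite cP0 (clP _ _ _ q2).
  have := rank_mono M (subsetDl P [set e']); rewrite -/P0; rlia.
have cTe : T \subset X by rewrite /T; stauto.
have big : r + 2 <= M (X :|: P0) + M (~: X :&: ~: P0).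
  have : M (~: X :&: ~: P) <= M (~: X :&: ~: P0).
    by apply: rank_mono; rewrite /P0; stauto.
  have := @sep_ge (X :|: P0); rewrite setCU.
  have : M (~: X :&: ~: P0) <= M (~: X) by apply: rank_mono; stauto.
  have : M (X :|: P0) <= r by apply: rank_mono; stauto.
  rlia.
have u2 : M (~: T) + M (~: X :&: ~: P0) <= M (~: X) + M (~: P0).
  by apply: rank_submod; rewrite /T /P0; stauto.
have rc : M (~: P0) = M (~: P) by rewrite cP0; apply/clP.
have u3 : M (X :|: P0) + M (e' |: T) <= M X + M P.
  by rewrite -(clP _ _ _ q1); apply: rank_submod; rewrite /T /P0; stauto.
have rT : M T <= M X by exact: rank_mono.
have geT : M T <= M (e' |: T) by exact: rankU1_ge.
have [lt|ge] := leqP r (M (~: T)); last first.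
  have ltT : M T < r by exact: leq_ltn_trans rT x1.
  have h := sep_ge ltT ge.
  have e'T : e' \in cl M T by apply/clP; rlia.
  case: (@minX F e' T).
    apply: proper_card; apply/properP; split=> //; exists e' => //.
    by rewrite /T !inE eqxx.
  split=> //; first by split=> //; exact: loopless e'X.
  - by split; rlia.
  - by split=> //; apply: mem_cl; rewrite /T !inE eqxx.
  - by apply: leq_ltn_trans (rank_mono M _) hs; apply: setSU.
split; first rlia.
by have := rankU1 M e' T; rlia.
Qed.

(** P and its complement cut X into parts T and U that have rank at most 2 together with e'.
    Uncrossing once more, with e added to T, minimality puts T on the line through e and e'; what X
    has off this line then lies in U. *)
Lemma line_side F e' P : config F e X -> e' \in X -> e' \in F -> e \in P ->
  [/\ M P < r, M (~: P) < r & M P + M (~: P) <= r + 2] ->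
  e' \in cl M P -> e' \in cl M (~: P) ->
  2 <= M (~: X :&: ~: P) -> 2 <= M (~: X :&: P) ->
  (exists2 t, t \in X & t != e' /\ t \in cl M [set e; e']) /\
  M (e' |: (X :\: cl M [set e; e'])) <= 2.
Proof.
move=> cfg e'X e'F eP hP q1 q2 hY1 hY2.
have [a1 b1] := cut_side cfg e'X e'F hP q1 q2 hY1.
have [] := @cut_side F e' (~: P) cfg e'X e'F; rewrite ?setCK //.
  by case: hP => p1 p2 p3; split=> //; rlia.
move=> a2 b2.
case: cfg => [hF [eF re] [x1 x2 x3] [g1 g2] hs]; case: hP => p1 p2 p3.
have x4 : 3 <= M X by have := sep_ge x1 x2; rlia.
have eX : e \notin X by rewrite -in_setC -closedX.
have re' := loopless closedX e'X.
set T := X :&: P :\ e' in a1 b1; set U := X :&: ~: P :\ e' in a2 b2.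
have [U0|[u uU]] := set_0Vmem U.
  have : M X <= M (e' |: T).
    apply: rank_mono; apply/subsetP => x xX; rewrite /T !inE xX.
    case: (eqVneq x e') => //= ne; case xP: (x \in P) => //.
    by have := in_set0 x; rewrite -U0 /U !inE ne xX xP.
  rlia.
have [T0|[t tT]] := set_0Vmem T.
  have : M X <= M (e' |: U).
    apply: rank_mono; apply/subsetP => x xX; rewrite /U !inE xX.
    case: (eqVneq x e') => //= ne; case xP: (x \in P) => //.
    by have := in_set0 x; rewrite -T0 /T !inE ne xX xP.
  rlia.
set P0 := P :\ e'.
have ee' : e != e' by apply: contraNneq eX => ->.
have cP0 : ~: P0 = e' |: ~: P by rewrite /P0; stauto.
have rP0 : M P0 = M P.
  have := @sep_ge P0; rewrite cP0 (clP _ _ _ q2).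
  have := rank_mono M (subsetDl P [set e']); rewrite -/P0; rlia.
have big : r + 2 <= M (X :|: P0) + M (~: X :&: ~: P0).
  have : M (~: X :&: ~: P) <= M (~: X :&: ~: P0).
    by apply: rank_mono; rewrite /P0; stauto.
  have := @sep_ge (X :|: P0); rewrite setCU.
  have : M (~: X :&: ~: P0) <= M (~: X) by apply: rank_mono; stauto.
  have : M (X :|: P0) <= r by apply: rank_mono; stauto.
  rlia.
have eP0 : e \in P0 by rewrite /P0 !inE ee'.
have rc : M (~: P0) = M (~: P) by rewrite cP0; apply/clP.
have u1 : M (X :|: P0) + M (e |: T) <= M X + M P0.
  rewrite -(clP _ _ _ g1); apply: rank_submod; rewrite /T; first by stauto.
  by move: eP0; rewrite /P0 => eP0; stauto.
have u2 : M (~: (e |: T)) + M (~: X :&: ~: P0) <= M (~: X) + M (~: P0).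
  have sub : ~: X :&: ~: P0 \subset ~: X :\ e.
    by apply/subsetP => x; rewrite !inE; case: (eqVneq x e) => [->|_];
       rewrite ?ee' ?eP ?andbF // => /andP[].
  have : M (~: X :\ e) <= M (~: X) by apply: rank_mono; stauto.
  have : M (~: (e |: T)) + M (~: X :&: ~: P0) <= M (~: X :\ e) + M (~: P0).
    apply: rank_submod; first by rewrite /T /P0; stauto.
    by rewrite subsetI sub /=; stauto.
  rlia.
have u3 : M (X :|: P0) + M (e' |: (e |: T)) <= M X + M P.
  have -> : M P = M (e' |: P) by rewrite (clP _ _ _ q1).
  rewrite -(clP _ _ _ g1); apply: rank_submod; rewrite /T /P0; first by stauto.
  by stauto.
have rTX : M (e |: T) <= M X.
  rewrite -(clP _ _ _ g1); apply: rank_mono; rewrite /T; stauto.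
have geT := rankU1_ge M e' (e |: T).
have full : r <= M (~: (e |: T)).
  rewrite leqNgt; apply/negP => lt; have h := sep_ge (leq_ltn_trans rTX x1) lt.
  have e'T : e' \in cl M (e |: T) by apply/clP; rlia.
  case: (@minX F e' (e |: T)).
    (* The elements u and e' of X outside T make up for e, so [e |: T] is still smaller than X. *)
    have n1 : u \notin e' |: T.
      move: uU; rewrite /U /T !inE => /and3P[h1 h2 h3].
      by rewrite (negbTE h1) (negbTE h3) !andbF.
    have n2 : e' \notin T by rewrite /T !inE eqxx.
    have sub : u |: (e' |: T) \subset X by rewrite /T; stauto.
    have := subset_leq_card sub; rewrite !cardsU1 n1 n2.
    by case: (e \in T) => /=; rlia.
  split=> //; first by split; rlia.
    split=> //; apply: mem_cl; rewrite /T !inE eqxx /= orbF.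
    by rewrite eq_sym.
  apply: leq_ltn_trans (rank_mono M _) hs; rewrite /T; stauto.
have tX : t \in X by move: tT; rewrite /T !inE => /and3P[].
have rt := loopless closedX tX.
have et : e != t by apply: contraNneq eX => ->.
have ge2 : 2 <= M (e |: T).
  rewrite -(pair_rank et re rt); apply: rank_mono; stauto.
have r2 : M (e' |: (e |: T)) = 2 by rlia.
have sl : e' |: (e |: T) \subset cl M [set e; e'].
  apply: cl_eq_rank; first by stauto.
  by rewrite (pair_rank ee' re re') r2.
split.
  exists t => //; split; first by move: tT; rewrite /T !inE => /and3P[].
  apply: (subsetP sl); by rewrite !in_setU1 tT !orbT.
apply: leq_trans (rank_mono M _) b2; apply: setUS.
apply/subsetP => x; rewrite inE => /andP[xl xX].
have xe' : x != e'.
  by apply: contraNneq xl => ->; apply: (subsetP sl); rewrite !inE eqxx.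
rewrite /U !inE xe' xX /=; apply: contra xl => xP; apply: (subsetP sl).
by rewrite /T !inE xe' xX xP !orbT.
Qed.

Hypothesis bad : forall F f, wide M F -> cl M F = F -> f \in F -> M [set f] = 1 ->
  ~~ vconn3 (contract M [set f]).

(** The separation X' that spoils M / e' is crossed with X. Wideness of F gives rank at least 2 to
    the corner outside both. If the corner of X' outside X had smaller rank, it would be at most one
    point by simplicity, and minimality of X would force X into rank 2. *)
Lemma line_thru F e' : config F e X -> e' \in X -> e' \in F ->
  (exists2 t, t \in X & t != e' /\ t \in cl M [set e; e']) /\
  M (e' |: (X :\: cl M [set e; e'])) <= 2.
Proof.
move=> cfg e'X e'F; have re' := loopless closedX e'X.
have := cfg => -[[wF cF] [eF re] [x1 x2 x3] [g1 g2] hs].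
have [X0 cfg0] := config_of wF cF e'F re' (bad wF cF e'F re').
have {cfg0} := config_closed cfg0.
set X' := ~: cl M (~: X0) => cfg'.
have cX' : cl M (~: X') = ~: X' by rewrite setCK cl_idem.
clearbody X'; have := cfg' => -[_ _ hX' [k1 k2] hs'].
have := hX' => -[y1 y2 y3].
have hY : 2 <= M (~: X :&: ~: X').
  have [p [q [pn qn h]]] := wide_pair wF hs hs'.
  move/wideP: (wF) => [rF _].
  have := @rank_submod _ M (p |: (q |: F)) set0 [set p; q] F.
  rewrite (eqP h) rank0 => /(_ ltac:(stauto) (sub0set _)) h'.
  have : M [set p; q] <= M (~: X :&: ~: X').
    by apply: rank_mono; rewrite -setCU subUset !sub1set !(in_setC _ (X :|: X')) pn.
  rlia.
have [a1 b1] := cut_side cfg e'X e'F hX' k1 k2 hY.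
have x4 : 3 <= M X by have := sep_ge x1 x2; rlia.
have e'X' : e' \notin X' by rewrite -in_setC -cX'.
have hY' : 2 <= M (~: X :&: X').
  rewrite leqNgt; apply/negP => lt1.
  set T := X :&: X' :\ e' in a1 b1.
  have eX' : X' = T :|: (~: X :&: X').
    apply/setP => z; rewrite /T !inE; case: eqP => [->|_] /=.
      by rewrite (negbTE e'X') !andbF.
    by case: (z \in X); case: (z \in X').
  have := @rank_submod _ M X' set0 T (~: X :&: X'); rewrite -eX' rank0.
  move=> /(_ (subxx _) (sub0set _)) h.
  have c1 : #|~: X :&: X'| <= 1.
    apply/card_le1_eqP => y z; rewrite !inE => /andP[yn yX] /andP[zn zX].
    apply: simple; rewrite ?(loopless cX') //.
    have : M [set z; y] <= M (~: X :&: X').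
      by apply: rank_mono; rewrite subUset !sub1set !inE yn zn yX zX.
    rewrite setUC; rlia.
  have c2 : #|X'| <= #|T| + 1.
    by rewrite {1}eX' cardsU; rlia.
  have e'T : e' \notin T by rewrite /T !inE eqxx.
  have sTX : e' |: T \subset X by rewrite /T; stauto.
  have c4 : #|X| <= #|X'|.
    by rewrite leqNgt; apply/negP => lt; apply: minX lt cfg'.
  have eX : e' |: T = X.
    by apply/eqP; rewrite eqEcard sTX cardsU1 e'T; rlia.
  by rewrite eX in b1; rlia.
have [eX'|eX'] := boolP (e \in X').
  exact: (@line_side F e' X').
apply: (@line_side F e' (~: X')); rewrite ?(in_setC e) ?setCK //.
by split=> //; rlia.
Qed.

End Minimal.

Hypothesis bad : forall F f, wide M F -> cl M F = F -> f \in F -> M [set f] = 1 ->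
  ~~ vconn3 (contract M [set f]).

(** A minimal X consists of points of the line l through e and an element e' of F in X, together
    with one point u off l. By [line_thru] at u, no configuration on e and X has u in its flat; but
    exchanging the part of F in X for u produces one. *)
Lemma no_config n F e X : #|X| < n -> ~ config F e X.
Proof.
elim: n => [//|n IH] in F e X * => ltX cfg.
have [ltX'|geX] := ltnP #|~: cl M (~: X)| #|X|.
  by apply: (IH F e (~: cl M (~: X))); [rlia|exact: config_closed].
have sX : ~: cl M (~: X) \subset X by rewrite -setCS setCK sub_cl.
have cX : cl M (~: X) = ~: X.
  by apply: setC_inj; rewrite setCK; apply/eqP; rewrite eqEcard sX.
have minX F' e' X' : #|X'| < #|X| -> ~ config F' e' X'.
  by move=> lt; apply: IH; rlia.
have line F0 e0 := @line_thru X e cX minX bad F0 e0.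
have := cfg => -[[wF cF] [eF re] [x1 x2 x3] [g1 g2] hs].
have x4 : 3 <= M X by have := sep_ge x1 x2; rlia.
have eX : e \notin X by rewrite -in_setC -cX.
(* If F missed X, two directions of F outside X would make [~: X] spanning. *)
have [e' e'F e'X] : exists2 e', e' \in F & e' \in X.
  have [XF0|[x]] := set_0Vmem (F :&: X); last by rewrite inE => /andP[]; exists x.
  have [p [q [pn qn h]]] := wide_pair wF hs hs.
  move/wideP: (wF) => [rF _].
  have : M (p |: (q |: F)) <= M (~: X).
    apply: rank_mono; apply/subsetP => z.
    rewrite setUid in pn qn; rewrite !inE => /or3P[/eqP->//|/eqP->//|zF].
    by apply/negP => zX; have := in_set0 z; rewrite -XF0 inE zF zX.
  by rewrite (eqP h); rlia.
have [[t tX [te' tl]] W1] := line _ _ cfg e'X e'F.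
have re' := loopless cX e'X; have rt := loopless cX tX.
have ne x : x \in X -> e != x by move=> xX; apply: contraNneq eX => ->.
have lineE x y : x \in X -> y \in X -> x \in cl M [set e; y] ->
    cl M [set e; x] = cl M [set e; y].
  move=> xX yX xl; apply/eqP; rewrite eqEsubset; apply/andP.
  have s : [set e; x] \subset cl M [set e; y].
    by rewrite subUset !sub1set xl mem_cl // !inE eqxx.
  split; first exact: cl_sub.
  apply: cl_sub; apply: subset_trans (subset_trans _ _); last first.
  - apply: (@cl_eq_rank _ M [set e; x] (cl M [set e; y])) => //.
    by rewrite rank_cl !pair_rank ?ne //; apply: loopless cX _.
  - exact: sub_cl.
  - exact: subxx.
have tF : t \in F.
  by rewrite -cF; move: tl; apply/subsetP; apply: clS; stauto.
have [_ W2] := line _ _ cfg tX tF.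
rewrite (lineE t e') // in W2.
set l := cl M [set e; e'] in tl W1 W2; set W := X :\: l in W1 W2.
have rl : M l = 2 by rewrite rank_cl pair_rank ?ne.
have e'l : e' \in l by apply: mem_cl; rewrite !inE eqxx orbT.
have W1' : M W <= 1.
  rewrite leqNgt; apply/negP => W3.
  have i1 : e' \in cl M W by apply/clP; have := rankU1_ge M e' W; rlia.
  have i2 : t \in cl M W by apply/clP; have := rankU1_ge M t W; rlia.
  have sl : l \subset cl M W.
    apply: subset_trans (cl_sub _ : cl M [set e'; t] \subset _); last first.
      by rewrite subUset !sub1set i1.
    apply: cl_eq_rank; first by stauto.
    by rewrite rl pair_rank // eq_sym.
  have : M X <= M W.
    apply: rank_sub_cl; apply/subsetP => x xX.
    case xl : (x \in l); first exact: (subsetP sl).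
    by apply: mem_cl; rewrite /W inE xl xX.
  by have := rankU1_ge M e' W; rlia.
have [W0|[u uW]] := set_0Vmem W.
  have : M X <= M l.
    apply: rank_mono; apply/subsetP => x xX; apply/negPn/negP => xl.
    by have := in_set0 x; rewrite -W0 inE xX xl.
  rlia.
have uX : u \in X by move: uW; rewrite inE => /andP[].
have ul : u \notin l by move: uW; rewrite inE => /andP[].
have Xu x : x \in X -> x != u -> x \in l.
  move=> xX; apply: contraR => xl; apply/eqP; apply: simple.
  - exact: loopless cX xX.
  - exact: loopless cX uX.
  by apply: leq_trans W1'; rewrite rank_mono // subUset !sub1set !in_setD xX uX xl ul.
have noU F' : config F' e X -> u \notin F'.
  move=> cfg'; apply/negP => uF'.
  have [[x xX [xu xl] _]] := line _ _ cfg' uX uF'.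
  case/negP: ul; rewrite /l -(lineE x e') //; last exact: Xu.
  by rewrite (lineE x u) // mem_cl // !inE eqxx orbT.
have uF := noU _ cfg.
set FY := F :&: ~: X.
have eFY : e \in FY by rewrite !inE eF.
have sFY : FY \subset ~: X by exact: subsetIr.
have outX A x : A \subset ~: X -> x \in X -> M (x |: A) = (M A).+1.
  move=> sA xX; apply: notin_cl; apply/negP => xA.
  by have := subsetP (clS M sA) x xA; rewrite cX inE xX.
have sF : F \subset cl M (e' |: FY).
  apply/subsetP => f fF; have [fX|fX] := boolP (f \in X).
    have fl : f \in l by apply: Xu => //; apply: contraNneq uF => <-.
    by move: fl; apply/subsetP; apply: clS; stauto.
  by apply: mem_cl; rewrite !inE fF fX orbT.
have rFY : (M FY).+1 = M F.
  have := outX FY e' sFY e'X.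
  have : M (e' |: FY) <= M F by apply: rank_mono; rewrite /FY; stauto.
  by have := rank_sub_cl sF; rlia.
have /wideP[rF _] := wF.
have ruFY := outX FY u sFY uX.
(* As [~: X] is a flat, u and e' both raise the rank of each of its subsets by one. So F' has the
   rank of F, and replacing u by e' turns four directions over F into four over F'. *)
set F' := cl M (u |: FY).
have rF' : M F' = M F by rewrite rank_cl; rlia.
have rU A : M (A :|: F') = M (A :|: (u |: FY)).
  apply/eqP; rewrite eqn_leq; apply/andP; split.
    apply: rank_sub_cl; rewrite subUset; apply/andP; split.
      by apply: subset_trans (sub_cl M _); apply: subsetUl.
    by apply: clS; apply: subsetUr.
  by apply: rank_mono; apply: setUS; apply: sub_cl.
pose phi x := if x == u then e' else x.
have rk A : M (A :|: F) <= M (A :|: (e' |: FY)).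
  apply: rank_sub_cl; rewrite subUset; apply/andP; split.
    by apply: subset_trans (sub_cl M _); apply: subsetUl.
  by apply: subset_trans sF _; apply: clS; apply: subsetUr.
have nX F0 x y : cl M F0 = F0 -> ind2 M F0 x y -> x \notin F0.
  move=> cF0; rewrite ind2_ge => h; apply/negP => xF0.
  move: h; have -> : x |: (y |: F0) = y |: F0 by stauto.
  by have := rankU1 M y F0; rlia.
have onX x y : ind2 M F x y -> x != u -> x \notin X.
  move=> h xu; have xF := nX _ _ _ cF h; apply: contra xF => xX.
  rewrite -cF; have xl := Xu _ xX xu.
  by move: xl; apply/subsetP; apply: clS; stauto.
have key x y : ind2 M F x y -> ind2 M F' (phi x) (phi y).
  have half a b : ind2 M F a b -> b != u -> ind2 M F' (phi a) b.
    move=> h bu; have bX : b \notin X by apply: onX bu; rewrite ind2C; exact: h.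
    rewrite ind2_ge rF' setUA rU /phi.
    move: (h); rewrite ind2_ge setUA => /leq_trans -/(_ _ (rk _)).
    case: (eqVneq a u) => [->|au].
      have -> // : [set u] :|: [set b] :|: (e' |: FY) =
        [set e'] :|: [set b] :|: (u |: FY) by stauto.
    have aX := onX _ _ h au.
    have s : a |: (b |: FY) \subset ~: X.
      by apply/subsetP => z; rewrite !inE => /or3P[/eqP->//|/eqP->//|/andP[]].
    have e1 x0 : [set a] :|: [set b] :|: (x0 |: FY) = x0 |: (a |: (b |: FY)).
      by stauto.
    by rewrite !e1 (outX _ e' s e'X) (outX _ u s uX).
  move=> h; case: (eqVneq y u) => [yu|yu]; last first.
    by rewrite {2}/phi (negbTE yu); apply: half.
  case: (eqVneq x u) => [xu|xu].
    by move: h; rewrite xu yu ind2_ge setUA setUid; have := rankU1 M u F; rlia.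
  by rewrite ind2C {2}/phi (negbTE xu); apply: half; rewrite // ind2C.
have wF' : wide M F'.
  apply/wideP; split; first by rewrite rF'.
  case: (wideP _ _ wF) => _ [a [b [c [d [h1 h2 h3 h4 [h5 h6]]]]]].
  by exists (phi a), (phi b), (phi c), (phi d); split; try split; apply: key.
have uF' : u \in F' by apply: mem_cl; rewrite !inE eqxx.
have /negP[] // : u \notin F'.
apply: noU; split=> //.
- by split=> //; exact: cl_idem.
- by split=> //; apply: mem_cl; rewrite !inE eF eX orbT.
rewrite rU.
have : M (X :|: (u |: FY)) <= M (u |: (e' |: FY)).
  apply: rank_sub_cl; apply/subsetP => z.
  rewrite in_setU in_setU1 => /or3P[zX|/eqP->|zF].
  - case: (eqVneq z u) => [->|zu]; first by apply: mem_cl; rewrite !inE eqxx.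
    by have := Xu _ zX zu; apply/subsetP; apply: clS; stauto.
  - by apply: mem_cl; rewrite !inE eqxx.
  - by apply: mem_cl; rewrite !in_setU1 zF !orbT.
by have := rankU1 M u (e' |: FY); have := rankU1 M e' FY; rlia.
Qed.

End Splitter.

(** * Reduction of the splitter theorem to simple matroids *)

Section SplitterGeneral.

Variables (E : finType).
Implicit Types (M : matroid E) (A B F X Y : {set E}) (e f x y : E).

Lemma rank1_mem_cl M x y : M [set x] = 1 -> M [set y] = 1 -> y \in cl M [set x] ->
  cl M [set y] = cl M [set x].
Proof.
move=> rx ry yx; apply/eqP; rewrite eqEsubset cl_sub ?sub1set //=.
by apply/cl_sub/sub_cl_rank; rewrite ry setUC -rx rank_sub_cl //
  subUset !sub1set yx mem_cl1.
Qed.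

Lemma ind2_cl M F a b : ind2 M (cl M F) a b = ind2 M F a b.
Proof.
rewrite /ind2 rank_cl; congr (_ == _).
apply/eqP; rewrite eqn_leq; apply/andP; split; last first.
  by apply: rank_mono; do 2 apply: setUS; apply: sub_cl.
apply: rank_sub_cl; rewrite !setUA subUset; apply/andP; split.
  by apply: subset_trans (sub_cl M _); apply: subsetUl.
by apply: clS; apply: subsetUr.
Qed.

Lemma wide_cl M F : wide M F -> wide M (cl M F).
Proof.
case/wideP => rF [a [b [c [d h]]]]; apply/wideP; rewrite rank_cl; split=> //.
by exists a, b, c, d; rewrite !ind2_cl.
Qed.

Lemma exists_nonloop M A : 0 < M A -> exists2 e, e \in A & M [set e] = 1.
Proof.
move=> rA; have [s|] := boolP (A \subset cl M set0).
  by have := rank_sub_cl s; rewrite rank0; move: rA; case: (M A).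
case/subsetPn => e eA /notin_cl; rewrite setU0 rank0 => h; by exists e.
Qed.

Lemma splitter_simple M F : vconn3 M ->
  (forall x y, M [set x] = 1 -> M [set y] = 1 -> M [set x; y] <= 1 -> x = y) ->
  2 < M setT -> wide M F ->
  exists F' e, [/\ wide M F', M [set e] = 1, e \in F' & vconn3 (contract M [set e])].
Proof.
move=> M3 simple r3 wF.
have [/existsP[F' /existsP[e /and4P[h1 h2 h3 h4]]]|none] := boolP [exists F' : {set E},
  exists e, [&& wide M F', M [set e] == 1, e \in F' & vconn3 (contract M [set e])]].
  by exists F', e; rewrite h1 (eqP h2).
have bad F' f : wide M F' -> cl M F' = F' -> f \in F' -> M [set f] = 1 ->
    ~~ vconn3 (contract M [set f]).
  move=> h1 _ h3 h2; apply: contra none => h4.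
  by apply/existsP; exists F'; apply/existsP; exists f; rewrite h1 h2 h3 h4.
have wF' := wide_cl wF; have /wideP[rF _] := wF'.
have [|e eF re] := @exists_nonloop M (cl M F); first by move: r3; rewrite -rF; case: (M _).
have [X cfg] := config_of M3 wF' (cl_idem _ _) eF re (bad _ _ wF' (cl_idem _ _) eF re).
by case: (no_config M3 simple bad (ltnSn _) cfg).
Qed.

(* The simplification of M is its restriction to a transversal of the
   parallel classes. *)
Lemma splitter M F : vconn3 M -> 2 < M setT -> wide M F ->
  exists F' e, [/\ wide M F', M [set e] = 1, e \in F' & vconn3 (contract M [set e])].
Proof.
move=> M3 r3 wF.
pose K x := [set y in cl M [set x] | M [set y] == 1].
(* [pick] depends only on the set [K x], so parallel elements get the same representative. *)
pose rep x := odflt x [pick y in K x].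
pose S := [set rep x | x in [pred x | M [set x] == 1]].
have repP x : M [set x] = 1 -> [/\ rep x \in cl M [set x], M [set rep x] = 1 & rep x \in S].
  move=> rx; have Kx : x \in K x by rewrite in_set mem_cl1 rx.
  have xS : rep x \in S by apply: imset_f; rewrite inE rx.
  move: xS; rewrite /rep; case: pickP => [y|/(_ x)]; last by rewrite Kx.
  by rewrite in_set => /andP[? /eqP].
have repK x : M [set x] = 1 -> x \in cl M [set rep x].
  move=> rx; have [h1 h2 _] := repP x rx.
  by rewrite (rank1_mem_cl rx h2 h1) mem_cl1.
have loop x A : M [set x] != 1 -> x \in cl M A.
  move=> rx; apply: (subsetP (clS M (sub0set A))); apply/clP; rewrite setU0 rank0.
  by have := rankU1 M x set0; move: rx; rewrite setU0 rank0; case: (M _) => [|[]].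
have spanS A : A \subset cl M (cl M A :&: S).
  apply/subsetP => a aA; have [ra|] := eqVneq (M [set a]) 1; last exact: loop.
  have [h1 h2 h3] := repP a ra; apply: (subsetP (clS M _)) (repK a ra).
  rewrite sub1set inE h3 andbT; apply: (subsetP (clS M _)) h1.
  by rewrite sub1set.
have rS A : M (cl M A :&: S) = M A.
  apply/eqP; rewrite eqn_leq rank_sub_cl ?subsetIl //=.
  exact: rank_sub_cl (spanS A).
pose N := restrict M S.
have NE A : N A = M (A :&: S) by [].
have rN : N setT = M setT.
  rewrite NE -(rS setT); congr (M (_ :&: _)); apply/esym/eqP.
  by rewrite eqEsubset subsetT sub_cl.
have rk1 x : N [set x] = 1 -> x \in S /\ M [set x] = 1.
  rewrite NE => h; have xS : x \in S.
    apply: contraT => xS; move: h; have -> : [set x] :&: S = set0.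
      by apply/setP => z; rewrite !inE; case: eqP => // ->; apply: negbTE.
    by rewrite rank0.
  by move: h; rewrite (setIidPl _) ?sub1set.
have N3 : vconn3 N.
  apply/vconn3P => X h1 h2; pose Y := [set x | rep x \in X].
  have sub (B : {set E}) (Q : pred E) : (forall x, Q x -> rep x \in B) ->
      [set x | Q x] \subset cl M (B :&: S).
    move=> h; apply/subsetP => x; rewrite inE => Qx.
    have [rx|] := eqVneq (M [set x]) 1; last exact: loop.
    have [_ _ h3] := repP x rx; apply: (subsetP (clS M _)) (repK x rx).
    by rewrite sub1set inE h3 h.
  have l1 : M Y <= N X by apply: rank_sub_cl; apply: sub.
  have l2 : M (~: Y) <= N (~: X).
    apply: rank_sub_cl; have -> : ~: Y = [set x | rep x \notin X].
      by apply/setP => x; rewrite !inE.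
    by apply: sub => x; rewrite !inE.
  rewrite rN in h1 h2 *.
  by have := vconn3P _ M3 Y (leq_ltn_trans l1 h1) (leq_ltn_trans l2 h2); rlia.
have simple x y : N [set x] = 1 -> N [set y] = 1 -> N [set x; y] <= 1 -> x = y.
  move=> /rk1[xS rx] /rk1[yS ry]; rewrite NE (setIidPl _) ?subUset ?sub1set ?xS //.
  move=> rxy; have yx : y \in cl M [set x] by apply/clP; have := rankU1_ge M y [set x]; rewrite setUC; rlia.
  move: xS yS => /imsetP[x0 /eqP rx0 ex] /imsetP[y0 /eqP ry0 ey].
  have [h1 h2 _] := repP x0 rx0; have [h3 h4 _] := repP y0 ry0.
  have eK : K x0 = K y0.
    rewrite /K -(rank1_mem_cl rx0 h2 h1) -(rank1_mem_cl ry0 h4 h3) -ex -ey.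
    by rewrite (rank1_mem_cl rx ry).
  rewrite ex ey /rep eK; case: pickP => // /(_ (rep y0)).
  by rewrite in_set h3 h4.
have wN : wide N (cl M F).
  case/wideP: wF => rF [a [b [c [d h]]]]; apply/wideP; rewrite NE rS rN; split=> //.
  have key p q : ind2 M F p q -> ind2 N (cl M F) (rep p) (rep q).
    have nl p' q' : ind2 M F p' q' -> M [set p'] = 1.
      move=> h'; apply/eqP; apply: contraLR h' => /(loop _ (q' |: F)) /clP.
      by rewrite ind2_ge -ltnNge => ->; rewrite ltnS rankU1.
    move=> hpq; have rp := nl _ _ hpq; have rq : M [set q] = 1 by apply: (nl q p); rewrite ind2C.
    have [p1 p2 p3] := repP p rp; have [q1 q2 q3] := repP q rq.
    rewrite ind2_ge !NE rS; move: hpq; rewrite ind2_ge => /leq_trans; apply.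
    apply: rank_sub_cl; rewrite !subUset !sub1set; apply/and3P; split.
    - by apply: (subsetP (clS M _)) (repK p rp); rewrite sub1set !inE eqxx p3.
    - by apply: (subsetP (clS M _)) (repK q rq); rewrite sub1set !inE eqxx q3 orbT.
    - by apply: subset_trans (spanS F) (clS _ (setSI _ _)); rewrite setUA subsetUr.
  by exists (rep a), (rep b), (rep c), (rep d);
     case: h => h1 h2 h3 h4 [h5 h6]; split; try split; apply: key.
have [|F' [e [w1 w2 w3 w4]]] := splitter_simple N3 simple _ wN; first by rewrite rN.
have [eS re] := rk1 e w2.
have up p q : ind2 N F' p q -> ind2 M (F' :&: S) p q.
  rewrite !ind2_ge !NE => /leq_trans; apply; apply: rank_mono.
  by apply/subsetP => z; rewrite !inE => /andP[/or3P[->|->|->] ->]; rewrite ?orbT.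
exists (F' :&: S), e; split; [|exact: re|by rewrite inE w3|]; last first.
  apply/vconn3P => X; have := vconn3P _ w4 X.
  have := contractE M [set e] X; have := contractE M [set e] (~: X).
  have := contractE M [set e] setT; have := contractE N [set e] setT.
  have := contractE N [set e] X; have := contractE N [set e] (~: X).
  have m A : N A <= M A by rewrite NE rank_mono ?subsetIl.
  have := m (X :|: [set e]); have := m (~: X :|: [set e]).
  have -> : setT :|: [set e] = setT by stauto.
  rewrite rN w2 re; rlia.
case/wideP: w1 => rF [a [b [c [d h]]]]; apply/wideP; rewrite -rN -rF; split=> //.
by exists a, b, c, d; case: h => h1 h2 h3 h4 [h5 h6]; split; try split; apply: up.
Qed.

End SplitterGeneral.

(** * Permutations of the field of order four *)

Section Field4.

Import GRing.Theory.
Local Open Scope ring_scope.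

Variables (F : finFieldType) (cardF : #|F| = 4%N).
Implicit Types (a b c s t u x y : F) (g h : F -> F) (k l : bool).

Lemma f4_exp4 x : x ^+ 4 = x.
Proof. by rewrite -[in LHS]cardF expf_card. Qed.

Lemma f4_addxx x : x + x = 0.
Proof.
have h : (-1) ^+ 4 = -1 :> F by exact: f4_exp4.
have h1 : 1 = -1 :> F by rewrite -h -signr_odd expr0.
by rewrite -[x]mulr1 -mulrDr {2}h1 subrr mulr0.
Qed.

Lemma f4_opp x : - x = x.
Proof. by apply: (addrI x); rewrite subrr f4_addxx. Qed.

Lemma f4_addr_eq0 x y : (x + y == 0) = (x == y).
Proof. by rewrite addr_eq0 f4_opp. Qed.

Lemma f4_square x : x != 0 -> x != 1 -> x ^+ 2 = x + 1.
Proof.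
move=> x0 x1; have h : x * (x - 1) * (x ^+ 2 - (x + 1)) = 0.
  have -> : x * (x - 1) * (x ^+ 2 - (x + 1)) = (x ^+ 4 - x) + (x + x) - (x ^+ 3 + x ^+ 3) by ring.
  by rewrite !f4_addxx f4_exp4 subrr addr0 subr0.
move/eqP: h; rewrite !mulf_eq0 subr_eq0 (negbTE x0) (negbTE x1) /=.
by rewrite subr_eq0 => /eqP.
Qed.

Lemma f4_outside01 x y : x != 0 -> x != 1 -> y != 0 -> y != 1 -> y = x \/ y = x ^+ 2.
Proof.
move=> x0 x1 y0 y1; have hx := f4_square x0 x1; have hy := f4_square y0 y1.
have : (y - x) * (y - (x + 1)) = 0.
  have -> : (y - x) * (y - (x + 1)) = (y ^+ 2 - (y + 1)) + (x ^+ 2 - (x + 1))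
    + (x + 1 + (x + 1)) - (x * y + x * y) by ring.
  by rewrite hx hy !f4_addxx !subrr subr0 !addr0.
by rewrite hx; move/eqP; rewrite mulf_eq0 !subr_eq0 => /orP[] /eqP ->; [left|right].
Qed.

Lemma f4_exists : exists w : F, w != 0 /\ w != 1.
Proof.
have [/existsP[w /andP[]]|] := boolP [exists w : F, (w != 0) && (w != 1)]; first by exists w.
rewrite negb_exists => /forallP h; have : (#|F| <= #|[set (0%R : F); 1%R]|)%N.
  by rewrite subset_leq_card //; apply/subsetP => x _; have := h x; rewrite negb_and !negbK !inE.
by rewrite cardF cards2; case: (_ != _).
Qed.

Definition frob k x := if k then x ^+ 2 else x.

Lemma frobD k x y : frob k (x + y) = frob k x + frob k y.
Proof.
case: k => //=; have -> : (x + y) ^+ 2 = x ^+ 2 + y ^+ 2 + (x * y + x * y) by ring.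
by rewrite f4_addxx addr0.
Qed.

Lemma frobM k x y : frob k (x * y) = frob k x * frob k y.
Proof. by case: k => //=; rewrite exprMn. Qed.

Lemma frob_comp k l x : frob k (frob l x) = frob (k (+) l) x.
Proof. by case: k; case: l => //=; rewrite -exprM f4_exp4. Qed.

Lemma frobK k : involutive (frob k).
Proof. by move=> x; rewrite frob_comp addbb. Qed.

Lemma frob0 k : frob k 0 = 0.
Proof. by case: k; rewrite /= ?expr0n. Qed.

Lemma frob_eq0 k x : (frob k x == 0) = (x == 0).
Proof. by case: k; rewrite /= ?expf_eq0. Qed.

(** After an affine normalisation g fixes 0 and 1, hence fixes or swaps the two other elements, and
    the swap is squaring. *)
Lemma f4_perm_form g : injective g ->
  exists a b k, a != 0 /\ forall x, g x = a * frob k x + b.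
Proof.
move=> ig; pose a := g 1 - g 0; have a0 : a != 0.
  by rewrite subr_eq0; apply/eqP => /ig/eqP; rewrite oner_eq0.
pose h x := (g x - g 0) / a.
have gh x : g x = a * h x + g 0 by rewrite /h mulrCA divff // mulr1 subrK.
have ih : injective h by move=> x y e; apply: ig; rewrite (gh x) (gh y) e.
have h0 : h 0 = 0 by rewrite /h subrr mul0r.
have h1 : h 1 = 1 by rewrite /h divff.
have hout x : x != 0 -> x != 1 -> h x != 0 /\ h x != 1.
  by rewrite -{2}h0 -{2}h1 !(inj_eq ih).
have [w [w0 w1]] := f4_exists; have [hw0 hw1] := hout _ w0 w1.
have ww : w ^+ 2 != w by rewrite f4_square // addrC -subr_eq0 addrK oner_neq0.
have ww0 : w ^+ 2 != 0 by rewrite expf_neq0.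
have ww1 : w ^+ 2 != 1 by rewrite f4_square // -subr_eq0 addrK.
have [k hw] : exists k, h w = frob k w.
  by case: (f4_outside01 w0 w1 hw0 hw1) => ->; [exists false|exists true].
exists a, (g 0), k; split=> // x; rewrite gh; congr (_ * _ + _).
have [->|x0] := eqVneq x 0; first by rewrite h0 frob0.
have [->|x1] := eqVneq x 1; first by rewrite h1; case: k {hw}; rewrite /= ?expr1n.
case: (f4_outside01 w0 w1 x0 x1) => -> //.
have [hv0 hv1] := hout _ ww0 ww1.
case: (f4_outside01 ww0 ww1 hv0 hv1); rewrite -?exprM ?f4_exp4 => hv.
  rewrite hv; case: k hw => //= hw; case/eqP: ww; apply: ih.
  by rewrite hw hv.
rewrite hv; case: k hw => //= hw; first by rewrite -exprM f4_exp4.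
by case/eqP: ww; apply: ih; rewrite hw hv.
Qed.

(* The permutations of F are the maps a x + b and a x^2 + b, and the sum of
   x g(x) over F is 0 for the former and a for the latter. *)
Definition sgn g := \sum_x x * g x != 0.

Lemma f4_sum_scale (f : F -> F) c : c != 0 -> \sum_x f (c * x) = \sum_x f x.
Proof.
by move=> c0; rewrite [RHS](reindex (fun x => c * x)) //; exists (fun x => c^-1 * x) => x _;
   rewrite ?mulKf ?mulVKf.
Qed.

Lemma f4_sum : \sum_(x : F) x = 0.
Proof.
have [w [w0 w1]] := f4_exists; have := f4_sum_scale id w0.
rewrite /= -mulr_sumr => /eqP; rewrite -subr_eq0 -[X in _ - X]mul1r -mulrBl.
by rewrite mulf_eq0 subr_eq0 (negbTE w1) => /eqP.
Qed.

Lemma f4_sum_inj g : injective g -> \sum_x g x = 0.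
Proof. by move=> ig; rewrite -[RHS]f4_sum [RHS](reindex_inj ig). Qed.

Lemma sgn_form g a b k : a != 0 -> (forall x, g x = a * frob k x + b) -> sgn g = k.
Proof.
move=> a0 ge; rewrite /sgn.
have -> : \sum_x x * g x = a * \sum_x x * frob k x.
  rewrite mulr_sumr; under eq_bigr => x _ do rewrite ge mulrDr mulrCA.
  by rewrite big_split /= -mulr_suml f4_sum mul0r addr0.
rewrite mulf_eq0 (negbTE a0) /=; case: k {ge} => /=.
  (* Each of the three nonzero x contributes x * x^2 = 1, and 1 + 1 + 1 = 1. *)
  rewrite (bigD1 0) //= mul0r add0r (eq_bigr (fun=> 1)) => [|x x0]; last first.
    by apply: (mulfI x0); rewrite mulr1 -!exprS f4_exp4.
  rewrite sumr_const; have -> : #|[pred x : F | x != 0]| = 3%N.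
    by rewrite -[RHS]/(4.-1)%N -cardF -(cardC1 (0 : F)); apply: eq_card => x; rewrite !inE.
  by rewrite !mulrS mulr0n addr0 f4_addxx addr0 oner_neq0.
have -> : \sum_x x * x = frob true (\sum_x x).
  rewrite (big_morph (frob true) (frobD true) (frob0 true)).
  by apply: eq_bigr => x _; rewrite /= expr2.
by rewrite f4_sum frob0 eqxx.
Qed.

Lemma sgn_ext g h : g =1 h -> sgn g = sgn h.
Proof. by move=> e; rewrite /sgn; under eq_bigr do rewrite e. Qed.

Lemma sgnP g : injective g -> exists a b, a != 0 /\ forall x, g x = a * frob (sgn g) x + b.
Proof.
by case/f4_perm_form => a [b [k [a0 ge]]]; exists a, b; rewrite (sgn_form a0 ge).
Qed.

Lemma sgn_comp g h : injective g -> injective h -> sgn (g \o h) = sgn g (+) sgn h.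
Proof.
case/sgnP => a [b [a0 ge]] /sgnP[c [d [c0 he]]].
apply: (@sgn_form _ (a * frob (sgn g) c) (a * frob (sgn g) d + b)).
  by rewrite mulf_neq0 ?frob_eq0.
by move=> x; rewrite /= ge he frobD frobM frob_comp; ring.
Qed.

Lemma sgn_frob k : sgn (frob k) = k.
Proof. by apply: (@sgn_form _ 1 0) => [|x]; rewrite ?oner_neq0 // mul1r addr0. Qed.

(** With different signs the sum would be a x + c x^2 plus a constant, which takes the same value at
    0 and at a / c. *)
Lemma sgn_add_inj g h : injective g -> injective h ->
  injective (fun x => g x + h x) -> sgn g = sgn h.
Proof.
move=> ig ih igh; case: (eqVneq (sgn g) (sgn h)) => // ne; exfalso.
wlog [gf ht] : g h ig ih igh ne / sgn g = false /\ sgn h = true.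
  move=> H; case eg : (sgn g) ne; case eh : (sgn h) => // _.
    apply: (H h g) => //; last by rewrite eg eh.
    by move=> x y; rewrite [LHS]addrC [RHS]addrC; exact: igh.
  by apply: (H g h) => //; rewrite eg eh.
have [a [b [a0 ge]]] := sgnP ig; have [c [d [c0 he]]] := sgnP ih.
rewrite gf ht /= in ge he.
have /eqP : a / c = 0.
  apply: igh; rewrite !ge !he expr0n /= !mulr0.
  have -> : a * (a / c) + b + (c * (a / c) ^+ 2 + d) =
    (a * (a / c) + a * (a / c)) + (b + d) by field.
  by rewrite f4_addxx; ring.
by rewrite mulf_eq0 invr_eq0 (negbTE a0) (negbTE c0).
Qed.

(** Two rows of the same sign with different slopes agree in some column, so all rows share one
    slope. *)
Lemma latin_const_sgn (T : F -> F -> F) k :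
  (forall s, injective (T s)) -> (forall t, injective (T^~ t)) ->
  (forall s, sgn (T s) = k) ->
  exists a (beta : F -> F), [/\ a != 0, injective beta &
    forall s t, T s t = a * frob k t + beta s].
Proof.
move=> iT iT' sT.
have form s : exists a b, a != 0 /\ forall t, T s t = a * frob k t + b.
  by have := sgnP (iT s); rewrite sT.
have [a0 [b0 [a0n e0]]] := form 0.
have [beta be] : exists beta : F -> F, forall s t, T s t = a0 * frob k t + beta s.
  exists (fun s => T s 0) => s t; have [a [b [an e]]] := form s.
  have [ea|ne] := eqVneq a a0; first by rewrite !e ea frob0 mulr0 add0r.
  have ne' : a - a0 != 0 by rewrite subr_eq0.
  have es : s = 0.
    apply: (iT' (frob k ((b0 - b) / (a - a0)))); rewrite /= e e0 frobK.
    by field.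
  by move: e; rewrite es => e; rewrite !e0 frob0 mulr0 add0r.
exists a0, beta; split=> // s s' eb; apply: (iT' 0); by rewrite /= !be eb.
Qed.

Lemma f4_linear_frob a b : (forall t, a * t + b * t ^+ 2 = 0) -> a = 0 /\ b = 0.
Proof.
move=> h; have [w [w0 w1]] := f4_exists.
have h1 := h 1; rewrite mulr1 expr1n mulr1 in h1.
have hw := h w; have : b * (w * (w - 1)) = 0.
  have -> : b * (w * (w - 1)) = (a * w + b * w ^+ 2) - w * (a + b) by ring.
  by rewrite hw h1 mulr0 subrr.
move/eqP; rewrite !mulf_eq0 subr_eq0 (negbTE w0) (negbTE w1) !orbF => /eqP b0.
by rewrite b0 addr0 in h1.
Qed.

(** Rows 1 and 3 are a t + b1 and a t + b3, rows 2 and 4 are c t^2 + b2 and c t^2 + b4, and the t_i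
    are a transversal. Summing along it gives a = c u for u = t1 + t3, so a t + c t^2 takes only the
    values 0 and v = a u. Rows 1 and 3 never meet row 2, so b1 + b2 and b3 + b2 avoid these values
    and differ by v; then rows 1 and 3 have the same entry on the transversal. *)
Lemma no_transversal a c (b1 b2 b3 b4 t1 t2 t3 t4 : F) :
  a != 0 -> c != 0 -> b1 + b2 + b3 + b4 = 0 -> t1 + t2 + t3 + t4 = 0 -> t1 != t3 ->
  (forall t, a * t + b1 != c * t ^+ 2 + b2) ->
  (forall t, a * t + b3 != c * t ^+ 2 + b2) ->
  b1 != b3 -> a * t1 + b1 != a * t3 + b3 ->
  a * t1 + b1 + (c * t2 ^+ 2 + b2) + (a * t3 + b3) + (c * t4 ^+ 2 + b4) = 0 -> False.
Proof.
move=> a0 c0 sb st t13 d12 d32 b13 tt ss.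
set u := t1 + t3.
have u0 : u != 0 by rewrite f4_addr_eq0.
have eu : t2 + t4 = u.
  apply/eqP; rewrite -f4_addr_eq0 /u; apply/eqP; rewrite -st; ring.
have : a * u + c * u ^+ 2 = 0.
  have -> : u ^+ 2 = t2 ^+ 2 + t4 ^+ 2 by rewrite -eu -/(frob true _) frobD.
  by have := congr2 (fun p q => p - q) ss sb; rewrite /= subrr => <-; rewrite /u; ring.
have -> : a * u + c * u ^+ 2 = (a + c * u) * u by ring.
move/eqP; rewrite mulf_eq0 (negbTE u0) orbF f4_addr_eq0 => /eqP ea.
set v := a * u.
have v0 : v != 0 by rewrite mulf_neq0.
have ev z : a * (u * z) + c * (u * z) ^+ 2 = v * (z + z ^+ 2).
  by rewrite /v ea; ring.
have out m m' : (forall t, a * t + m != c * t ^+ 2 + m') ->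
    (m + m') / v != 0 /\ (m + m') / v != 1.
  move=> d; have d' t : m + m' != a * t + c * t ^+ 2.
    apply: contraNneq (d t) => e; rewrite -f4_addr_eq0; apply/eqP.
    have -> : a * t + m + (c * t ^+ 2 + m') = (a * t + c * t ^+ 2) + (m + m') by ring.
    by rewrite e f4_addxx.
  split.
    apply: contraNneq (d' 0) => /eqP; rewrite mulf_eq0 invr_eq0 (negbTE v0) orbF => /eqP ->.
    by rewrite expr0n /= !mulr0 addr0.
  have [w [w0 w1]] := f4_exists.
  apply: contraNneq (d' (u * w)) => e.
  by rewrite ev f4_square // addrA f4_addxx add0r mulr1 -[v]mul1r -e divfK.
have [m0 m1] := out _ _ d12; have [n0 n1] := out _ _ d32.
case: (f4_outside01 m0 m1 n0 n1).
  move/(mulIf (invr_neq0 v0))/addIr/eqP; rewrite eq_sym; exact: negP.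
rewrite f4_square // => e.
have e' : b3 + b2 = b1 + b2 + v by apply: (mulIf (invr_neq0 v0)); rewrite e [RHS]mulrDl divff.
have e3 : b3 = b1 + v by apply: (addIr b2); rewrite e'; ring.
case/eqP: tt; have -> : a * t3 + b3 = a * t1 + b1 + (a * t3 + a * t3).
  by rewrite e3 /v /u; ring.
by rewrite f4_addxx addr0.
Qed.

Lemma f4_enum s1 s2 : s1 != s2 -> exists s3 s4, uniq [:: s1; s2; s3; s4] /\
  forall f : F -> F, \sum_x f x = f s1 + f s2 + f s3 + f s4.
Proof.
move=> ne; have c2 : #|~: [set s1; s2]| = 2%N.
  by have := cardsC [set s1; s2]; rewrite cards2 ne cardF => -[].
move/eqP/cards2P: c2 => [s3 [s4 [n34 e34]]].
have o3 : s3 \in ~: [set s1; s2] by rewrite e34 !inE eqxx.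
have o4 : s4 \in ~: [set s1; s2] by rewrite e34 !inE eqxx orbT.
move: o3 o4; rewrite !inE !negb_or => /andP[n31 n32] /andP[n41 n42].
have un : uniq [:: s1; s2; s3; s4].
  by rewrite /= !inE !negb_or ne n34 ![s1 == _]eq_sym ![s2 == _]eq_sym n31 n32 n41 n42.
exists s3, s4; split=> // f.
have -> : \sum_x f x = \sum_(x <- [:: s1; s2; s3; s4]) f x.
  rewrite [RHS]big_uniq //; apply: eq_bigl => x; apply/esym.
  have : x \in [set s1; s2] :|: ~: [set s1; s2] by rewrite setUCr inE.
  by rewrite e34 !inE -orbA.
by rewrite !big_cons big_nil addr0 !addrA.
Qed.

(* A Latin square of order 4 with rows of both signs is the Cayley table of
   Z/4, which has no transversal. *)
Lemma latin_transversal_sgn (T : F -> F -> F) (tau : F -> F) :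
  (forall s, injective (T s)) -> (forall t, injective (T^~ t)) ->
  injective tau -> injective (fun s => T s (tau s)) ->
  forall s s', sgn (T s) = sgn (T s').
Proof.
move=> iT iT' itau iTt s s'; case: (eqVneq (sgn (T s)) (sgn (T s'))) => // ne; exfalso.
wlog [e1 e2] : s s' ne / sgn (T s) = false /\ sgn (T s') = true.
  move=> H; case es : (sgn (T s)) ne; case es' : (sgn (T s')) => // _.
    by apply: (H s' s); rewrite es es'.
  by apply: (H s s'); rewrite es es'.
have ss' : s != s' by apply: contraNneq ne => ->.
have [s3 [s4 [un sumE]]] := f4_enum ss'.
have col t : T s t + T s' t + T s3 t + T s4 t = 0.
  by rewrite -(sumE (T^~ t)) f4_sum_inj.
have dg : T s (tau s) + T s' (tau s') + T s3 (tau s3) + T s4 (tau s4) = 0.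
  by rewrite -(sumE (fun s => T s (tau s))) f4_sum_inj.
have st : tau s + tau s' + tau s3 + tau s4 = 0 by rewrite -(sumE tau) f4_sum_inj.
have [a1 [b1 [an1 f1]]] := sgnP (iT s); have [a2 [b2 [an2 f2]]] := sgnP (iT s').
have [a3 [b3 [an3 f3]]] := sgnP (iT s3); have [a4 [b4 [an4 f4]]] := sgnP (iT s4).
rewrite e1 e2 /= in f1 f2.
have colE t : a1 * t + b1 + (a2 * t ^+ 2 + b2) + (a3 * frob (sgn (T s3)) t + b3)
   + (a4 * frob (sgn (T s4)) t + b4) = 0 by rewrite -f1 -f2 -f3 -f4.
have sb : b1 + b2 + b3 + b4 = 0.
  by have := colE 0; rewrite expr0n /= !frob0 !mulr0 !add0r.
have lin t : a1 * t + a2 * t ^+ 2 + a3 * frob (sgn (T s3)) t + a4 * frob (sgn (T s4)) t = 0.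
  rewrite -(colE t) -[LHS]addr0 -sb; ring.
have Tne x y t : x != y -> T x t != T y t by move=> xy; apply: contra xy => /eqP/iT' ->.
have tne x y : x != y -> tau x != tau y by move=> xy; apply: contra xy => /eqP/itau ->.
have Ttne x y : x != y -> T x (tau x) != T y (tau y) by move=> xy; apply: contra xy => /eqP/iTt ->.
move: un; rewrite /= !inE !negb_or => /and4P[/and3P[n12 n13 n14] /andP[n23 n24] n34 _].
(* As t and t^2 are linearly independent functions, the vanishing column sums leave two rows of each
   sign, with equal slopes within a sign. *)
case e3 : (sgn (T s3)) f3 lin; case e4 : (sgn (T s4)) f4 => /= f4 f3 lin.
- have [] := @f4_linear_frob a1 (a2 + a3 + a4).
    by move=> t; rewrite -(lin t); ring.
  by move=> h; rewrite h eqxx in an1.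
- have [h1 h2] := @f4_linear_frob (a1 + a4) (a2 + a3) ltac:(by move=> t; rewrite -(lin t); ring).
  move/eqP: h1; rewrite f4_addr_eq0 => /eqP h1; move/eqP: h2; rewrite f4_addr_eq0 => /eqP h2.
  subst a4 a3.
  apply: (@no_transversal a1 a2 b1 b2 b4 b3 (tau s) (tau s') (tau s4) (tau s3)) => //.
  + by rewrite -sb; ring.
  + by rewrite -st; ring.
  + exact: tne.
  + by move=> t; rewrite -f1 -f2 Tne.
  + by move=> t; rewrite -f4 -f2 Tne // eq_sym.
  + by have := Tne s s4 0 n14; rewrite f1 f4 !mulr0 !add0r.
  + by rewrite -f1 -f4 Ttne.
  + by rewrite -f1 -f2 -f3 -f4 -dg; ring.
- have [h1 h2] := @f4_linear_frob (a1 + a3) (a2 + a4) ltac:(by move=> t; rewrite -(lin t); ring).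
  move/eqP: h1; rewrite f4_addr_eq0 => /eqP h1; move/eqP: h2; rewrite f4_addr_eq0 => /eqP h2.
  subst a4 a3.
  apply: (@no_transversal a1 a2 b1 b2 b3 b4 (tau s) (tau s') (tau s3) (tau s4)) => //.
  + exact: tne.
  + by move=> t; rewrite -f1 -f2 Tne.
  + by move=> t; rewrite -f3 -f2 Tne // eq_sym.
  + by have := Tne s s3 0 n13; rewrite f1 f3 !mulr0 !add0r.
  + by rewrite -f1 -f3 Ttne.
  + by rewrite -f1 -f2 -f3 -f4.
- have [] := @f4_linear_frob (a1 + a3 + a4) a2.
    by move=> t; rewrite -(lin t); ring.
  by move=> _ h; rewrite h eqxx in an2.
Qed.

End Field4.

(** * Codes *)

Section Parallel.

Variables (E : finType) (M : matroid E).
Implicit Types (A B L : {set E}) (e f : E).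

Definition par A f g := [&& f \notin cl M A, g \notin cl M A & g \in cl M (f |: A)].

Lemma par_clE A f g : par A f g -> cl M (g |: A) = cl M (f |: A).
Proof.
case/and3P => hf hg hgf; have rf := notin_cl hf; have rg := notin_cl hg.
have s : g |: A \subset cl M (f |: A).
  by rewrite subUset sub1set hgf (subset_trans (sub_cl M A)) ?clS ?subsetUr.
apply/eqP; rewrite eqEsubset cl_sub //=; apply: cl_sub.
apply: subset_trans (sub_cl M _) _.
rewrite -(cl_idem M (g |: A)); apply: cl_sub.
apply: subset_trans (_ : cl M (f |: A) \subset _); first exact: sub_cl.
apply: cl_sub; rewrite cl_idem.
have : M (f |: (g |: A)) = M (g |: A).
  rewrite rg -rf setUCA; exact/clP.
move=> h; rewrite subUset sub1set; apply/andP; split; first exact/clP.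
by apply: subset_trans (sub_cl M _); apply: subsetUr.
Qed.

Lemma par_sym A f g : par A f g -> par A g f.
Proof.
move=> h; have e := par_clE h; case/and3P: h => hf hg _.
by apply/and3P; split=> //; rewrite e mem_cl // !inE eqxx.
Qed.

Lemma par_trans A f g h : par A f g -> par A g h -> par A f h.
Proof.
move=> h1 h2; have e := par_clE h1; case/and3P: h1 => hf _ _.
case/and3P: h2 => _ hh hgh; apply/and3P; split=> //; by rewrite -e.
Qed.

Lemma par_sub A B f g : A \subset B -> par A f g -> f \notin cl M B -> par B f g.
Proof.
move=> sAB h fB; have /and3P[_ _ fg] := par_sym h; have /and3P[_ _ gf] := h.
apply/and3P; split=> //.
  apply: contra fB => gB; move: fg; apply/subsetP; apply: cl_sub.
  by rewrite subUset sub1set gB (subset_trans sAB) ?sub_cl.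
by move: gf; apply/subsetP; apply: clS; apply: setUS.
Qed.

Lemma par_hyp A f g : (M A).+1 = M setT -> f \notin cl M A -> g \notin cl M A -> par A f g.
Proof.
move=> rA hf hg; apply/and3P; split=> //; apply/clP; rewrite (notin_cl hf).
have := rankU1_ge M g (f |: A); rewrite (notin_cl hf).
have : M (g |: (f |: A)) <= M setT by rewrite rank_mono ?subsetT.
by rlia.
Qed.

Lemma par_notin A f g : par A f g -> f \notin cl M A /\ g \notin cl M A.
Proof. by case/and3P. Qed.

Lemma ind2P A f g : reflect (f \notin cl M A /\ g \notin cl M (f |: A)) (ind2 M A f g).
Proof.
rewrite ind2_ge setUCA; apply: (iffP idP) => [h|[/notin_cl h1 /notin_cl ->]]; last by rewrite h1.
have := rankU1 M f A; have := rankU1 M g (f |: A) => h1 h2.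
by split; apply: notin_clI; rlia.
Qed.

Lemma full_cl A e : M A = M setT -> e \in cl M A.
Proof.
move=> rA; apply/clP; apply/eqP; rewrite eqn_leq rankU1_ge andbT rA.
by rewrite rank_mono ?subsetT.
Qed.

Lemma ind2_par A a b c : (M A).+2 = M setT -> ind2 M A a b -> ind2 M A a c -> par (a |: A) b c.
Proof.
move=> rA /ind2P[ha hb] /ind2P[_ hc]; apply: par_hyp => //.
by rewrite (notin_cl ha).
Qed.

End Parallel.

Section Codes.

Variables (E : finType) (S : finType) (M : matroid E).
Implicit Types (A B : {set E}) (e f : E) (C : {set {ffun E -> S}}).

(* An almost affine code: C projects onto S^I for I independent, and the
   coordinates in the closure of A are functions of those in A. *)
Record matroid_code C : Prop := Code {
  code_inh : exists x, x \in C;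
  code_det : forall A e x y, x \in C -> y \in C -> e \in cl M A ->
    {in A, x =1 y} -> x e = y e;
  code_free : forall A e x s, x \in C -> e \notin cl M A ->
    exists y, [/\ y \in C, {in A, y =1 x} & y e = s] }.

(** The coordinates of x in I are set to those of y one at a time, through words supplied by
    [code_free]. *)
Lemma code_walk C I (Phi : {ffun E -> S} -> Prop) : matroid_code C -> indep M I ->
  (forall x y, x \in C -> y \in C -> {in I, x =1 y} -> Phi x -> Phi y) ->
  (forall h x y, h \in I -> x \in C -> y \in C -> {in I :\ h, x =1 y} ->
     Phi x -> Phi y) ->
  forall x y, x \in C -> y \in C -> Phi x -> Phi y.
Proof.
move=> codeC iI base step x y xC yC.
have [n le] : exists n, #|[set h in I | x h != y h]| <= n by eexists; apply: leqnn.
elim: n => [|n IH] in x xC le *.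
  apply: base => // h hI; apply/eqP/negPn/negP => ne.
  move: le; rewrite leqn0 cards_eq0 => /eqP/setP/(_ h).
  by rewrite !inE hI ne.
have [D0|[h]] := set_0Vmem [set h in I | x h != y h].
  by apply: IH; rewrite // D0 cards0.
rewrite inE => /andP[hI hxy] px.
have [z [zC zx zh]] := code_free codeC (y h) xC (notin_cl_indep iI hI).
have xz : {in I :\ h, x =1 z} by move=> k kI; rewrite zx.
apply: (IH z zC); last exact: step hI xC zC xz px.
have : #|[set h in I | z h != y h]| < #|[set h in I | x h != y h]|.
  apply: proper_card; apply/properP; split.
    apply/subsetP => k; rewrite !inE => /andP[kI]; rewrite kI.
    by case: (eqVneq k h) => [->|kh]; rewrite ?zh ?eqxx // zx // !inE kh.
  by exists h; rewrite !inE ?hI // zh eqxx.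
by move/leq_trans/(_ le).
Qed.

Lemma code_lift C I (v : E -> S) : matroid_code C -> indep M I ->
  exists2 y, y \in C & {in I, y =1 v}.
Proof.
move=> codeC iI; have [x0 x0C] := code_inh codeC.
suff: forall J : {set E}, J \subset I -> exists2 y, y \in C & {in J, y =1 v}.
  by apply.
move=> J; elim/set_ind1: J => [_|h J IH]; first by exists x0 => // z; rewrite inE.
rewrite subUset sub1set => /andP[hI sJ]; have [y yC yv] := IH sJ.
have [hJ|hJ] := boolP (h \in J).
  by exists y => // z; rewrite in_setU1 => /orP[/eqP ->|]; apply: yv.
have iJ : indep M (h |: J).
  by apply: indep_sub iI; rewrite subUset sub1set hI.
have := notin_cl_indep iJ (setU11 h J); rewrite setU1K // => nh.
have [z [zC zy zh]] := code_free codeC (v h) yC nh.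
by exists z => // k; rewrite in_setU1 => /orP[/eqP ->//|kJ]; rewrite zy ?yv.
Qed.

End Codes.

Section CodeMap.

Variables (E S S' : finType) (M : matroid E) (C : {set {ffun E -> S}}).
Variables (phi : E -> S -> S') (psi : E -> S' -> S).

Lemma code_map : matroid_code M C ->
  (forall e, cancel (phi e) (psi e)) -> (forall e, cancel (psi e) (phi e)) ->
  matroid_code M [set [ffun e => phi e (x e)] | x : {ffun E -> S} in C].
Proof.
move=> codeC phiK psiK; have inj e : injective (phi e) := can_inj (phiK e).
split.
- by have [x xC] := code_inh codeC; exists [ffun e => phi e (x e)]; apply: imset_f.
- move=> A e _ _ /imsetP[x xC ->] /imsetP[y yC ->] eA xy; rewrite !ffunE; congr phi.
  by apply: (code_det codeC xC yC eA) => g /xy; rewrite !ffunE => /inj.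
- move=> A e _ s /imsetP[x xC ->] eA.
  have [y [yC yx ye]] := code_free codeC (psi e s) xC eA.
  exists [ffun e => phi e (y e)]; rewrite imset_f ?ffunE ?ye ?psiK //; split=> //.
  by move=> g gA; rewrite !ffunE yx.
Qed.

End CodeMap.

Section Agree.

Variables (E S : finType).
Implicit Types (A : {set E}) (x y : {ffun E -> S}).

Definition agree A x y := [forall e in A, x e == y e].

Lemma agreeP A x y : reflect {in A, x =1 y} (agree A x y).
Proof.
apply: (iffP forallP) => [h e eA|h e]; last by apply/implyP => /h ->.
by have := h e; rewrite eA => /eqP.
Qed.

Lemma agreeC A x y : agree A x y = agree A y x.
Proof. by apply: eq_forallb => e; rewrite eq_sym. Qed.

Lemma agree_congr A x y z : agree A x y -> agree A z x = agree A z y.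
Proof.
by move=> /agreeP xy; apply/agreeP/agreeP => zx e eA; rewrite zx // xy.
Qed.

Lemma agreeU1 e A x y : agree (e |: A) x y = agree A x y && (x e == y e).
Proof.
apply/agreeP/andP => [h|[/agreeP h /eqP he] g]; last by case/setU1P => [->|/h].
by split; [apply/agreeP => g gA|]; rewrite h ?setU11 ?setU1r.
Qed.

Lemma agreexx A x : agree A x x.
Proof. exact/agreeP. Qed.

End Agree.

(** * Signs of parallel pairs in a code *)

Section Transport.

Variables (E : finType) (F : finFieldType) (cardF : #|F| = 4).
Implicit Types (A B L : {set E}) (e f g : E) (x y : {ffun E -> F}).

(* With the coordinates of A fixed as in x, the bijection between the values
   at two elements f and g that are parallel over A. *)
Definition tr (C : {set {ffun E -> F}}) A x f g (s : F) :=
  if [pick y in C | agree A y x && (y f == s)] is Some y then y g else s.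

Definition sg C A x f g := sgn (tr C A x f g).

Section Code.

Variables (M : matroid E) (C : {set {ffun E -> F}}).
Hypothesis codeC : matroid_code M C.

Local Notation tr := (tr C).
Local Notation sg := (sg C).

Lemma trE A x f g y : par M A f g -> y \in C -> {in A, y =1 x} ->
  tr A x f g (y f) = y g.
Proof.
case/and3P => hf hg hgf yC yx; rewrite /tr; case: pickP => [z|/(_ y)]; last first.
  by rewrite yC eqxx andbT /= => /agreeP; case.
case/and3P => zC /agreeP zx /eqP zf.
apply: (code_det codeC zC yC hgf) => e; rewrite !inE => /orP[/eqP -> //|eA].
by rewrite zx // yx.
Qed.

Lemma tr_surj A x f s : x \in C -> f \notin cl M A ->
  exists y, [/\ y \in C, {in A, y =1 x} & y f = s].
Proof. exact: (code_free codeC). Qed.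

Lemma tr_ext A x f g (G : F -> F) : x \in C -> par M A f g ->
  (forall y, y \in C -> {in A, y =1 x} -> y g = G (y f)) -> tr A x f g =1 G.
Proof.
move=> xC h hG s; have [hf _] := par_notin h.
have [y [yC yx <-]] := tr_surj s xC hf.
by rewrite (trE h yC yx) hG.
Qed.

Lemma tr_can A x f g : x \in C -> par M A f g -> cancel (tr A x f g) (tr A x g f).
Proof.
move=> xC h s; have [hf _] := par_notin h.
have [y [yC yx <-]] := tr_surj s xC hf.
by rewrite (trE h yC yx) (trE (par_sym h) yC yx).
Qed.

Lemma tr_inj A x f g : x \in C -> par M A f g -> injective (tr A x f g).
Proof. by move=> xC h; apply: can_inj (tr_can xC h). Qed.

Lemma sg_trans A x f g h : x \in C -> par M A f g -> par M A g h ->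
  sg A x f h = sg A x f g (+) sg A x g h.
Proof.
move=> xC h1 h2; rewrite /sg addbC -sgn_comp //; try exact: tr_inj.
apply: sgn_ext; apply: (tr_ext xC (par_trans h1 h2)) => y yC yx /=.
by rewrite (trE h1 yC yx) (trE h2 yC yx).
Qed.

Lemma sg_refl A x f : x \in C -> f \notin cl M A -> sg A x f f = false.
Proof.
move=> xC hf; have h : par M A f f by rewrite /par hf mem_cl // !inE eqxx.
by have := sg_trans xC h h; case: (sg A x f f).
Qed.

Lemma sg_sym A x f g : x \in C -> par M A f g -> sg A x f g = sg A x g f.
Proof.
move=> xC h; have [hf _] := par_notin h.
have := sg_trans xC h (par_sym h); rewrite sg_refl //.
by case: (sg A x f g); case: (sg A x g f).
Qed.

(** The words that agree with x on B are among those that agree with it on A, so the permutation is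
    the same. Signs may thus be computed over a hyperplane. *)
Lemma sg_sub A B x f g : x \in C -> A \subset B -> par M A f g -> f \notin cl M B ->
  sg B x f g = sg A x f g.
Proof.
move=> xC sAB h fB; apply: sgn_ext; apply: (tr_ext xC (par_sub sAB h fB)) => y yC yx.
by rewrite (trE h yC) // => e eA; apply: yx; exact: (subsetP sAB).
Qed.

Lemma sg_base A x y f g : x \in C -> y \in C -> {in A, x =1 y} -> par M A f g ->
  sg A x f g = sg A y f g.
Proof.
move=> xC yC xy h; apply: sgn_ext; apply: (tr_ext xC h) => z zC zx.
by rewrite (trE h zC) // => e eA; rewrite zx // xy.
Qed.

Lemma sg_cl A B x f g : x \in C -> cl M A = cl M B -> par M A f g ->
  sg A x f g = sg B x f g.
Proof.
move=> xC e h; have [hf _] := par_notin h.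
have eU : cl M (A :|: B) = cl M A.
  apply/eqP; rewrite eqEsubset; apply/andP; split; last by rewrite clS ?subsetUl.
  by apply: cl_sub; rewrite subUset sub_cl e sub_cl.
have hU : par M (A :|: B) f g by apply: par_sub h _; rewrite ?subsetUl ?eU.
rewrite -(sg_sub xC (subsetUl A B) h) ?eU //.
apply: sg_sub; rewrite ?subsetUr ?eU //.
case/and3P: h => _ hg hgf; apply/and3P; split; rewrite -?e //.
move: hgf; apply/subsetP; apply: cl_sub.
rewrite subUset sub1set mem_cl ?inE ?eqxx //=.
by apply: subset_trans (sub_cl M A) _; rewrite e clS ?subsetUr.
Qed.

Section Latin.

Variables (L : {set E}) (x : {ffun E -> F}).
Hypothesis xC : x \in C.
Hypothesis rL : (M L).+2 = M setT.

(** The Latin square of the values at c, its rows and columns indexed by those at a and b, over the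
    coline L. The default s does not occur if a and b are independent over L. *)
Definition lat a b c (s t : F) :=
  if [pick y in C | [&& agree L y x, y a == s & y b == t]] is Some y then y c else s.

Lemma ind2_cl_full a b c : ind2 M L a b -> c \in cl M (a |: (b |: L)).
Proof. by move=> /eqP h; apply: full_cl; rewrite h. Qed.

Lemma latE a b c y : ind2 M L a b -> y \in C -> {in L, y =1 x} ->
  lat a b c (y a) (y b) = y c.
Proof.
move=> hab yC yx; rewrite /lat; case: pickP => [z|/(_ y)]; last first.
  by rewrite yC !eqxx !andbT /= => /agreeP; case.
case/and4P => zC /agreeP zx /eqP za /eqP zb.
apply: (code_det codeC zC yC (ind2_cl_full c hab)) => e.
by rewrite !inE => /or3P[/eqP ->|/eqP ->|eL]; rewrite // zx // yx.
Qed.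

Lemma lat_surj a b s t : ind2 M L a b ->
  exists y, [/\ y \in C, {in L, y =1 x}, y a = s & y b = t].
Proof.
case/ind2P => ha hb; have [y [yC yx ya]] := code_free codeC s xC ha.
have [z [zC zy zb]] := code_free codeC t yC hb; exists z; split=> //.
  by move=> e eL; rewrite zy ?yx // !inE eL orbT.
by rewrite zy ?inE ?eqxx.
Qed.

Lemma lat_injr a b c s : ind2 M L a b -> ind2 M L a c -> injective (lat a b c s).
Proof.
move=> hab hac t t'; have [y [yC yx ya yb]] := lat_surj s t hab.
have [z [zC zx za zb]] := lat_surj s t' hab.
rewrite -{1}ya -yb -za -zb !latE // => e.
apply: (code_det codeC yC zC (ind2_cl_full b hac)) => d.
by rewrite !inE => /or3P[/eqP ->|/eqP ->|dL]; rewrite ?ya ?za // yx // zx.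
Qed.

Lemma lat_injl a b c t : ind2 M L a b -> ind2 M L b c -> injective (lat a b c ^~ t).
Proof.
move=> hab hbc s s' /=; have [y [yC yx ya yb]] := lat_surj s t hab.
have [z [zC zx za zb]] := lat_surj s' t hab.
rewrite -ya -{1}yb -za -zb !latE // => e.
apply: (code_det codeC yC zC (ind2_cl_full a hbc)) => d.
by rewrite !inE => /or3P[/eqP ->|/eqP ->|dL]; rewrite ?yb ?zb // yx // zx.
Qed.

Lemma lat_sg a b c y : ind2 M L a b -> ind2 M L a c -> y \in C -> {in L, y =1 x} ->
  sg (a |: L) y b c = sgn (lat a b c (y a)).
Proof.
move=> hab hac yC yx; apply: sgn_ext; apply: (tr_ext yC (ind2_par rL hab hac)).
move=> z zC zy; rewrite -(zy a) ?inE ?eqxx // latE // => e eL.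
by rewrite zy ?yx // !inE eL orbT.
Qed.

(** Fixing a leaves the term in b, fixing b leaves [be], and fixing c composes [be] with the inverse
    of the term in b, whence the sum of the two signs. *)
Lemma form_sgn a b c k (al : F) (be : F -> F) :
  ind2 M L a b -> ind2 M L a c -> ind2 M L b c -> al != 0%R -> injective be ->
  (forall y, y \in C -> {in L, y =1 x} -> y c = al * frob k (y b) + be (y a))%R ->
  forall y, y \in C -> {in L, y =1 x} ->
    [/\ sg (a |: L) y b c = k, sg (b |: L) y a c = sgn be
      & sg (c |: L) y a b = k (+) sgn be].
Proof.
move=> hab hac hbc al0 ibe form y yC yx.
have [p [q [p0 hbe]]] := sgnP cardF ibe.
have up d z : {in d |: L, z =1 y} -> {in L, z =1 x} /\ z d = y d.
  move=> zy; split; last by rewrite zy ?inE ?eqxx.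
  by move=> e eL; rewrite zy ?yx // !inE eL orbT.
split.
- apply: (sgn_form cardF (a := al) (b := be (y a))) => //.
  apply: (tr_ext yC (ind2_par rL hab hac)) => z zC /up[zx za].
  by rewrite form // za.
- apply: (sgn_form cardF (a := p) (b := (al * frob k (y b) + q)%R)) => //.
  apply: tr_ext; rewrite ?ind2_par // 1?ind2C // => z zC /up[zx zb].
  by rewrite form // zb hbe; ring.
- apply: (sgn_form cardF (a := frob k (- p / al)%R) (b := frob k ((y c - q) / al)%R)).
    by rewrite frob_eq0 mulf_neq0 ?oppr_eq0 ?invr_eq0.
  apply: tr_ext; rewrite ?ind2_par // 1?ind2C // => z zC /up[zx zc].
  rewrite -[LHS](frobK cardF k) -(frob_comp cardF k) -(frobM k) -(frobD cardF k).
  congr frob; rewrite -zc form // hbe; by field.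
Qed.

Lemma latin_form a b c k : ind2 M L a b -> ind2 M L a c -> ind2 M L b c ->
  (forall y, y \in C -> {in L, y =1 x} -> sg (a |: L) y b c = k) ->
  exists (al : F) (be : F -> F), [/\ al != 0%R, injective be &
    forall y, y \in C -> {in L, y =1 x} -> y c = al * frob k (y b) + be (y a)]%R.
Proof.
move=> hab hac hbc hk.
have hs s : sgn (lat a b c s) = k.
  have [y [yC yx <- _]] := lat_surj s s hab.
  by rewrite -lat_sg // hk.
have [al [be [al0 ibe e]]] := latin_const_sgn cardF (fun s => lat_injr (s := s) hab hac)
  (fun t => lat_injl (t := t) hab hbc) hs.
by exists al, be; split=> // y yC yx; rewrite -e latE.
Qed.

(** The words with value 0 at d form a transversal of the Latin square on a, b and c. *)
Lemma quad_sg_const a b c d : ind2 M L a b -> ind2 M L a c -> ind2 M L a d ->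
  ind2 M L b c -> ind2 M L b d -> ind2 M L c d ->
  forall y z, y \in C -> {in L, y =1 x} -> z \in C -> {in L, z =1 x} ->
  sg (a |: L) y b c = sg (a |: L) z b c.
Proof.
move=> hab hac had hbc hbd hcd y z yC yx zC zx.
rewrite !lat_sg //; apply: (latin_transversal_sgn cardF (tau := lat a d b ^~ 0%R)).
- by move=> s; exact: lat_injr.
- by move=> t; exact: lat_injl.
- by apply: lat_injl => //; rewrite ind2C.
- have e s : lat a b c s (lat a d b s 0%R) = lat a d c s 0%R.
    have [w [wC wx wa wd]] := lat_surj s 0%R had.
    by rewrite -wa -wd !latE.
  by move=> s s'; rewrite /= !e; apply: lat_injl => //; rewrite ind2C.
Qed.

(** The pair c, d is routed through b on the left and through a on the right. With c fixed, the
    value at d is both a permutation of the value at a and the sum of two such permutations, [G] and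
    [be']; by [sgn_add_inj] these have equal signs, which is the claim. *)
Lemma quad_sg_swap a b c d : ind2 M L a b -> ind2 M L a c -> ind2 M L a d ->
  ind2 M L b c -> ind2 M L b d -> ind2 M L c d ->
  forall y, y \in C -> {in L, y =1 x} -> sg (a |: L) y c d = sg (b |: L) y c d.
Proof.
move=> hab hac had hbc hbd hcd y yC yx.
have hba := hab; have hcb := hbc; have hdb := hbd; rewrite ind2C in hba.
rewrite ind2C in hcb; rewrite ind2C in hdb.
have hca := hac; have hda := had; have hdc := hcd; rewrite ind2C in hca.
rewrite ind2C in hda; rewrite ind2C in hdc.
have c1 z : z \in C -> {in L, z =1 x} -> sg (a |: L) z b c = sg (a |: L) y b c.
  by move=> zC zx; apply: (quad_sg_const (d := d)).
have c2 z : z \in C -> {in L, z =1 x} -> sg (a |: L) z b d = sg (a |: L) y b d.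
  by move=> zC zx; apply: (quad_sg_const (d := c)).
have [al [be [al0 ibe f1]]] := latin_form hab hac hbc c1.
have [al' [be' [al'0 ibe' f2]]] := latin_form hab had hbd c2.
have [s1 s2 s3] := form_sgn hab hac hbc al0 ibe f1 yC yx.
have [t1 t2 t3] := form_sgn hab had hbd al'0 ibe' f2 yC yx.
rewrite (sg_trans yC (ind2_par rL hac hab) (ind2_par rL hab had)).
rewrite (sg_trans yC (ind2_par rL hbc hba) (ind2_par rL hba hbd)).
rewrite (sg_sym yC (ind2_par rL hac hab)) (sg_sym yC (ind2_par rL hbc hba)) s2 t2.
set k := sg (a |: L) y b c in s3 *; set k' := sg (a |: L) y b d.
have itr := tr_inj yC (ind2_par rL hca hcb).
pose G (s : F) := (al' * frob k' (tr (c |: L) y a b s))%R.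
have iG : injective G.
  by move=> s s' /(mulfI al'0) /(inv_inj (frobK cardF k'))/itr.
have sG : sgn G = k' (+) (k (+) sgn be).
  rewrite -s3 -[LHS]/(sgn ((fun t => al' * frob k' t)%R \o tr (c |: L) y a b)).
  rewrite sgn_comp //; last by move=> s s' /(mulfI al'0) /(inv_inj (frobK cardF k')).
  by congr (_ (+) _); apply: (sgn_form cardF (a := al') (b := 0%R)) => // t; rewrite addr0.
have : sgn G = sgn be'.
  apply: (sgn_add_inj cardF iG ibe').
  have e : (fun s => G s + be' s)%R =1 tr (c |: L) y a d.
    move=> s; apply/esym; move: s; apply: (tr_ext yC (ind2_par rL hca hcd)) => z zC zy.
    have zx : {in L, z =1 x} by move=> e eL; rewrite zy ?yx // !inE eL orbT.
    by rewrite /G (trE (ind2_par rL hca hcb) zC zy) f2.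
  by apply: eq_inj (tr_inj yC (ind2_par rL hca hcd)) _ => s; rewrite e.
by rewrite sG; case: (k); case: (k'); case: (sgn be); case: (sgn be').
Qed.

End Latin.

End Code.

Definition coherent (M : matroid E) (C : {set {ffun E -> F}}) := exists o : E -> bool,
  forall A x f g, x \in C -> par M A f g -> sg C A x f g = o f (+) o g.

End Transport.

(** * Bases of the contraction of an element *)

Section ElementConnectivity.

Variables (E : finType) (M : matroid E) (e : E).
Implicit Types (A B H I L P Q X Y : {set E}) (f g h : E).

Local Notation r := (M setT).

Hypothesis e1 : M [set e] = 1.
Hypothesis r2 : 1 < r.
(* M / e and the deletion from M of the parallel class of e are connected. *)
Hypothesis contract_conn : forall X Y, X :|: Y = setT ->
  M (e |: X) + M (e |: Y) <= r.+1 -> M (e |: X) <= 1 \/ M (e |: Y) <= 1.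
Hypothesis delete_conn : forall X Y, X :|: Y :|: cl M [set e] = setT ->
  M X + M Y <= r -> M X = 0 \/ M Y = 0.

(** These are the bases of M / e; each spans a hyperplane of M that avoids e. *)
Definition transversal_basis I := [/\ indep M (e |: I), e \notin I & M (e |: I) = r].

Lemma transversal_basis_ex : exists I, transversal_basis I.
Proof.
have ie : indep M [set e] by rewrite /indep e1 cards1.
have [B [eB _] [iB rB]] := indep_ext (subsetT _) ie; rewrite sub1set in eB.
by exists (B :\ e); rewrite /transversal_basis setD1K // !inE eqxx.
Qed.

Lemma transversal_rank I : transversal_basis I -> (M I).+1 = r /\ e \notin cl M I.
Proof.
case=> iI eI rI; have e2 := notin_cl_indep iI (setU11 e I).
rewrite setU1K // in e2; split=> //; by rewrite -rI notin_cl.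
Qed.

Lemma transversal_basisP I : transversal_basis I <-> is_basis (contract M [set e]) I.
Proof.
have cE A : contract M [set e] A + 1 = M (e |: A) by rewrite -{1}e1 contractE setUC.
have eT : e |: setT = setT :> {set E} by apply/setUidPr; apply: subsetT.
split=> [[iI eI rI]|[iI rI]].
  have c1 := cE I; have c2 := cE setT; rewrite eT in c2.
  split; last by rlia.
  by move: iI; rewrite /indep cardsU1 eI => /eqP iI; apply/eqP; rlia.
have eI : e \notin I.
  apply/negP => /(notin_cl_indep iI) /negP; rewrite cl_contract; apply.
  by apply: mem_cl; rewrite !inE eqxx orbT.
have c1 := cE I; have c2 := cE setT; rewrite eT in c2; split=> //; last by rlia.
by move/eqP: iI => iI; rewrite /indep cardsU1 eI; apply/eqP; rlia.
Qed.

Lemma transversal_swap I h h' : transversal_basis I -> h \in I ->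
  h' \notin cl M (e |: (I :\ h)) -> transversal_basis (h' |: (I :\ h)).
Proof.
move=> /transversal_basisP bI hI hh'; apply/transversal_basisP.
by apply: basis_swap; rewrite // cl_contract setUC.
Qed.

Lemma transversal_chain (R : {set E} -> {set E} -> Prop) :
  (forall I, transversal_basis I -> R I I) ->
  (forall I J K, transversal_basis J -> R I J -> R J K -> R I K) ->
  (forall I h h', transversal_basis I -> h \in I -> h' \notin cl M (e |: (I :\ h)) ->
     R I (h' |: (I :\ h))) ->
  forall I J, transversal_basis I -> transversal_basis J -> R I J.
Proof.
move=> R0 Rt Rs I J /transversal_basisP bI /transversal_basisP bJ.
apply: basis_chain bI bJ => [K /transversal_basisP|K K' K'' /transversal_basisP|].
- exact: R0.
- exact: Rt.
- move=> K h h' /transversal_basisP bK hK; rewrite cl_contract setUC; exact: Rs.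
Qed.

Lemma outside_hyperplane H : (M H).+1 = r -> exists2 f, f \notin cl M H & f \notin cl M [set e].
Proof.
move=> rH; have [/existsP[f /andP[]]|] := boolP [exists f, (f \notin cl M H) && (f \notin cl M [set e])].
  by exists f.
rewrite negb_exists => /forallP h.
have [|| h0|h0] := @delete_conn (cl M H) [set e].
- apply/setP => f; rewrite !in_setU in_setT; have := h f; rewrite negb_and !negbK.
  by case: (f \in cl M H) => //= ->; rewrite orbT.
- by rewrite rank_cl e1; rlia.
- by move: h0; rewrite rank_cl; rlia.
- by move: h0; rewrite e1.
Qed.

Lemma rank_parallel A X : X \subset cl M [set e] -> M (e |: (A :|: X)) = M (e |: A).
Proof.
move=> sX; have -> : e |: (A :|: X) = e |: A :|: X by stauto.
by apply: rankU_cl; apply: subset_trans sX _; apply: clS; stauto.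
Qed.

(** Let P and Q be the two classes of [kap] off H. If neither lay in the closure of L and e, there
    would be p and q that are parallel over L or form four classes over L with e and some h in H, so
    that [kap] agrees on them. Hence [linking] applies over e and separates P from Q in M / e. *)
Lemma const_off_hyperplane (kap : E -> bool) H : cl M H = H -> (M H).+1 = r -> e \notin H ->
  (forall L f g, L \subset H -> (M L).+2 = r -> f \notin H -> g \notin H ->
     ind2 M L e f -> ind2 M L e g ->
     par M L f g \/ (exists2 h, h \in H & [/\ ind2 M L e h, ind2 M L f g,
       ind2 M L h f & ind2 M L h g]) -> kap f = kap g) ->
  forall f g, f \notin H -> g \notin H -> f \notin cl M [set e] -> g \notin cl M [set e] ->
  kap f = kap g.
Proof.
move=> cH rH eH hyp f g fH gH fe ge; case: (eqVneq (kap f) (kap g)) => // ne; exfalso.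
pose P := [set z | [&& z \notin H, z \notin cl M [set e] & kap z == kap f]].
pose Q := [set z | [&& z \notin H, z \notin cl M [set e] & kap z == kap g]].
have fullH : M (H :|: [set e]) = r.
  by rewrite setUC notin_cl ?cH.
have sT A : A \subset cl M (H :|: [set e]) by apply/subsetP => z _; apply: full_cl.
have [|X sX rX] := @linking _ M H [set e] P Q _ (sT _) (sT _).
  move=> L sL; rewrite fullH => rL.
  have [|] := boolP (P \subset cl M (L :|: [set e])); first by left.
  have [|] := boolP (Q \subset cl M (L :|: [set e])); first by right.
  case/subsetPn => q; rewrite !inE => /and3P[qH qe /eqP kq] nq.
  case/subsetPn => p; rewrite !inE => /and3P[pH pe /eqP kp] np.
  have {}np : p \notin cl M (e |: L) by rewrite setUC inE.
  have {}nq : q \notin cl M (e |: L) by rewrite setUC inE.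
  have eL : e \notin cl M L.
    by apply: contra eH => /(subsetP (clS M sL)); rewrite cH.
  have rL' : (M L).+2 = r by rewrite -rL setUC (notin_cl eL).
  have iep : ind2 M L e p by apply/ind2P.
  have ieq : ind2 M L e q by apply/ind2P.
  case/eqP: ne; rewrite -kp -kq; apply: (hyp L) => //.
  have pL : p \notin cl M L by apply: contra pH => /(subsetP (clS M sL)); rewrite cH.
  have [qp|qp] := boolP (q \in cl M (p |: L)).
    left; apply/and3P; split=> //.
    by apply: contra qH => /(subsetP (clS M sL)); rewrite cH.
  right; have [h hH hL] : exists2 h, h \in H & h \notin cl M L.
    apply/subsetPn; apply/negP => /rank_sub_cl; rlia.
  exists h => //.
  have sub z : z \notin H -> z \notin cl M (h |: L).
    move=> zH; apply: contra zH => zc; rewrite -cH; move: zc; apply/subsetP.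
    by apply: clS; stauto.
  split; [rewrite ind2C| |  |]; apply/ind2P; split=> //; exact: sub.
have [| | |] := @contract_conn (X :|: P :|: cl M [set e]) (H :\: X :|: Q).
- apply/setP => z; rewrite in_setT !in_setU in_setD.
  case zX : (z \in X) => //=; case zH : (z \in H) => /=; rewrite ?orbT //.
  case ze : (z \in cl M [set e]); rewrite ?orbT // !inE zH.
  move: ze; rewrite inE => -> /=.
  by move: ne; case: (kap z); case: (kap f); case: (kap g).
- rewrite rank_parallel; last exact: subxx.
  move: rX; rewrite fullH e1 addn1; congr (_ + _ <= _); congr (M _); stauto.
- rewrite rank_parallel; last exact: subxx.
  move=> h; have : M (f |: [set e]) <= M (e |: (X :|: P)).
    apply: rank_mono; apply/subsetP => z; rewrite in_setU1 in_set1 !in_setU1 in_setU.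
    case/orP => /eqP ->; last by rewrite eqxx.
    by rewrite [f \in P]inE fH fe eqxx !orbT.
  by rewrite (notin_cl fe); rlia.
- move=> h; have : M (g |: [set e]) <= M (e |: (H :\: X :|: Q)).
    apply: rank_mono; apply/subsetP => z; rewrite in_setU1 in_set1 !in_setU1 in_setU.
    case/orP => /eqP ->; last by rewrite eqxx.
    by rewrite [g \in Q]inE gH ge eqxx !orbT.
  by rewrite (notin_cl ge); rlia.
Qed.

(** If every hyperplane contained e or f, [linking] on the whole ground set would separate e from
    f. *)
Lemma avoid_two f : f \notin cl M [set e] -> M [set f] = 1 ->
  exists L, [/\ (M L).+1 = r, e \notin cl M L & f \notin cl M L].
Proof.
move=> fe rf.
have [/existsP[L /and3P[/eqP rL h1 h2]]|] :=
  boolP [exists L : {set E}, [&& (M L).+1 == r, e \notin cl M L & f \notin cl M L]].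
  by exists L.
rewrite negb_exists => /forallP none.
have sT A : A \subset cl M (setT :|: set0) by apply/subsetP => z _; apply: full_cl; rewrite setU0.
have [|X _] := @linking _ M setT set0 [set e] [set f] _ (sT _) (sT _).
  move=> L _; rewrite !setU0 !sub1set => rL; have := none L.
  by rewrite rL eqxx /= negb_and !negbK => /orP.
rewrite !setU0 rank0 addn0 => h.
have [| |h0|h0] := @delete_conn (X :|: [set e]) (setT :\: X :|: [set f]) => //.
- by stauto.
- have : M [set e] <= M (X :|: [set e]) by rewrite rank_mono ?subsetUr.
  by rewrite h0 e1.
- have : M [set f] <= M (setT :\: X :|: [set f]) by rewrite rank_mono ?subsetUr.
  by rewrite h0 rf.
Qed.

(** Let A and B be the two classes of [kap]. By the first hypothesis a hyperplane avoiding e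
    contains A or B, and by the second it is split by them. Exchanges lead from a hyperplane missing
    a point of A to one missing a point of B; at the exchange where containing B turns into
    containing A, the deletion would be disconnected. *)
Lemma const_off_parallel (kap : E -> bool) :
  (forall H f g, cl M H = H -> (M H).+1 = r -> e \notin H -> f \notin H -> g \notin H ->
     f \notin cl M [set e] -> g \notin cl M [set e] -> kap f = kap g) ->
  (forall L f g, e \notin cl M L -> par M L f g -> f \notin cl M (e |: L) -> kap f = kap g) ->
  forall f g, f \notin cl M [set e] -> g \notin cl M [set e] -> kap f = kap g.
Proof.
move=> k1 k2.
suff main a b : a \notin cl M [set e] -> b \notin cl M [set e] -> kap a -> ~~ kap b -> False.
  move=> f g fe ge; case ef : (kap f); case eg : (kap g) => //.
    by case: (main f g); rewrite ?eg.
  by case: (main g f); rewrite ?ef.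
move=> ae be ka kb.
pose A := [set z | (z \notin cl M [set e]) && kap z].
pose B := [set z | (z \notin cl M [set e]) && ~~ kap z].
have aA : a \in A by rewrite in_set ae.
have bB : b \in B by rewrite in_set be.
have nl z : z \notin cl M [set e] -> M [set z] = 1.
  move=> ze; have : z \notin cl M set0.
    by apply: contra ze; apply/subsetP; apply: clS; apply: sub0set.
  by move/notin_cl; rewrite setU0 rank0.
have cover : A :|: B :|: cl M [set e] = setT.
  apply/setP => z; rewrite !in_setU in_setT.
  case ze : (z \in cl M [set e]); first by rewrite orbT.
  by rewrite orbF [z \in A]in_set [z \in B]in_set ze; case: (kap z).
have off H : (M H).+1 = r -> e \notin cl M H -> A \subset cl M H \/ B \subset cl M H.
  move=> rH eH; have [|] := boolP (A \subset cl M H); first by left.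
  have [|] := boolP (B \subset cl M H); first by right.
  case/subsetPn => q; rewrite in_set => /andP[qe kq] qH.
  case/subsetPn => p; rewrite in_set => /andP[pe kp] pH.
  have := @k1 (cl M H) p q (cl_idem _ _); rewrite rank_cl => /(_ rH eH pH qH pe qe).
  by rewrite kp (negbTE kq).
have split H : (M H).+1 = r -> e \notin cl M H ->
    M (cl M H :&: A) + M (cl M H :&: B) <= M H.
  move=> rH eH.
  have sc X : cl M H :&: X \subset cl M (cl M H :|: set0).
    by rewrite setU0 cl_idem subsetIl.
  have [|X _] := @linking _ M (cl M H) set0 (cl M H :&: A) (cl M H :&: B) _ (sc _) (sc _).
    move=> L sL; rewrite !setU0 rank_cl => rL.
    have [|] := boolP (cl M H :&: A \subset cl M L); first by left.
    have [|] := boolP (cl M H :&: B \subset cl M L); first by right.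
    case/subsetPn => q; rewrite in_setI [q \in B]in_set => /and3P[qH qe kq] qL.
    case/subsetPn => p; rewrite in_setI [p \in A]in_set => /and3P[pH pe kp] pL.
    have cpL : cl M (p |: L) = cl M H.
      have spL : p |: L \subset cl M H by rewrite subUset sub1set pH.
      apply/eqP; rewrite eqEsubset cl_sub //=; apply: cl_eq_rank => //.
      by rewrite rank_cl (notin_cl pL) rL.
    have ppq : par M L p q by apply/and3P; split; rewrite ?cpL.
    have eL : e \notin cl M L.
      by apply: contra eH; apply/subsetP; rewrite -[cl M H]cl_idem; apply: clS.
    have pe' : p \notin cl M (e |: L).
      apply: notin_clI; rewrite setUCA (notin_cl eL) notin_cl ?cpL //.
      by rewrite (notin_cl pL).
    by have := k2 L p q eL ppq pe'; rewrite kp (negbTE kq).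
  rewrite !setU0 rank_cl rank0 addn0; apply: leq_trans; apply: leq_add;
    by apply: rank_mono; apply: subsetUr.
have fin I h h' : transversal_basis I -> h \in I -> h' \notin cl M (e |: (I :\ h)) ->
    B \subset cl M I -> A \subset cl M (h' |: (I :\ h)) -> False.
  move=> tI hI hh' sB sA; have tI' := transversal_swap tI hI hh'.
  have [[r1 n1] [r1' n1']] := (transversal_rank tI, transversal_rank tI').
  have := split _ r1 n1; have := split _ r1' n1'.
  rewrite (setIidPr sB) (setIidPr sA).
  have sL : I :\ h \subset (cl M I :&: A) :|: (cl M (h' |: (I :\ h)) :&: B).
    apply/subsetP => l lI; have lI' : l \in I by move: lI; rewrite !inE => /andP[].
    have l1 : l \in cl M I by rewrite mem_cl.
    have l2 : l \in cl M (h' |: (I :\ h)) by rewrite mem_cl // in_setU1 lI orbT.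
    have le : l \notin cl M [set e].
      have [iI eI _] := tI; have nel : l != e by apply: contraNneq eI => <-.
      have := notin_cl_indep iI (_ : l \in e |: I); rewrite in_setU1 lI' orbT.
      move=> /(_ isT); apply: contra; apply/subsetP; apply: clS.
      by rewrite sub1set !inE eq_sym nel eqxx.
    by rewrite in_setU !in_setI l1 l2 [l \in A]in_set [l \in B]in_set le /=; case: (kap l).
  have := @rank_submod _ M (I :\ h) set0 _ _ sL (sub0set _); rewrite rank0.
  have rL : (M (I :\ h)).+1 = M I.
    have [iI _ _] := tI.
    have iI' : indep M I by apply: indep_sub iI; apply: subsetUr.
    by rewrite -(notin_cl (notin_cl_indep iI' hI)) setD1K.
  (* The inequalities yield M A + M B <= 2 (r - 1) - (r - 2) = r. *)
  move=> u1 u2 u3; have [|h0|h0] := @delete_conn A B cover; first rlia.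
    have : M [set a] <= M A by rewrite rank_mono ?sub1set.
    by rewrite (nl a) // h0.
  have : M [set b] <= M B by rewrite rank_mono ?sub1set.
  by rewrite (nl b) // h0.
have hypI L z : (M L).+1 = r -> e \notin cl M L -> z \notin cl M L ->
    exists2 I, transversal_basis I & cl M I = cl M L.
  move=> rL eL zL; have [I sI [iI rI]] := rank_basis M L.
  have cI : cl M I = cl M L.
    apply/eqP; rewrite eqEsubset clS //=; apply: cl_sub; apply: cl_eq_rank => //.
    by rewrite rI.
  exists I => //; split; last by rewrite notin_cl ?cI // rI.
    by rewrite indepU1 // cI.
  by apply: contra eL => eI; rewrite -cI mem_cl.
have [L1 [r1 n1 m1]] := avoid_two ae (nl a ae).
have [L2 [r2' n2 m2]] := avoid_two be (nl b be).
have [I1 t1 c1] := hypI _ _ r1 n1 m1; have [I2 t2 c2] := hypI _ _ r2' n2 m2.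
have sB : B \subset cl M I1.
  case: (off L1 r1 n1); rewrite c1 // => /subsetP/(_ a aA) h; by rewrite h in m1.
have nB : ~~ (B \subset cl M I2).
  by apply/subsetPn; exists b; rewrite ?c2.
apply: (negP nB); move: sB; apply: (transversal_chain (R := fun I J => B \subset cl M I -> B \subset cl M J)) => //.
- by move=> I J K _ h1 h2 /h1.
- move=> I h h' tI hI hh' s; have tI' := transversal_swap tI hI hh'.
  have [q1 q2] := transversal_rank tI'.
  by case: (off _ q1 q2) => // sA; case: (fin _ _ _ tI hI hh' s sA).
Qed.

End ElementConnectivity.

(** * Coherence *)

Section Coherence.

Variables (E : finType) (F : finFieldType) (cardF : #|F| = 4).
Implicit Types (A B H I L X Y : {set E}) (f g h : E) (x y : {ffun E -> F}).
Implicit Types (M : matroid E) (C : {set {ffun E -> F}}).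

Section Step.

Variables (M : matroid E) (C : {set {ffun E -> F}}) (e : E).
Local Notation r := (M setT).

Hypothesis codeC : matroid_code M C.
Hypothesis e1 : M [set e] = 1.
Hypothesis r2 : 1 < r.
Hypothesis contract_conn : forall X Y, X :|: Y = setT ->
  M (e |: X) + M (e |: Y) <= r.+1 -> M (e |: X) <= 1 \/ M (e |: Y) <= 1.
Hypothesis delete_conn : forall X Y, X :|: Y :|: cl M [set e] = setT ->
  M X + M Y <= r -> M X = 0 \/ M Y = 0.

Variable o : F -> E -> bool.
Hypothesis coh : forall A x f g, x \in C -> e \in A -> par M A f g ->
  sg C A x f g = o (x e) f (+) o (x e) g.

Lemma notin_cl_sub A B f : A \subset B -> f \notin cl M B -> f \notin cl M A.
Proof. by move=> s; apply: contra; apply/subsetP; apply: clS. Qed.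

(** Two words that differ at e but agree on a set L not spanning e relate [o c] to [o c']. For a
    pair parallel over L both signs can be read over L; for a pair that forms four classes with e
    and some h, the sign does not depend on the value at e by [quad_sg_const]. *)
Lemma delta_const c c' f g : f \notin cl M [set e] -> g \notin cl M [set e] ->
  o c f (+) o c' f = o c g (+) o c' g.
Proof.
have [z0 z0C] := code_inh codeC.
have two L : e \notin cl M L -> exists x x', [/\ x \in C, x' \in C,
    {in L, x' =1 x}, x e = c & x' e = c'].
  move=> eL; have [x [xC _ xe]] := code_free codeC c z0C eL.
  by have [x' [x'C xx' x'e]] := code_free codeC c' xC eL; exists x, x'.
have k2 L p q : e \notin cl M L -> par M L p q -> p \notin cl M (e |: L) ->
    o c p (+) o c' p = o c q (+) o c' q.
  move=> eL hpq pe; have [x [x' [xC x'C xx' xe x'e]]] := two L eL.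
  have hpq' : par M (e |: L) p q by apply: par_sub hpq pe; apply: subsetUr.
  have h1 := coh xC (setU11 e L) hpq'; have h2 := coh x'C (setU11 e L) hpq'.
  rewrite (sg_sub codeC xC (subsetUr _ _) hpq pe) in h1.
  rewrite (sg_sub codeC x'C (subsetUr _ _) hpq pe) in h2.
  rewrite (sg_base codeC x'C xC xx' hpq) h1 xe x'e in h2.
  by move: h2; case: (o c p); case: (o c q); case: (o c' p); case: (o c' q).
move=> fe ge; pose kap z := o c z (+) o c' z; rewrite -/(kap f) -/(kap g).
apply: (const_off_parallel e1 r2 delete_conn _ k2) fe ge.
move=> H {}f {}g cH rH eH fH gH fe ge.
apply: (const_off_hyperplane e1 r2 contract_conn (kap := kap) cH rH eH _ fH gH fe ge).
move=> L p q sL rL pH qH iep ieq; rewrite /kap.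
have [eL peL] := ind2P _ _ _ _ iep; have [_ qeL] := ind2P _ _ _ _ ieq.
case=> [hpq|[h' hH [ieh ipq ihp ihq]]]; first exact: k2 eL hpq peL.
have [x [x' [xC x'C xx' xe x'e]]] := two L eL.
have hpq : par M (e |: L) p q by apply: ind2_par.
have h1 := coh xC (setU11 e L) hpq; have h2 := coh x'C (setU11 e L) hpq.
have iph : ind2 M L p h' by rewrite ind2C.
have iqh : ind2 M L q h' by rewrite ind2C.
rewrite (quad_sg_const cardF codeC xC rL iep ieq ieh ipq iph iqh x'C xx' xC) // h1 xe x'e in h2.
by move: h2; case: (o c p); case: (o c q); case: (o c' p); case: (o c' q).
Qed.

(** By [delta_const] a single function serves for all values at e; the choice of 0 is arbitrary. *)
Let o0 := o 0%R.

Lemma coh_over A x f g : x \in C -> e \in cl M A -> par M A f g ->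
  sg C A x f g = o0 f (+) o0 g.
Proof.
move=> xC eA h; have [fA gA] := par_notin h.
have ce : cl M (e |: A) = cl M A.
  apply: cl_eq; first by rewrite subUset sub1set eA sub_cl.
  exact: subset_trans (sub_cl M A) (clS _ (subsetUr _ _)).
have h' : par M (e |: A) f g by apply: par_sub h _; rewrite ?subsetUr ?ce.
rewrite (sg_cl codeC xC (esym ce) h) (coh xC (setU11 _ _) h').
have fe : f \notin cl M [set e].
  by apply: contra fA; apply/subsetP; apply: cl_sub; rewrite sub1set.
have ge : g \notin cl M [set e].
  by apply: contra gA; apply/subsetP; apply: cl_sub; rewrite sub1set.
have := delta_const (x e) 0%R fe ge; rewrite -/o0.
by case: (o (x e) f); case: (o (x e) g); case: (o0 f); case: (o0 g).
Qed.

(** The sign is moved to one over [e |: L] for a coline L in H: directly if the pair is parallel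
    over L, and by [quad_sg_swap] of e and h if the pair forms four classes with them. *)
Lemma coh_hyperplane H x f g : x \in C -> (M H).+1 = r -> e \notin cl M H ->
  f \notin cl M H -> g \notin cl M H -> f \notin cl M [set e] -> g \notin cl M [set e] ->
  sg C H x f g = o0 f (+) o0 g.
Proof.
move=> xC rH eH fH gH fe ge.
have hyp p q : p \notin cl M H -> q \notin cl M H -> par M H p q by exact: par_hyp.
pose kap p := sg C H x f p (+) o0 p.
suff : kap f = kap g.
  rewrite /kap (sg_refl cardF codeC xC fH); case: (sg C H x f g);
  by case: (o0 f); case: (o0 g).
apply: (const_off_hyperplane e1 r2 contract_conn (cl_idem M H) _ eH) => //.
  by rewrite rank_cl.
move=> L p q sL rL pH qH iep ieq hh.
have [eL peL] := ind2P _ _ _ _ iep; have [_ qeL] := ind2P _ _ _ _ ieq.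
suff hs : sg C H x p q = o0 p (+) o0 q.
  rewrite /kap (sg_trans cardF codeC xC (hyp f p fH pH) (hyp p q pH qH)) hs.
  by case: (sg C H x f p); case: (o0 p); case: (o0 q).
have ecl : cl M H = cl M (cl M H) by rewrite cl_idem.
rewrite (sg_cl codeC xC ecl (hyp p q pH qH)).
case: hh => [hpq|[h hH [ieh ipq ihp ihq]]].
  rewrite (sg_sub codeC xC sL hpq) ?cl_idem //.
  rewrite -(sg_sub codeC xC (subsetUr [set e] L) hpq) //.
  apply: coh_over => //; first by rewrite mem_cl // setU11.
  by apply: par_sub hpq peL; apply: subsetUr.
have hs : h |: L \subset cl M H by rewrite subUset sub1set hH.
rewrite (sg_sub codeC xC hs) ?cl_idem //; last by apply: ind2_par.
rewrite -(quad_sg_swap cardF codeC xC rL ieh iep ieq ihp ihq ipq xC) //.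
by apply: coh_over; rewrite ?mem_cl ?setU11 ?ind2_par.
Qed.

Local Notation basis := (transversal_basis M e).

(** The word is changed at one h of I. Unless e and f are already parallel over L = I - h, the Latin
    square on e, h and f over L has rows of constant sign; by [latin_form] the sign in question is
    that of [be], whatever the word. *)
Lemma sign_base I x y f : basis I -> x \in C -> y \in C -> f \notin cl M I ->
  f \notin cl M [set e] -> sg C I x e f = sg C I y e f.
Proof.
move=> bI xC yC fI fe; have [rI eI] := transversal_rank bI.
have step h x' z : h \in I -> x' \in C -> z \in C -> {in I :\ h, x' =1 z} ->
    sg C I x' e f = sg C I z e f.
  move=> hI x'C zC xz; set L := I :\ h in xz *.
  have sLI : L \subset I by exact: subsetDl.
  have eL := notin_cl_sub sLI eI; have fL := notin_cl_sub sLI fI.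
  have iI : indep M I by case: bI => iI _ _; apply: indep_sub iI; apply: subsetUr.
  have hL := notin_cl_indep iI hI; rewrite -/L in hL.
  have eIL : I = h |: L by rewrite /L setD1K.
  have rL : (M L).+2 = r by rewrite -rI eIL (notin_cl hL).
  have [fe'|fe'] := boolP (f \in cl M (e |: L)).
    have hp : par M L e f by apply/and3P.
    by rewrite !(sg_sub codeC _ sLI hp) // (sg_base codeC x'C zC xz hp).
  have ieh : ind2 M L e h by rewrite ind2C; apply/ind2P; rewrite -eIL.
  have ief : ind2 M L e f by apply/ind2P.
  have ihf : ind2 M L h f by apply/ind2P; rewrite -eIL.
  have hk w : w \in C -> {in L, w =1 z} -> sg C (e |: L) w h f = o0 h (+) o0 f.
    by move=> wC _; apply: coh_over; rewrite ?mem_cl ?setU11 ?ind2_par.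
  have [al [be [al0 ibe form]]] := latin_form cardF codeC zC rL ieh ief ihf hk.
  have [_ s1 _] := form_sgn cardF codeC rL ieh ief ihf al0 ibe form x'C xz.
  have [_ s2 _] := form_sgn cardF codeC rL ieh ief ihf al0 ibe form zC (fun _ _ => erefl).
  by rewrite eIL s1 s2.
have hp : par M I e f by apply: par_hyp.
have iI : indep M I by case: bI => iI _ _; apply: indep_sub iI; apply: subsetUr.
apply: (code_walk codeC iI (Phi := fun z => sg C I x e f = sg C I z e f)) xC yC _ => //.
- by move=> z w zC wC zw ->; apply: (sg_base codeC zC wC zw).
- by move=> h z w hI zC wC zw ->; apply: (step h).
Qed.

(** This common value becomes o(e). When h is exchanged for h' over the coline L, the Latin square
    on e, h and h' gives the sign of e, h' over [h |: L] and that of e, h over [h' |: L], and these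
    differ by o0 h + o0 h'. *)
Lemma sign_basis I J x y f g : basis I -> basis J -> x \in C -> y \in C ->
  f \notin cl M I -> f \notin cl M [set e] -> g \notin cl M J -> g \notin cl M [set e] ->
  sg C I x e f (+) o0 f = sg C J y e g (+) o0 g.
Proof.
have hyp K p : basis K -> p \notin cl M K -> par M K e p.
  by move=> bK pK; have [rK eK] := transversal_rank bK; apply: par_hyp.
have same K x' p q : basis K -> x' \in C -> p \notin cl M K -> q \notin cl M K ->
    p \notin cl M [set e] -> q \notin cl M [set e] ->
    sg C K x' e p (+) o0 p = sg C K x' e q (+) o0 q.
  move=> bK x'C pK qK pe qe; have [rK eK] := transversal_rank bK.
  rewrite (sg_trans cardF codeC x'C (hyp K p bK pK) (par_hyp rK pK qK)).
  rewrite (coh_hyperplane x'C rK eK pK qK pe qe).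
  by case: (sg C K x' e p); case: (o0 p); case: (o0 q).
move=> bI bJ xC yC.
pose R (I J : {set E}) := forall f g, f \notin cl M I -> f \notin cl M [set e] ->
   g \notin cl M J -> g \notin cl M [set e] ->
   sg C I y e f (+) o0 f = sg C J y e g (+) o0 g.
move=> fI fe gJ ge; rewrite (sign_base bI xC yC fI fe).
move: f g fI fe gJ ge; rewrite -/(R I J).
apply: (transversal_chain e1 r2) bI bJ => //.
- by move=> K bK f g fK fe gK ge; apply: same.
- move=> K K' K'' bK' h1 h2 f g fK fe gK ge.
  have [rK' _] := transversal_rank bK'.
  have [k kK ke] := outside_hyperplane e1 r2 delete_conn rK'.
  by rewrite (h1 f k) // (h2 k g).
move=> K h h' bK hK hh' f g fK fe gK ge.
have bK' := transversal_swap e1 r2 bK hK hh'; set K' := h' |: _ in bK' gK *.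
have [rK eK] := transversal_rank bK; have [rK' eK'] := transversal_rank bK'.
have [h'K|h'K] := boolP (h' \in cl M K).
  have sc : K' \subset cl M K.
    by rewrite subUset sub1set h'K (subset_trans (subsetDl _ _)) ?sub_cl.
  have ecl : cl M K' = cl M K.
    apply/eqP; rewrite eqEsubset cl_sub //=.
    rewrite -(cl_idem M K'); apply: cl_sub; rewrite cl_idem.
    apply: subset_trans (sub_cl M K) (cl_eq_rank sc _).
    by rewrite rank_cl; rlia.
  rewrite -(sg_cl codeC yC (esym ecl)); last by apply: hyp; rewrite // -ecl.
  by apply: same; rewrite // -ecl.
set L := K :\ h in hh' K' bK' gK rK' eK' *.
have iK : indep M K by case: bK => iK _ _; apply: indep_sub iK; apply: subsetUr.
have hL := notin_cl_indep iK hK; rewrite -/L in hL.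
have eKL : K = h |: L by rewrite /L setD1K.
have rL : (M L).+2 = r by rewrite -rK eKL (notin_cl hL).
have eL : e \notin cl M L by apply: notin_cl_sub eK; apply: subsetDl.
have ieh : ind2 M L e h by rewrite ind2C; apply/ind2P; rewrite -eKL.
have ieh' : ind2 M L e h' by apply/ind2P.
have ihh' : ind2 M L h h' by apply/ind2P; rewrite -eKL.
have he : h \notin cl M [set e].
  have [_ hn] := ind2P _ _ _ _ ieh; apply: notin_cl_sub hn; exact: subsetUl.
have h'e : h' \notin cl M [set e] by apply: notin_cl_sub hh'; exact: subsetUl.
have hK' : h \notin cl M K' by move: ihh'; rewrite ind2C => /ind2P[].
rewrite (same K y f h') // (same K' y g h) //.
have hk w : w \in C -> {in L, w =1 y} -> sg C (e |: L) w h h' = o0 h (+) o0 h'.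
  by move=> wC _; apply: coh_over; rewrite ?mem_cl ?setU11 ?ind2_par.
have [al [be [al0 ibe form]]] := latin_form cardF codeC yC rL ieh ieh' ihh' hk.
have [_ s1 s2] := form_sgn cardF codeC rL ieh ieh' ihh' al0 ibe form yC (fun _ _ => erefl).
rewrite eKL s1 /K' s2.
by case: (o0 h); case: (o0 h'); case: (sgn be).
Qed.

Lemma coherent_step : coherent M C.
Proof.
have [x0 x0C] := code_inh codeC.
have [I0 b0] := transversal_basis_ex e1.
have [rI0 _] := transversal_rank b0.
have [f0 f0I f0e] := outside_hyperplane e1 r2 delete_conn rI0.
pose s := sg C I0 x0 e f0 (+) o0 f0.
(* The value s at e is forced by [sign_basis]; elements parallel to e are compared with e directly,
   over the empty set. *)
pose o1 g := if g \in cl M [set e] then s (+) sg C set0 x0 e g else o0 g.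
have e0 : e \notin cl M set0 by apply: notin_clI; rewrite setU0 e1 rank0.
have o1e : o1 e = s by rewrite /o1 mem_cl1 (sg_refl cardF codeC x0C e0) addbF.
exists o1 => A x f g xC h; have [fA gA] := par_notin h.
have [A' [sA rA' fA']] : exists A', [/\ A \subset A', (M A').+1 = r & f \notin cl M A'].
  have [I sI [iI rI]] := rank_basis M A.
  have cI : cl M I = cl M A.
    apply/eqP; rewrite eqEsubset clS //=; apply: cl_sub; apply: cl_eq_rank => //.
    by rewrite rI.
  have iI' : indep M (f |: I) by rewrite indepU1 // cI.
  have [B [sB _] [iB rB]] := indep_ext (subsetT _) iI'.
  have fB : f \in B by move: sB; rewrite subUset sub1set => /andP[].
  have nf := notin_cl_indep iB fB.
  have fI : f \notin I by apply: contra fA => fI; rewrite -cI mem_cl.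
  have sIB : I \subset B :\ f.
    apply/subsetP => z zI; rewrite !inE; apply/andP; split.
      by apply: contraNneq fI => <-.
    by apply: (subsetP sB); rewrite in_setU1 zI orbT.
  have sAB : A \subset cl M (B :\ f).
    by apply: subset_trans (sub_cl M A) _; rewrite -cI; apply: clS.
  exists (cl M (B :\ f)); rewrite rank_cl cl_idem; split=> //.
  by rewrite -rB -(notin_cl nf) setD1K.
have hA' := par_sub sA h fA'; have [_ gA'] := par_notin hA'.
rewrite -(sg_sub codeC xC sA h fA').
have [eA'|eA'] := boolP (e \in cl M A').
  have off z : z \notin cl M A' -> o1 z = o0 z.
    move=> zA'; rewrite /o1; case: ifP => // ze; case/negP: zA'.
    by move: ze; apply/subsetP; apply: cl_sub; rewrite sub1set.
  by rewrite coh_over // !off.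
have [I sI [iI rI]] := rank_basis M A'.
have cI : cl M I = cl M A'.
  apply/eqP; rewrite eqEsubset clS //=; apply: cl_sub; apply: cl_eq_rank => //.
  by rewrite rI.
have bI : basis I.
  split; [by rewrite indepU1 // cI|by apply: contra eA' => eI; rewrite -cI mem_cl|].
  by rewrite notin_cl ?cI // rI.
have key z : z \notin cl M A' -> sg C I x e z = o1 e (+) o1 z.
  move=> zA'; rewrite o1e /o1; case: ifP => [ze|/negbT ze].
    have hp : par M set0 e z.
      apply/and3P; split=> //; last by rewrite setU0.
      by apply: notin_cl_sub zA'; apply: sub0set.
    rewrite (sg_sub codeC xC (sub0set _) hp) ?cI //.
    rewrite (sg_base codeC xC x0C _ hp) => [|k]; last by rewrite inE.
    by case: (s); case: (sg C set0 x0 e z).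
  have zI : z \notin cl M I by rewrite cI.
  by have := sign_basis bI b0 xC x0C zI ze f0I f0e; rewrite -/s => <-; case: (sg C I x e z); case: (o0 z).
rewrite (sg_cl codeC xC (esym cI) hA').
have hI z : z \notin cl M A' -> par M I e z.
  by move=> zA'; apply: par_hyp; rewrite ?cI // rI.
rewrite (sg_trans cardF codeC xC (par_sym (hI f fA')) (hI g gA')).
rewrite -(sg_sym cardF codeC xC (hI f fA')) !key //.
by case: (o1 e); case: (o1 f); case: (o1 g).
Qed.

End Step.

Lemma code_contract M C e c : matroid_code M C -> M [set e] = 1 ->
  matroid_code (contract M [set e]) [set y in C | y e == c].
Proof.
move=> codeC e1; have e0 : e \notin cl M set0 by apply: notin_clI; rewrite setU0 e1 rank0.
have inC x : (x \in [set y in C | y e == c]) = (x \in C) && (x e == c) by rewrite inE.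
split.
- have [x xC] := code_inh codeC; have [y [yC _ ye]] := code_free codeC c xC e0.
  by exists y; rewrite inC yC ye eqxx.
- move=> A f x y; rewrite !inC => /andP[xC /eqP xe] /andP[yC /eqP ye].
  rewrite cl_contract => fA xy; apply: (code_det codeC xC yC fA) => z.
  by rewrite !inE => /orP[/xy //|/eqP ->]; rewrite xe ye.
- move=> A f x s; rewrite inC cl_contract => /andP[xC /eqP xe] fA.
  have [y [yC yx yf]] := code_free codeC s xC fA; exists y.
  have ye : y e = c by rewrite yx // !inE eqxx orbT.
  rewrite inC yC ye eqxx; split=> // z zA.
  by apply: yx; rewrite inE zA.
Qed.

Lemma par_contract M e A f g : e \in A ->
  par (contract M [set e]) A f g = par M A f g.
Proof.
move=> eA; rewrite /par !cl_contract.
have -> : f |: A :|: [set e] = f |: A by stauto.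
by have -> : A :|: [set e] = A by stauto.
Qed.

Lemma sg_contract C e x A f g : e \in A ->
  sg [set y in C | y e == x e] A x f g = sg C A x f g.
Proof.
move=> eA; apply: sgn_ext => s; rewrite /tr.
suff /eq_pick -> : (fun y => (y \in [set y in C | y e == x e]) && (agree A y x && (y f == s)))
  =1 (fun y => (y \in C) && (agree A y x && (y f == s))) by [].
move=> y; rewrite inE -andbA; congr (_ && _).
by case: (boolP (agree A y x)) => [/agreeP/(_ e eA) ->|_]; rewrite ?eqxx // andbF.
Qed.

Lemma coherent_rank1 M C : matroid_code M C -> M setT <= 1 -> coherent M C.
Proof.
move=> codeC r1; have [x0 x0C] := code_inh codeC.
have [loops|[f0 f0n]] : cl M set0 = setT \/ exists f, f \notin cl M set0.
- have [/eqP|] := boolP (cl M set0 == setT); first by left.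
  by rewrite -subTset => /subsetPn[f _ hf]; right; exists f.
- exists (fun=> false) => A x f g _ /par_notin[/negP[]].
  by apply: (subsetP (clS M (sub0set A))); rewrite loops in_setT.
exists (sg C set0 x0 f0) => A x f g xC h; have [fA gA] := par_notin h.
have n0 z : z \notin cl M A -> z \notin cl M set0.
  by apply: notin_cl_sub; apply: sub0set.
have [rA rE] : M A = 0 /\ M setT = 1.
  by have := notin_cl fA; have := rank_mono M (subsetT (f |: A)); split; rlia.
have h0 z w : z \notin cl M set0 -> w \notin cl M set0 -> par M set0 z w.
  by move=> hz hw; apply: par_hyp; rewrite // rank0 rE.
rewrite -(sg_cl codeC xC (_ : cl M set0 = cl M A)) ?h0 ?n0 //; last first.
  by apply: cl_eq; rewrite ?sub0set //; apply: cl_eq_rank; rewrite ?sub0set // rA.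
have in0 : {in set0, x =1 x0} by move=> w; rewrite inE.
have hf := h0 f f0 (n0 _ fA) f0n; have hg := h0 f0 g f0n (n0 _ gA).
rewrite (sg_base codeC xC x0C in0 (par_trans hf hg)).
by rewrite (sg_trans cardF codeC x0C hf hg) (sg_sym cardF codeC x0C hf).
Qed.

(** Induction on the rank. In rank at least 3 the splitter provides e, and vertical 3-connectivity
    of M / e and of M yields the two connectivity conditions. In rank 2, M / e has rank 1, and the
    four classes keep the deletion connected. *)
Lemma coherent_wide M C F0 : vconn3 M -> wide M F0 -> matroid_code M C -> coherent M C.
Proof.
have [n le] : exists n, M setT <= n by exists (M setT).
elim: n => [|n IH] in M C F0 le *; move=> M3 wF codeC.
  by apply: coherent_rank1; rewrite // (leq_trans le).
have r2 : 1 < M setT by case/wideP: wF => <-.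
have step e : M [set e] = 1 ->
    (forall c, coherent (contract M [set e]) [set y in C | y e == c]) ->
    (forall X Y, X :|: Y = setT ->
      M (e |: X) + M (e |: Y) <= (M setT).+1 -> M (e |: X) <= 1 \/ M (e |: Y) <= 1) ->
    (forall X Y, X :|: Y :|: cl M [set e] = setT ->
      M X + M Y <= M setT -> M X = 0 \/ M Y = 0) -> coherent M C.
  move=> e1 hc h1 h2.
  have [o ho] : exists o : F -> E -> bool, forall c A x f g, x \in [set y in C | y e == c] ->
     par (contract M [set e]) A f g -> sg [set y in C | y e == c] A x f g = o c f (+) o c g.
    have [o ho] := fin_all_exists hc.
    by exists o.
  apply: (coherent_step codeC e1 r2 h1 h2 (o := o)) => A x f g xC eA hp.
  by rewrite -(sg_contract C _ _ _ eA) ho ?par_contract // inE xC eqxx.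
case: (ltnP 2 (M setT)) => [r3|r2'].
  have [F' [e [wF' e1 eF' N3]]] := splitter M3 r3 wF.
  have rT : contract M [set e] setT + 1 = M setT.
    by rewrite -{1}e1 contractE setUC (setUidPr _) ?subsetT.
  have wN : wide (contract M [set e]) F'.
    have eU A : F' \subset A -> A :|: [set e] = A.
      by move=> s; apply/setUidPl; rewrite sub1set (subsetP s).
    have cE A : F' \subset A -> contract M [set e] A + 1 = M A.
      by move=> s; rewrite -{1}e1 contractE eU.
    case/wideP: wF' => rF' [a [b [c [d h]]]]; apply/wideP; split.
      by have := cE F' (subxx _); rewrite -rF' in rT; rlia.
    have k p q : ind2 M F' p q -> ind2 (contract M [set e]) F' p q.
      rewrite !ind2_ge; have := cE F' (subxx _).
      have := cE (p |: (q |: F')); rewrite setUA subsetUr => /(_ isT); rlia.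
    by exists a, b, c, d; case: h => h1 h2 h3 h4 [h5 h6]; split; try split; apply: k.
  apply: (step e e1).
  - move=> c; apply: (IH _ _ F') => //; first by rlia.
    exact: code_contract.
  - move=> X Y XY sXY; case: (leqP (M (e |: X)) 1) => [|lX]; first by left.
    case: (leqP (M (e |: Y)) 1) => [|lY]; first by right.
    have := contractE M [set e] X; have := contractE M [set e] (~: X).
    rewrite e1 ![_ :|: [set e]]setUC => c1 c2.
    have : M (e |: ~: X) <= M (e |: Y).
      apply: rank_mono; apply: setUS; apply/subsetP => z.
      by have := in_setT z; rewrite -XY !inE; case: (z \in X).
    have := vconn3P _ N3 X; rlia.
  - move=> X Y XY sXY; case: (posnP (M X)) => [|pX]; first by left.
    case: (posnP (M Y)) => [|pY]; first by right.
    have := vconn3P _ M3 X; have := vconn3P _ M3 Y.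
    have cX : M (~: X) <= M Y + 1.
      have : M (~: X) <= M (Y :|: cl M [set e]).
        by apply: rank_mono; apply/subsetP => z; have := in_setT z; rewrite -XY;
           rewrite !in_setU in_setC; case: (z \in X).
      have := @rank_submod _ M (Y :|: cl M [set e]) set0 Y (cl M [set e]) (subxx _) (sub0set _).
      by rewrite rank_cl e1 rank0; rlia.
    have cY : M (~: Y) <= M X + 1.
      have : M (~: Y) <= M (X :|: cl M [set e]).
        by apply: rank_mono; apply/subsetP => z; have := in_setT z; rewrite -XY;
           rewrite !in_setU in_setC; case: (z \in X); case: (z \in Y).
      have := @rank_submod _ M (X :|: cl M [set e]) set0 X (cl M [set e]) (subxx _) (sub0set _).
      by rewrite rank_cl e1 rank0; rlia.
    have := rank_mono M (subsetT (~: X)); have := rank_mono M (subsetT (~: Y)).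
    rlia.
have rE : M setT = 2 by apply/eqP; rewrite eqn_leq r2' r2.
have [e _ e1] := @exists_nonloop _ M setT (ltnW r2).
have rF : M F0 = 0 by case/wideP: wF; rewrite rE => -[].
apply: (step e e1).
- move=> c; apply: coherent_rank1; first exact: code_contract.
  have := contractE M [set e] setT; rewrite e1 setUC (setUidPr _) ?subsetT // rE.
  rlia.
- move=> X Y _; rewrite rE; case: (leqP (M (e |: X)) 1) => [|lX]; first by left.
  case: (leqP (M (e |: Y)) 1) => [|lY]; [by right|rlia].
- move=> X Y XY; rewrite rE => sXY; case: (posnP (M X)) => [|pX]; first by left.
  case: (posnP (M Y)) => [|pY]; first by right.
  have u Z : M (Z :|: F0) <= M Z.
    have := @rank_submod _ M (Z :|: F0) set0 Z F0 (subxx _) (sub0set _).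
    by rewrite rF rank0; rlia.
  have [|| p [q [pn qn hpq]]] := @wide_pair _ M F0 X Y wF.
  + have := u X; rewrite rE; rlia.
  + have := u Y; rewrite rE; rlia.
  have cov z : z \notin X :|: Y -> z \in cl M [set e].
    by have := in_setT z; rewrite -XY in_setU; case: (z \in X :|: Y).
  move: hpq; rewrite ind2_ge rF => h.
  have : M (p |: (q |: F0)) <= M [set p; q] + M F0.
    have := @rank_submod _ M (p |: (q |: F0)) set0 [set p; q] F0.
    by rewrite rank0 => /(_ ltac:(stauto) (sub0set _)); rlia.
  have : M [set p; q] <= M [set e].
    by apply: rank_sub_cl; rewrite subUset !sub1set !cov.
  rlia.
Qed.

End Coherence.

(** * Linear codes *)

Section LinearCodes.

Variables (E : finType) (F : finFieldType).
Implicit Types (A B I L X Y : {set E}) (e f g h : E) (x y z : {ffun E -> F}).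
Implicit Types (M : matroid E) (C D : {set {ffun E -> F}}).

Local Open Scope ring_scope.

Definition linear_code M D := matroid_code M D /\
  forall a x y, x \in D -> y \in D -> [ffun e => a * x e + y e] \in D.

Section Coherent.

Hypothesis cardF : #|F| = 4%N.

Variables (M : matroid E) (C : {set {ffun E -> F}}).
Hypothesis codeC : matroid_code M C.

Lemma sg_relabel (o : E -> bool) A x f g : x \in C -> par M A f g ->
  sg [set [ffun e => frob (o e) (x e)] | x : {ffun E -> F} in C] A
    [ffun e => frob (o e) (x e)] f g = o f (+) sg C A x f g (+) o g.
Proof.
move=> xC h; have fK e := frobK cardF (o e).
have codeC' := code_map (phi := fun e => frob (o e)) (psi := fun e => frob (o e)) codeC fK fK.
pose G := frob (o g) \o (tr C A x f g \o frob (o f)).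
have iF k : injective (frob k : F -> F) := inv_inj (frobK cardF k).
have it := tr_inj codeC xC h.
have -> : o f (+) sg C A x f g (+) o g = sgn G.
  rewrite sgn_comp ?sgn_comp ?(sgn_frob cardF) //; last exact: inj_comp.
  by rewrite -/(sg C A x f g); case: (o f); case: (o g); case: (sg C A x f g).
apply: sgn_ext; apply: (tr_ext codeC' _ h); first exact: imset_f.
move=> _ /imsetP[y yC ->] yx; rewrite !ffunE /G /= fK (trE codeC h yC) // => e eA.
by have := yx e eA; rewrite !ffunE => /iF.
Qed.

Section Even.

Hypothesis even : forall A x f g, x \in C -> par M A f g -> sg C A x f g = false.

(** With the rest L of B fixed, the value at f is affine in that at b, all signs being trivial. To
    see that the slope survives a change at h in L, the Latin square on h, b and f is used: its rows
    share the slope [al2], which is compared with [al] on two words whose values at b differ by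
    1. *)
Lemma coord_slope B f b : is_basis M B -> b \in B -> exists al : F, forall x y,
  x \in C -> y \in C -> {in B :\ b, x =1 y} -> x f - y f = al * (x b - y b).
Proof.
move=> bB bb; have [iB rB] := bB; set L := B :\ b.
have rL : (M L).+1 = M setT := rankD1_basis bB bb.
have iL : indep M L by apply: indep_sub iB; apply: subsetDl.
have bL : b \notin cl M L by exact: notin_cl_indep.
have [fL|fL] := boolP (f \in cl M L).
  by exists 0 => x y xC yC xy; rewrite (code_det codeC xC yC fL xy) subrr mul0r.
have hp : par M L b f by exact: par_hyp.
have [x0 x0C] := code_inh codeC.
have [al [be [al0 hal]]] := sgnP cardF (tr_inj codeC x0C hp).
rewrite -/(sg C L x0 b f) even // in hal.
exists al; pose Phi x := forall y y', y \in C -> y' \in C -> {in L, y =1 x} ->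
  {in L, y' =1 x} -> y f - y' f = al * (y b - y' b).
suff main x : x \in C -> Phi x by move=> x y xC yC xy; apply: (main y yC).
move=> xC; apply: (code_walk codeC iL (Phi := Phi)) x0C xC _.
- move=> x1 x2 _ _ x12 h1 y y' yC y'C y2 y'2.
  by apply: h1 => // e eL; rewrite ?y2 ?y'2 // x12.
- move=> h x1 x2 hL x1C x2C; set L2 := L :\ h => x12 h1 y y' yC y'C yx y'x.
  have hL2 : h \notin cl M L2 by exact: notin_cl_indep.
  have eL : L = h |: L2 by rewrite /L2 setD1K.
  have rL2 : (M L2).+2 = M setT by rewrite -rL eL (notin_cl hL2).
  have sL2 : L2 \subset L by exact: subsetDl.
  have bL2 := notin_cl_sub sL2 bL; have fL2 := notin_cl_sub sL2 fL.
  have [fb|fb] := boolP (f \in cl M (b |: L2)).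
    have hp2 : par M L2 b f by apply/and3P.
    have b1 : b \notin cl M L by [].
    have up z : z \in C -> {in L, z =1 x2} -> exists w, [/\ w \in C, {in L, w =1 x1},
        w b = z b & w f = z f].
      move=> zC zx; have [w [wC wx wb]] := code_free codeC (z b) x1C b1.
      exists w; split=> //; apply: (code_det codeC wC zC fb) => e.
      rewrite in_setU1 => /orP[/eqP ->//|eL2].
      by rewrite wx ?x12 ?zx // (subsetP sL2).
    have [w [wC wx <- <-]] := up y yC yx; have [w' [w'C w'x <- <-]] := up y' y'C y'x.
    exact: h1.
  have ihb : ind2 M L2 h b by apply/ind2P; rewrite -eL.
  have ihf : ind2 M L2 h f by apply/ind2P; rewrite -eL.
  have ibf : ind2 M L2 b f by apply/ind2P.
  have ev z : z \in C -> {in L2, z =1 x2} -> sg C (h |: L2) z b f = false.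
    by move=> zC _; apply: even; rewrite // -eL.
  have [al2 [be2 [_ _ form]]] := latin_form cardF codeC x2C rL2 ihb ihf ibf ev.
  have onL z z' : z \in C -> z' \in C -> {in L2, z =1 x2} -> {in L2, z' =1 x2} ->
     z h = z' h -> z f - z' f = al2 * (z b - z' b).
    by move=> zC z'C zx z'x zh; rewrite !form //= zh; ring.
  have [w [wC wx wb]] := code_free codeC (x1 b + 1) x1C bL.
  have k1 := h1 w x1 wC x1C wx (fun _ _ => erefl).
  have wx2 : {in L2, w =1 x2} by move=> e eL2; rewrite wx ?x12 // (subsetP sL2).
  have k2 := onL w x1 wC x1C wx2 x12 (wx h hL).
  have -> : al = al2.
    by apply: (mulIf (oner_neq0 F)); move: k2; rewrite k1 wb [x1 b + 1]addrC addrK.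
  apply: onL => //; try by move=> e eL2; rewrite ?yx ?y'x // (subsetP sL2).
  by rewrite yx ?y'x.
- move=> y y' yC y'C yx y'x.
  have hy z : z \in C -> {in L, z =1 x0} -> z f = al * z b + be.
    by move=> zC zx; rewrite -(trE codeC hp zC zx) hal.
  by rewrite !hy //; ring.
Qed.

(** Adding up the slopes along a walk makes x f - y f a linear function of the differences on a
    basis, so the translate of C by one of its words is linear. *)
Lemma even_linear : exists D, linear_code M D.
Proof.
have [B _ bB] := indep_extend_basis (indep0 M); have [iB rB] := bB.
have [x0 x0C] := code_inh codeC.
have [al hal] : exists al : E -> E -> F, forall f b, b \in B -> forall x y,
    x \in C -> y \in C -> {in B :\ b, x =1 y} -> x f - y f = al f b * (x b - y b).
  have ex f : exists al : E -> F, forall b, b \in B -> forall x y,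
      x \in C -> y \in C -> {in B :\ b, x =1 y} -> x f - y f = al b * (x b - y b).
    have /fin_all_exists[al hal] : forall b, exists a : F, b \in B -> forall x y,
        x \in C -> y \in C -> {in B :\ b, x =1 y} -> x f - y f = a * (x b - y b).
      move=> b; have [bb|bb] := boolP (b \in B); last by exists 0.
      by have [a ha] := coord_slope f bB bb; exists a.
    by exists al.
  by have [al hal] := fin_all_exists ex; exists al.
have formula x y f : x \in C -> y \in C -> x f - y f = \sum_(b in B) al f b * (x b - y b).
  move=> xC yC; pose Phi z := z f - y f = \sum_(b in B) al f b * (z b - y b).
  apply: (code_walk codeC iB (Phi := Phi)) yC xC _.
  - move=> z w zC wC zw; rewrite /Phi => hz.
    have fB : f \in cl M B by apply: full_cl.
    rewrite -(code_det codeC zC wC fB zw) hz; apply: eq_bigr => b bb.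
    by rewrite zw.
  - move=> h z w hB zC wC zw; rewrite /Phi => hz.
    have -> : w f - y f = (z f - y f) + al f h * (w h - z h).
      by rewrite -(hal f h hB w z wC zC) => [|e /zw //]; ring.
    rewrite hz (bigD1 h) //= [RHS](bigD1 h) //=.
    rewrite (eq_bigr (fun b => al f b * (w b - y b))) => [|b /andP[bb bh]].
      by ring.
    by rewrite zw // !inE bh.
  - by rewrite /Phi subrr big1 // => b _; rewrite subrr mulr0.
exists [set [ffun e => x e - x0 e] | x : {ffun E -> F} in C]; split.
  split.
  - by exists [ffun e => x0 e - x0 e]; apply: imset_f.
  - move=> A e _ _ /imsetP[x xC ->] /imsetP[y yC ->] eA xy; rewrite !ffunE.
    congr (_ - _); apply: (code_det codeC xC yC eA) => g /xy; rewrite !ffunE.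
    exact: addIr.
  - move=> A e _ s /imsetP[x xC ->] eA.
    have [y [yC yx ye]] := code_free codeC (s + x0 e) xC eA.
    exists [ffun e => y e - x0 e]; rewrite imset_f // ffunE ye addrK; split=> //.
    by move=> g gA; rewrite !ffunE yx.
move=> a _ _ /imsetP[x xC ->] /imsetP[y yC ->].
have [w wC wB] := code_lift (fun e => x0 e + a * (x e - x0 e) + (y e - x0 e)) codeC iB.
apply/imsetP; exists w => //; apply/ffunP => e; rewrite !ffunE.
rewrite (formula w x0 e wC x0C) (formula x x0 e xC x0C) (formula y x0 e yC x0C).
rewrite mulr_sumr -big_split /=; apply: eq_bigr => b bb.
by rewrite wB //; ring.
Qed.

End Even.

End Coherent.

Lemma coherent_linear (cardF : #|F| = 4%N) M C : matroid_code M C -> coherent M C ->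
  exists D, linear_code M D.
Proof.
move=> codeC [o ho]; have fK e := frobK cardF (o e).
pose phi e := @frob F (o e).
apply: (even_linear cardF (code_map (phi := phi) (psi := phi) codeC fK fK)).
move=> A _ f g /imsetP[x xC ->] h.
by rewrite (sg_relabel cardF codeC o xC h) ho //; case: (o f); case: (o g).
Qed.

(** * Linear codes of matroids without wide colines *)

Section Binary.

Hypothesis addxx : forall a : F, a + a = 0.

Variable M : matroid E.
Hypothesis narrow : forall L, ~~ wide M L.

(** For f outside B, the entry tells whether b lies in the fundamental circuit of f. *)
Definition fund B f b : F := (f \notin cl M (B :\ b))%:R.

Definition fund_code B : {set {ffun E -> F}} :=
  [set x : {ffun E -> F} | [forall f, x f == \sum_(b in B) fund B f b * x b]].

Lemma fund_codeP B x :
  reflect (forall f, x f = \sum_(b in B) fund B f b * x b) (x \in fund_code B).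
Proof. by rewrite inE; apply: (iffP forallP) => h f; apply/eqP. Qed.

(* In the rank-2 contraction M / L every element outside cl L lies in one of
   the classes of b, g and b', so the fundamental matrix pivots as over F_2. *)
Lemma fund_pivot L b g b' f : (M L).+2 = M setT -> ind2 M L b g ->
  b' \notin cl M (g |: L) ->
  (f \notin cl M (b' |: L))%:R = (f \notin cl M (b |: L))%:R +
     (f \notin cl M (g |: L))%:R * (b' \notin cl M (b |: L))%:R :> F.
Proof.
move=> rL ibg b'g; have [bL gb] := ind2P _ _ _ _ ibg.
have igb : ind2 M L g b by rewrite ind2C.
have [gL bg] := ind2P _ _ _ _ igb.
have b'L : b' \notin cl M L by apply: notin_cl_sub b'g; apply: subsetUr.
have igb' : ind2 M L g b' by apply/ind2P.
have [b'b|b'b] := boolP (b' \in cl M (b |: L)).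
  have hp : par M L b b' by apply/and3P.
  by rewrite (par_clE hp) mulr0 addr0.
have ibb' : ind2 M L b b' by apply/ind2P.
have [fL|fL] := boolP (f \in cl M L).
  have s p : f \in cl M (p |: L) by move: fL; apply/subsetP; apply: clS; apply: subsetUr.
  by rewrite !s mul0r addr0.
have two p q : p \notin cl M L -> q \notin cl M L -> ind2 M L p q ->
    f \in cl M (p |: L) -> f \in cl M (q |: L) -> false.
  move=> pL qL /ind2P[_ qp] fp fq; have h1 : par M L p f by apply/and3P.
  have h2 : par M L f q by apply: par_sym; apply/and3P.
  by have /and3P[_ _ h3] := par_trans h1 h2; rewrite h3 in qp.
have some : [|| f \in cl M (b |: L), f \in cl M (g |: L) | f \in cl M (b' |: L)].
  apply/negPn/negP; rewrite !negb_or => /and3P[fb fg fb'].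
  case/negP: (narrow L); apply/wideP; split=> //; exists b, g, b', f.
  by split=> //; [apply/ind2P|split; apply/ind2P].
have n1 := two b g bL gL ibg; have n2 := two b b' bL b'L ibb'.
have n3 := two g b' gL b'L igb'.
case h1 : (f \in cl M (b |: L)) n1 n2 some; case h2 : (f \in cl M (g |: L)) n3;
  case h3 : (f \in cl M (b' |: L)) => //= n3 n1 n2 _;
  rewrite ?mulr1 ?mulr0 ?mul0r ?addr0 ?add0r ?addxx //;
  by [have := n1 isT isT|have := n2 isT isT|have := n3 isT isT].
Qed.

(** Eliminating x b in favour of x b' changes the coefficients exactly as [fund_pivot]
    prescribes. *)
Lemma fund_code_swap B b b' : is_basis M B -> b \in B -> b' \notin cl M (B :\ b) ->
  fund_code B \subset fund_code (b' |: (B :\ b)).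
Proof.
move=> bB bb nb'; have [iB rB] := bB.
have [b'B|b'B] := boolP (b' \in B).
  have <- : b = b'.
    by apply/eqP; apply: contraNT nb' => ne; apply: mem_cl; rewrite !inE eq_sym ne.
  by rewrite setD1K.
apply/subsetP => x /fund_codeP hx; apply/fund_codeP => f.
set B' := b' |: B :\ b.
have D1 : B' :\ b' = B :\ b by rewrite /B' setU1K // !inE (negbTE b'B) andbF.
have split1 (G : E -> F) : \sum_(c in B) G c = G b + \sum_(c in B :\ b) G c.
  rewrite (bigD1 b) //=; congr (_ + _); apply: eq_bigl => c; by rewrite !inE andbC.
have split2 (G : E -> F) : \sum_(c in B') G c = G b' + \sum_(c in B :\ b) G c.
  rewrite (bigD1 b') ?setU11 //=; congr (_ + _); apply: eq_bigl => c.
  by rewrite -D1 !inE andbC.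
have fb' : fund B b' b = 1 by rewrite /fund nb'.
have xb : x b = x b' + \sum_(c in B :\ b) fund B b' c * x c.
  by rewrite (hx b') split1 fb' mul1r -addrA addxx addr0.
rewrite split2 {1}(hx f) split1 {1}xb mulrDr -addrA mulr_sumr -big_split /=.
congr (_ + _); first by rewrite /fund D1.
apply: eq_bigr => c; rewrite !inE => /andP[cb cB].
rewrite mulrA -mulrDl; congr (_ * _).
pose L := B :\ b :\ c.
have eB'c : B' :\ c = b' |: L.
  apply/setP => z; rewrite !inE; case: (eqVneq z b') => [->|_] /=; last by rewrite andbCA.
  by rewrite andbT; apply: contraNneq b'B => ->.
have eBc : B :\ c = b |: L.
  apply/setP => z; rewrite !inE; case: (eqVneq z b) => [->|_] /=; last by [].
  by rewrite bb andbT eq_sym.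
have eBb : B :\ b = c |: L by rewrite /L setD1K // !inE cb.
have iBb : indep M (B :\ b) by apply: indep_sub iB; apply: subsetDl.
have cL : c \notin cl M L by apply: notin_cl_indep; rewrite // !inE cb.
have rL : (M L).+2 = M setT by rewrite -(rankD1_basis bB bb) eBb (notin_cl cL).
have icb : ind2 M L c b by apply/ind2P; split=> //; rewrite -eBb; exact: notin_cl_indep.
rewrite /fund eB'c eBc eBb addrC (@fund_pivot L b c b' f) //.
- by rewrite ind2C.
- by rewrite -eBb.
Qed.

Lemma fund_code_eq B B' : is_basis M B -> is_basis M B' -> fund_code B = fund_code B'.
Proof.
move=> bB bB'; apply/eqP; rewrite eqEsubset.
have sub I J : is_basis M I -> is_basis M J -> fund_code I \subset fund_code J.
  move=> bI bJ; apply: (basis_chain (R := fun I J => fund_code I \subset fund_code J)) bI bJ => //.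
  - by move=> K K' K'' _; apply: subset_trans.
  - exact: fund_code_swap.
by rewrite !sub.
Qed.

(** As the code is the same for all bases, its properties at A are checked with a basis of M that
    extends one of A. *)
Lemma binary_linear : exists D, linear_code M D.
Proof.
have [B0 _ bB0] := indep_extend_basis (indep0 M).
have ext A : exists I B, [/\ I \subset A, cl M I = cl M A, I \subset B & is_basis M B].
  have [I sI [iI rI]] := rank_basis M A; have [B sB bB] := indep_extend_basis iI.
  exists I, B; split=> //; apply: cl_eq; first exact: subset_trans sI (sub_cl M A).
  by apply: cl_eq_rank; rewrite // rI.
have fund0 I B f b : I \subset B -> f \in cl M I -> b \notin I -> fund B f b = 0.
  move=> sI fI bI; rewrite /fund; have -> // : f \in cl M (B :\ b).
  move: fI; apply/subsetP; apply: clS; apply/subsetP => z zI; rewrite !inE (subsetP sI) // andbT.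
  by apply: contraNneq bI => <-.
exists (fund_code B0); split; last first.
  move=> a x y /fund_codeP hx /fund_codeP hy; apply/fund_codeP => f; rewrite ffunE hx hy.
  rewrite mulr_sumr -big_split /=; apply: eq_bigr => b _; rewrite ffunE; ring.
split.
- exists [ffun=> 0]; apply/fund_codeP => f; rewrite ffunE big1 // => b _.
  by rewrite ffunE mulr0.
- move=> A e x y; have [I [B [sI cI sB bB]]] := ext A.
  rewrite (fund_code_eq bB0 bB) => /fund_codeP hx /fund_codeP hy eA xy.
  rewrite hx hy; apply: eq_bigr => b bB'; have [bI|bI] := boolP (b \in I).
    by rewrite xy // (subsetP sI).
  by rewrite (fund0 I) ?mul0r // cI.
- move=> A e x s; have [I sI [iI rI]] := rank_basis M A.
  have cI : cl M I = cl M A.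
    by apply: cl_eq; [exact: subset_trans sI (sub_cl M A)|apply: cl_eq_rank; rewrite // rI].
  move=> + eA; have iI' : indep M (e |: I) by rewrite indepU1 // cI.
  have [B sB bB] := indep_extend_basis iI'; have [iB _] := bB.
  rewrite (fund_code_eq bB0 bB) => /fund_codeP hx.
  pose v b := if b == e then s else x b.
  have eB : e \in B by apply: (subsetP sB); rewrite setU11.
  have sIB : I \subset B by apply: subset_trans sB; apply: subsetUr.
  have eI : e \notin I by apply: contra eA => eI; rewrite -cI mem_cl.
  pose y := [ffun f => \sum_(b in B) fund B f b * v b].
  have yB b : b \in B -> y b = v b.
    move=> bb; rewrite ffunE (bigD1 b) //= big1 => [|c /andP[cB cb]].
      by rewrite /fund notin_cl_indep // mul1r addr0.
    by rewrite /fund mem_cl ?mul0r // !inE eq_sym cb.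
  exists y; split.
  + by apply/fund_codeP => f; rewrite {1}ffunE; apply: eq_bigr => b bb; rewrite yB.
  + move=> f fA; rewrite ffunE hx; apply: eq_bigr => b bb; rewrite /v.
    case: (eqVneq b e) => [->|//]; rewrite (fund0 I) ?mul0r //.
    by rewrite cI mem_cl.
  + by rewrite yB // /v eqxx.
Qed.

End Binary.

End LinearCodes.

(** * Gluing along separations *)

Section CodeLinear.

Variables (E : finType) (F : finFieldType).
Implicit Types (A B I L X Y : {set E}) (e f g h : E) (x y z : {ffun E -> F}).
Implicit Types (M : matroid E) (C D : {set {ffun E -> F}}).

Lemma linear_code_scale M D a x y : linear_code M D -> x \in D -> y \in D ->
  [ffun e => a * x e + y e]%R \in D.
Proof. by case=> _; apply. Qed.

Lemma linear_code0 M D : linear_code M D -> [ffun=> 0%R] \in D.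
Proof.
move=> lD; have [x xD] := code_inh (proj1 lD).
have := linear_code_scale (-1)%R lD xD xD.
by congr (_ \in D); apply/ffunP => e; rewrite !ffunE mulN1r addNr.
Qed.

(* A 2-sum of M1 on X and M2 off X along the base point y0 of M1 and x0 of M2;
   the sum is direct if the base points are loops. *)
Lemma glue_codes M M1 M2 D1 D2 X (x0 y0 : E) : linear_code M1 D1 -> linear_code M2 D2 ->
  (forall A e, e \in X -> (e \in cl M A) =
     (e \in cl M1 (if x0 \in cl M2 (A :\: X) then y0 |: A :&: X else A :&: X))) ->
  (forall A e, e \notin X -> (e \in cl M A) =
     (e \in cl M2 (if y0 \in cl M1 (A :&: X) then x0 |: A :\: X else A :\: X))) ->
  exists D, linear_code M D.
Proof.
move=> l1 l2 h1 h2; have [k1 _] := l1; have [k2 _] := l2.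
pose G (c1 c2 : {ffun E -> F}) := [ffun e => if e \in X then c1 e else c2 e].
pose D := [set G c.1 c.2 | c in [pred c : {ffun E -> F} * {ffun E -> F} |
             [&& c.1 \in D1, c.2 \in D2 & c.1 y0 == c.2 x0]]].
have inD c1 c2 : c1 \in D1 -> c2 \in D2 -> c1 y0 = c2 x0 -> G c1 c2 \in D.
  move=> d1 d2 e; apply/imsetP; exists (c1, c2) => //; by rewrite inE /= d1 d2 e eqxx.
have Din z : z \in D -> exists c1 c2, [/\ c1 \in D1, c2 \in D2, c1 y0 = c2 x0 & z = G c1 c2].
  by case/imsetP => -[c1 c2]; rewrite inE /= => /and3P[d1 d2 /eqP e] ->; exists c1, c2.
have onX c1 c2 c1' c2' A : {in A, G c1 c2 =1 G c1' c2'} -> {in A :&: X, c1 =1 c1'}.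
  by move=> h g; rewrite inE => /andP[gA gX]; have := h g gA; rewrite !ffunE gX.
have offX c1 c2 c1' c2' A : {in A, G c1 c2 =1 G c1' c2'} -> {in A :\: X, c2 =1 c2'}.
  by move=> h g; rewrite inE => /andP[gX gA]; have := h g gA; rewrite !ffunE (negbTE gX).
exists D; split; last first.
  move=> a _ _ /Din[c1 [c2 [d1 d2 e ->]]] /Din[c1' [c2' [d1' d2' e' ->]]].
  have := inD _ _ (linear_code_scale a l1 d1 d1') (linear_code_scale a l2 d2 d2').
  rewrite !ffunE e e' => /(_ erefl); congr (_ \in D); apply/ffunP => g.
  by rewrite !ffunE; case: ifP.
split.
- exists (G [ffun=> 0%R] [ffun=> 0%R]); apply: inD; rewrite ?ffunE //.
    exact: linear_code0 l1.
  exact: linear_code0 l2.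
- move=> A e _ _ /Din[c1 [c2 [d1 d2 e12 ->]]] /Din[c1' [c2' [d1' d2' e12' ->]]] eA zz.
  have z1 := onX _ _ _ _ _ zz; have z2 := offX _ _ _ _ _ zz; rewrite !ffunE.
  have [eX|eX] := boolP (e \in X).
    move: eA; rewrite h1 //; case: ifP => [q eA|_ eA].
      apply: (code_det k1 d1 d1' eA) => g; rewrite in_setU1 => /orP[/eqP ->|/z1 //].
      by rewrite e12 e12'; apply: (code_det k2 d2 d2' q).
    exact: (code_det k1 d1 d1' eA).
  move: eA; rewrite h2 //; case: ifP => [q eA|_ eA].
    apply: (code_det k2 d2 d2' eA) => g; rewrite in_setU1 => /orP[/eqP ->|/z2 //].
    by rewrite -e12 -e12'; apply: (code_det k1 d1 d1' q).
  exact: (code_det k2 d2 d2' eA).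
- move=> A e _ s /Din[c1 [c2 [d1 d2 e12 ->]]].
  have [eX|eX] := boolP (e \in X).
    rewrite h1 //; case: ifP => [q eA|/negbT q eA].
      have [c [dc cc ce]] := code_free k1 s d1 eA.
      exists (G c c2); rewrite inD ?cc ?setU11 // ffunE eX; split=> // g gA.
      by rewrite !ffunE; case: ifP => // gX; rewrite cc // !inE gX gA orbT.
    have [c [dc cc ce]] := code_free k1 s d1 eA.
    have [c' [dc' cc' ce']] := code_free k2 (c y0) d2 q.
    exists (G c c'); rewrite inD ?ce' // ffunE eX; split=> // g gA.
    by rewrite !ffunE; case: ifP => gX; rewrite ?cc ?cc' // !inE gX gA.
  rewrite h2 //; case: ifP => [q eA|/negbT q eA].
    have [c [dc cc ce]] := code_free k2 s d2 eA.
    exists (G c1 c); rewrite inD ?cc ?setU11 // ffunE (negbTE eX); split=> // g gA.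
    by rewrite !ffunE; case: ifP => // gX; rewrite cc // !inE gX gA orbT.
  have [c [dc cc ce]] := code_free k2 s d2 eA.
  have [c' [dc' cc' ce']] := code_free k1 (c x0) d1 q.
  exists (G c' c); rewrite inD ?ce' // ffunE (negbTE eX); split=> // g gA.
  by rewrite !ffunE; case: ifP => gX; rewrite ?cc ?cc' // !inE gX gA.
Qed.

Section Separation.

Variable M : matroid E.
Local Notation r := (M setT).

(* Contracting I from the side of ~: X leaves at most the base point y there,
   up to parallel elements. *)
Definition cosep X I (y : E) := [/\ I \subset ~: X, y \in ~: X, M I + M X = r,
  M (X :|: I) = r & ~: X \subset cl M (y |: I)].

(** I is a basis of [~: X] in M / X. The rank of [~: X] exceeds that of I by at most one, and y
    makes up the difference; if I spans [~: X], any y will do and is a loop of M / I. *)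
Lemma cosep_exists X : M X < r -> M X + M (~: X) <= r.+1 -> exists I (y : E), cosep X I y.
Proof.
move=> ltX leX; have [I sI [iI rI]] := rank_basis (contract M X) (~: X).
have c1 := contractE M X I; have c2 := contractE M X (~: X).
have eT : ~: X :|: X = setT by stauto.
rewrite eT in c2.
have rI' : M I + M X = r.
  have := @rank_submod _ M (I :|: X) set0 I X (subxx _) (sub0set _).
  have := mrank_card M I; move/eqP: iI; rewrite rank0; rlia.
have rU : M (X :|: I) = r by rewrite setUC; rlia.
exists I; have [s|] := boolP (~: X \subset cl M I).
  have [e0|[y yX]] := set_0Vmem (~: X).
    by move: ltX; rewrite -[X]setCK e0 setC0 ltnn.
  by exists y; split=> //; apply: subset_trans s (clS _ (subsetUr _ _)).
case/subsetPn => y yX yI; exists y; split=> //.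
apply: cl_eq_rank; first by rewrite subUset sub1set yX.
by rewrite (notin_cl yI); rlia.
Qed.

(** Let B be the part of A off X. If B and J span the base point x0, then B acts on subsets of X
    like all of [~: X], which M / I reduces to y. Otherwise B is skew to X and does not affect
    closures inside X. *)
Lemma cosep_cl X I (y : E) J (x0 : E) A e : cosep X I y -> cosep (~: X) J x0 ->
  M X + M (~: X) <= r.+1 -> e \in X ->
  (e \in cl M A) = (e \in cl (contract M I)
     (if x0 \in cl (contract M J) (A :\: X) then y |: A :&: X else A :&: X)).
Proof.
move=> [sI yX rI rXI sY] [sJ xX rJ rYJ sX] leX eX; rewrite setCK in sJ xX sX.
set B := A :\: X; set A1 := A :&: X.
have eA : A = A1 :|: B by rewrite /A1 /B setID.
have sB : B \subset ~: X by rewrite /B; stauto.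
have sA1 : A1 \subset X by exact: subsetIr.
have F1 (V W K : {set E}) : K \subset W -> M (W :|: V) = M W + M V -> M (K :|: V) = M K + M V.
  move=> sK h; have k1 := @rank_submod _ M (K :|: V) set0 K V (subxx _) (sub0set _).
  have k2 := @rank_submod _ M (W :|: V) K (K :|: V) W.
  have {}k2 := k2 ltac:(stauto) ltac:(stauto).
  by rewrite rank0 in k1; rlia.
have rkI (K : {set E}) : K \subset X -> M (K :|: I) = M K + M I.
  by move=> sK; apply: (@F1 I X) => //; rewrite rXI; rlia.
have rBJ : M (B :|: J) = M B + M J.
  by apply: (@F1 J (~: X)) => //; rewrite rYJ; rlia.
have sJB : B :|: X \subset cl M (x0 |: (B :|: J)).
  rewrite subUset; apply/andP; split.
    by apply: subset_trans (sub_cl M _); stauto.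
  by apply: subset_trans sX (clS _ _); stauto.
have rBX : M (B :|: X) = M (x0 |: (B :|: J)).
  apply/eqP; rewrite eqn_leq rank_sub_cl //= rank_mono //.
  by rewrite !subUset sub1set !inE xX orbT subsetUl (subset_trans sJ) ?subsetUr.
have clE (K K' : {set E}) : M K = M K' -> M (e |: K) = M (e |: K') -> (e \in cl M K) = (e \in cl M K').
  by move=> h1 h2; rewrite !inE h1 h2.
have eU (K V : {set E}) : e |: (K :|: V) = (e |: K) :|: V by rewrite setUA.
have sA1e : e |: A1 \subset X by rewrite subUset sub1set eX.
rewrite !cl_contract; case: ifP => [q|/negbT q].
  have cY : cl M (y |: A1 :|: I) = cl M (A1 :|: ~: X).
    apply: cl_eq; last first.
      rewrite subUset; apply/andP; split.
        by apply: subset_trans (sub_cl M _); stauto.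
      by apply: subset_trans sY (clS _ _); stauto.
    apply: subset_trans (sub_cl M _).
    by rewrite !subUset sub1set in_setU yX orbT subsetUl (subset_trans sI) ?subsetUr.
  rewrite cY.
  have key (K : {set E}) : K \subset X -> M (K :|: B) + M (~: X) = M (K :|: ~: X) + M B.
    move=> sK; move/clP: q => q; rewrite q in rBX.
    have k1 := @rank_submod _ M (K :|: ~: X) B (K :|: B) (~: X).
    have {}k1 := k1 ltac:(stauto) ltac:(stauto).
    have k2 := @rank_submod _ M setT (K :|: B) (K :|: ~: X) (B :|: X).
    have {}k2 := k2 ltac:(stauto) ltac:(stauto).
    by rlia.
  have q1 := key A1 sA1; have q2 := key _ sA1e.
  rewrite eA [LHS]inE [RHS]inE !eU; apply/eqP/eqP; rlia.
have skew (K : {set E}) : K \subset X -> M (K :|: B) = M K + M B.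
  move=> sK; apply: (@F1 B X) => //; rewrite setUC.
  have := @rank_submod _ M (B :|: X) set0 B X (subxx _) (sub0set _).
  by rewrite rank0; move: (notin_cl q); rlia.
have q1 := skew A1 sA1; have q2 := skew _ sA1e.
have q3 := rkI A1 sA1; have q4 := rkI _ sA1e.
by rewrite eA [LHS]inE [RHS]inE !eU; apply/eqP/eqP; rlia.
Qed.

End Separation.

Lemma code_contract_agree M C I x : matroid_code M C -> x \in C ->
  matroid_code (contract M I) [set y in C | agree I y x].
Proof.
move=> codeC xC.
have inC y : (y \in [set y in C | agree I y x]) = (y \in C) && (agree I y x) by rewrite inE.
split.
- by exists x; rewrite inC xC; apply/agreeP.
- move=> A f y z; rewrite !inC => /andP[yC /agreeP yx] /andP[zC /agreeP zx].
  rewrite cl_contract => fA yz; apply: (code_det codeC yC zC fA) => g.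
  by rewrite in_setU => /orP[/yz //|gI]; rewrite yx ?zx.
- move=> A f y s; rewrite inC cl_contract => /andP[yC /agreeP yx] fA.
  have [z [zC zy zf]] := code_free codeC s yC fA; exists z; split=> //.
    rewrite inC zC; apply/agreeP => g gI; rewrite zy ?yx //.
    by rewrite in_setU gI orbT.
  by move=> g gA; rewrite zy // in_setU gA.
Qed.

(** Both pieces of a separation are contractions by sets of positive rank: their codes come from C
    by fixing coordinates, and they have fewer nonloops. *)
Lemma code_linear (cardF : #|F| = 4) M C : matroid_code M C -> exists D, linear_code M D.
Proof.
have [n le] : exists n, #|[set e | M [set e] == 1]| <= n by eexists; apply: leqnn.
elim: n => [|n IH] in M C le * => codeC.
  (* Without nonloops the rank is 0, so no coline is wide. *)
  apply: binary_linear; first exact: f4_addxx.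
  move=> L; apply/negP => /wideP[rL _].
  have [|e _ e1] := @exists_nonloop _ M setT; first by rewrite -rL.
  move: le; rewrite leqn0 cards_eq0 => /eqP/setP/(_ e).
  by rewrite !inE e1.
have [M3|] := boolP (vconn3 M).
  have [/existsP[L wL]|] := boolP [exists L : {set E}, wide M L].
    by apply: (coherent_linear cardF codeC); exact: (coherent_wide cardF M3 wL codeC).
  rewrite negb_exists => /forallP narrow.
  by apply: binary_linear narrow; exact: f4_addxx.
case/forallPn => X; rewrite !negb_imply -ltnNge => /and3P[lt1 lt2 lt3].
have leX : M X + M (~: X) <= (M setT).+1 by rlia.
have leX' : M (~: X) + M (~: ~: X) <= (M setT).+1 by rewrite setCK; rlia.
have [x xC] := code_inh codeC.
have rec I : 0 < M I -> exists D, linear_code (contract M I) D.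
  move=> pI; apply: IH (code_contract_agree I codeC xC).
  have [e eI e1] := exists_nonloop pI.
  suff : #|[set e | contract M I [set e] == 1]| < #|[set e | M [set e] == 1]|.
    by move/leq_trans/(_ le).
  apply: proper_card; apply/properP; split.
    apply/subsetP => f; rewrite !inE => /eqP h.
    have := contractE M I [set f]; have := rankU1 M f set0; rewrite setU0 rank0.
    have := @rank_submod _ M ([set f] :|: I) set0 [set f] I (subxx _) (sub0set _).
    by rewrite rank0 => u1 u2 u3; apply/eqP; rlia.
  exists e; rewrite !inE ?e1 //.
  have := contractE M I [set e]; rewrite (setUidPr _) ?sub1set //.
  by case: (contract M I [set e]) => //= k; rlia.
have [I [y hI]] := cosep_exists lt1 leX.
have [J [x0 hJ]] := cosep_exists lt2 leX'.
have [|D1 l1] := rec I; first by case: hI => _ _ h _ _; rlia.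
have [|D2 l2] := rec J; first by case: hJ => _ _ h _ _; rlia.
apply: (glue_codes (X := X) (x0 := x0) (y0 := y) l1 l2) => A e eX.
  exact: cosep_cl hI hJ leX eX.
have eX' : e \in ~: X by rewrite inE.
have hI' : cosep M (~: ~: X) I y by rewrite setCK.
by rewrite (cosep_cl A hJ hI' leX' eX') setDE setCK -setDE.
Qed.

End CodeLinear.

(** * Representations *)

Section Representable.

Variables (E : finType) (F : finFieldType) (M : matroid E).
Implicit Types (A I X Y : {set E}) (e f g : E) (x y z : {ffun E -> F}).

Local Open Scope ring_scope.

Lemma eq_on_span (V : vectType F) (f g : {linear V -> F^o}) (X : seq V) w :
  w \in <<X>>%VS -> {in X, f =1 g} -> f w = g w.
Proof.
move=> /(@coord_span _ _ _ (in_tuple X)) -> fg; rewrite !linear_sum.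
apply: eq_bigr => i _; rewrite !linearZ fg //.
by apply: mem_nth; rewrite /= ltn_ord.
Qed.

Lemma span_setU1 (V : vectType F) (v : E -> V) e A :
  <<[seq v g | g in e |: A]>>%VS = (<[v e]> + <<[seq v g | g in A]>>)%VS.
Proof.
rewrite -span_cons; apply: eq_span => w; rewrite inE.
apply/imageP/orP => [[g]|[/eqP ->|/imageP[g gA ->]]].
- by rewrite in_setU1 => /orP[/eqP -> ->|gA ->]; [left|right; apply: image_f].
- by exists e; rewrite ?setU11.
- by exists g; rewrite ?in_setU1 ?gA ?orbT.
Qed.

Lemma rank_span_mem (V : vectType F) (v : E -> V) :
  (forall A, M A = \dim <<[seq v e | e in A]>>%VS) ->
  forall A e, (e \in cl M A) = (v e \in <<[seq v g | g in A]>>%VS).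
Proof.
move=> rv A e; set W := <<_>>%VS; have sW : (W <= <[v e]> + W)%VS by exact: addvSr.
have -> : (v e \in W) = (<[v e]> + W == W)%VS.
  apply/idP/eqP => [h|<-]; last by rewrite memvE addvSl.
  by apply/addv_idPr; rewrite -memvE.
rewrite inE !rv span_setU1 -/W; apply/eqP/eqP => [h|-> //].
by apply/esym/eqP; rewrite eqEdim sW h leqnn.
Qed.

Lemma rank_span (V : vectType F) (v : E -> V) :
  (forall A e, (e \in cl M A) = (v e \in <<[seq v g | g in A]>>%VS)) ->
  forall A, M A = \dim <<[seq v e | e in A]>>%VS.
Proof.
move=> h A; elim/set_ind1: A => [|e A IH].
  by rewrite rank0 /image_mem enum_set0 span_nil dimv0.
rewrite span_setU1; have [eA|eA] := boolP (e \in cl M A).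
  move: (eA); rewrite h memvE => /addv_idPr ->; rewrite -IH; exact/clP.
rewrite (notin_cl eA) IH; rewrite h in eA.
have : (<[v e]> :&: <<[seq v g | g in A]>> = 0)%VS.
  apply/eqP; rewrite -subv0; apply/subvP => w; rewrite memv_cap => /andP[/vlineP[k ->]].
  have [->|k0] := eqVneq k 0; first by rewrite scale0r !mem0v.
  by move/(memvZ k^-1); rewrite scalerA mulVf // scale1r => h0; rewrite h0 in eA.
move/dimv_disjoint_sum => ->; rewrite dim_vline.
by case: eqVneq eA => // ->; rewrite mem0v.
Qed.

Lemma representable_linear_code : representable F M -> exists D, @linear_code E F M D.
Proof.
case=> V [v /rank_span_mem rv].
pose D := [set x : {ffun E -> F} |
  boolp.asbool (exists f : {linear V -> F^o}, forall e, x e = f (v e))].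
have inD x : reflect (exists f : {linear V -> F^o}, forall e, x e = f (v e)) (x \in D).
  by rewrite inE; apply: boolp.asboolP.
exists D; split; last first.
  move=> a x y /inD[f xf] /inD[g yg]; apply/inD.
  exists (a \*: f \+ g : {linear V -> F^o}) => e; by rewrite ffunE xf yg.
split.
- exists [ffun=> 0]; apply/inD; exists (\0 : {linear V -> F^o}) => e; by rewrite ffunE.
- move=> A e x y /inD[f xf] /inD[g yg]; rewrite rv xf yg => eA fg.
  apply: eq_on_span eA _ => _ /imageP[k kA ->]; by rewrite -xf -yg fg.
- move=> A e x s /inD[f xf]; rewrite rv; set W := <<_>>%VS => eW.
  (* The first coordinate in this free family is 1 at [v e] and vanishes on W. *)
  pose X := [tuple of v e :: vbasis W].
  have fX : free X by rewrite free_cons (span_basis (vbasisP W)) eW (basis_free (vbasisP W)).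
  pose c : {linear V -> F^o} := coord X ord0.
  have c1 : c (v e) = 1 by have := coord_free ord0 ord0 fX.
  have c0 k : k \in A -> c (v k) = 0.
    move=> kA; apply: (@eq_on_span _ c (\0 : {linear V -> F^o}) (vbasis W)).
      by rewrite (span_basis (vbasisP W)) memv_span // image_f.
    move=> w /(nthP 0)[i]; rewrite size_tuple => lti <-.
    by have := coord_free (lift ord0 (Ordinal lti)) ord0 fX.
  exists [ffun k => f (v k) + (s - x e) * c (v k)]; split.
  + apply/inD; exists (f \+ ((s - x e) \*: c) : {linear V -> F^o}) => k.
    by rewrite ffunE.
  + by move=> k kA; rewrite ffunE c0 // mulr0 addr0 xf.
  + by rewrite ffunE c1 mulr1 -xf addrC subrK.
Qed.

Lemma linear_code_sum (D : {set {ffun E -> F}}) (I : finType) (P : pred I) (a : I -> F) (u : I -> {ffun E -> F}) :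
  linear_code M D -> (forall i, P i -> u i \in D) ->
  [ffun e => \sum_(i | P i) a i * u i e] \in D.
Proof.
move=> lD uD; pose w (s : seq I) := [ffun e => \sum_(i <- s | P i) a i * u i e].
have : forall s, w s \in D; last by move=> /(_ (index_enum I)).
elim=> [|i s IH].
  have := linear_code0 lD; congr (_ \in D); apply/ffunP => e; by rewrite !ffunE big_nil.
have [Pi|Pi] := boolP (P i).
  have := linear_code_scale (a i) lD (uD i Pi) IH; congr (_ \in D).
  by apply/ffunP => e; rewrite !ffunE big_cons Pi.
by move: IH; congr (_ \in D); apply/ffunP => e; rewrite !ffunE big_cons (negbTE Pi).
Qed.

(** By translation, the |F| possible values at an element outside the closure of A split a class
    into parts of equal size. *)
Lemma linear_code_class (D : {set {ffun E -> F}}) A x : linear_code M D -> x \in D ->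
  (#|[set y in D | agree A y x]| * #|F| ^ M A)%N = #|D|.
Proof.
move=> lD; have [cD _] := lD.
have le B y z : y \in D -> z \in D ->
    (#|[set w in D | agree B w y]| <= #|[set w in D | agree B w z]|)%N.
  move=> yD zD; pose t (w : {ffun E -> F}) := [ffun e => w e - y e + z e].
  rewrite -(card_in_imset (f := t)) => [|w w' _ _ /ffunP h]; last first.
    by apply/ffunP => e; have := h e; rewrite !ffunE => /addIr/addIr.
  apply/subset_leq_card/subsetP => v /imsetP[w]; rewrite inE => /andP[wD /agreeP wy] ->.
  rewrite inE; apply/andP; split; last by apply/agreeP => e eB; rewrite ffunE wy // subrr add0r.
  have := linear_code_scale 1 lD (linear_code_scale (-1) lD yD wD) zD.
  by congr (_ \in D); apply/ffunP => e; rewrite !ffunE; ring.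
elim/set_ind1: A x => [|e A IH] x xD.
  rewrite rank0 expn0 muln1; apply: eq_card => y; rewrite inE.
  by rewrite (introT (agreeP _ _ _)) ?andbT // => e; rewrite inE.
have [eA|eA] := boolP (e \in cl M A).
  rewrite (clP _ _ _ eA) -(IH x xD); congr (_ * _)%N; apply: eq_card => y.
  rewrite !inE agreeU1; case: (boolP (y \in D)) => //= yD.
  case: agreeP => //= yx; exact/eqP/(code_det cD yD xD eA).
rewrite (notin_cl eA) expnS mulnA -(IH x xD); congr (_ * _)%N.
rewrite -[RHS]sum1_card (partition_big (fun y : {ffun E -> F} => y e) predT) //=.
transitivity (\sum_(s : F) #|[set y in D | agree (e |: A) y x]|)%N.
  by rewrite sum_nat_const mulnC.
apply: eq_bigr => s _; have [z [zD zx ze]] := code_free cD s xD eA.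
transitivity #|[set y in D | agree (e |: A) y z]|.
  by apply/eqP; rewrite eqn_leq !le.
rewrite sum1_card; apply: eq_card => y; rewrite !inE agreeU1 ze.
have xz : agree A x z by rewrite agreeC; apply/agreeP.
by rewrite -(agree_congr _ xz) [RHS]unfold_in inE andbA.
Qed.

Lemma linear_code_representable (D : {set {ffun E -> F}}) : linear_code M D -> representable F M.
Proof.
move=> lD; have [cD _] := lD.
pose V : vectType F := {ffun {ffun E -> F} -> F^o}.
pose v e : V := [ffun x : {ffun E -> F} => if x \in D then x e else 0].
exists V, v; apply: rank_span => A e; apply/idP/idP => eA; last first.
  apply: contraLR eA => eA.
  have [y [yD yA ye]] := code_free cD 1 (linear_code0 lD) eA.
  apply/negP => /(@coord_span _ _ _ (in_tuple _))/ffunP/(_ y).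
  rewrite sum_ffunE ffunE yD ye big1 => [/eqP|i _]; first by rewrite oner_eq0.
  rewrite !ffunE; apply/eqP; rewrite mulf_eq0; apply/orP; right.
  set X := image_mem _ _; have /imageP[k kA ->] : X`_i \in X by apply: mem_nth.
  by rewrite ffunE yD yA // ffunE.
have [I sI [iI rI]] := rank_basis M A.
have eI : e \in cl M I.
  rewrite -(cl_idem M I); move: eA; apply/subsetP; apply: clS.
  by apply: cl_eq_rank; rewrite // rI.
(* Words of D dual to I; their values at e are the coefficients of [v e] in the [v i]. *)
have /boolp.choice[u hu] i : exists y, y \in D /\ {in I, y =1 fun j => (i == j)%:R}.
  by have [y yD yi] := code_lift (fun j => (i == j)%:R : F) cD iI; exists y.
have -> : v e = \sum_(i in I) u i e *: v i.
  apply/ffunP => x; rewrite sum_ffunE ffunE; case: ifP => xD; last first.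
    by rewrite big1 // => i _; rewrite !ffunE xD; apply: mulr0.
  have wD := linear_code_sum (P := mem I) (fun i => x i) lD (fun i _ => proj1 (hu i)).
  rewrite (code_det cD xD wD eI) => [|j jI]; rewrite ffunE.
    by apply: eq_bigr => i _; rewrite !ffunE xD mulrC.
  rewrite (bigD1 j) //= (proj2 (hu j)) // eqxx mulr1 big1 ?addr0 // => i /andP[_ ij].
  by rewrite (proj2 (hu i)) // (negbTE ij) mulr0.
apply: memv_suml => i iI'; apply/memvZ/memv_span; apply: image_f.
exact: (subsetP sI).
Qed.


End Representable.

(* The combinatorial names of all_boot must shadow those of all_classical. *)
From mathcomp Require Import all_classical all_reals all_analysis.
From mathcomp Require Import all_boot all_order all_algebra ring lra.

Import Order.TTheory GRing.Theory Num.Theory.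
Local Open Scope ring_scope.

(** * Entropy *)

Section MarginalEntropy.

Variables (R : realType) (E S : finType) (p : {ffun E -> S} -> R).
Hypotheses (p_ge0 : forall x, 0 <= p x) (p_sum1 : \sum_x p x = 1).
Implicit Types (A B : {set E}) (x y : {ffun E -> S}).

(** For p the joint law, the probability that X_A = x_A. The entropy of X_A is then written as a sum
    over words on all of E, so that the sums for A and for A + e have the same weights. *)
Definition marginal A x := \sum_(y | agree A y x) p y.

Definition marginal_entropy A := - \sum_x p x * ln (marginal A x).

Lemma marginal_ge A x : p x <= marginal A x.
Proof. by rewrite /marginal (bigD1 x) ?agreexx //= lerDl sumr_ge0. Qed.

Definition joint A e x s := \sum_(y | agree A y x && (y e == s)) p y.

Lemma joint_ge0 A e x s : 0 <= joint A e x s.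
Proof. by apply: sumr_ge0. Qed.

Lemma marginalU1 A e x : marginal (e |: A) x = joint A e x (x e).
Proof. by apply: eq_bigl => y; rewrite agreeU1. Qed.

Lemma marginal_joint A e x : marginal A x = \sum_s joint A e x s.
Proof. by rewrite /marginal (partition_big (fun y : {ffun E -> S} => y e) predT). Qed.

Lemma marginalU1_le A e x : marginal (e |: A) x <= marginal A x.
Proof.
rewrite marginalU1 (marginal_joint A e) (bigD1 (x e)) //= lerDl.
by rewrite sumr_ge0 // => s _; apply: joint_ge0.
Qed.

Lemma sum_ge0_eq0 (f : {ffun E -> S} -> R) x : (forall y, 0 <= f y) -> \sum_y f y <= 0 -> f x = 0.
Proof.
move=> f0; rewrite (bigD1 x) //= => h; apply/eqP; rewrite eq_le f0 andbT.
by apply: le_trans h; rewrite lerDl sumr_ge0.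
Qed.

(** Marginals shrink as A grows, so equal entropies make them agree at every word of positive
    probability, which leaves no mass for another value at e. *)
Lemma entropy_det A e x y : marginal_entropy (e |: A) = marginal_entropy A ->
  0 < p x -> 0 < p y -> agree A x y -> x e = y e.
Proof.
move=> hA px py xy.
have pos B z : 0 < p z -> 0 < marginal B z by move/lt_le_trans; apply; apply: marginal_ge.
have le_ln z : p z * ln (marginal (e |: A) z) <= p z * ln (marginal A z).
  have := p_ge0 z; rewrite le_eqVlt => /orP[/eqP <-|pz]; first by rewrite !mul0r.
  by rewrite ler_pM2l // ler_ln ?posrE ?pos // marginalU1_le.
pose d z := p z * ln (marginal A z) - p z * ln (marginal (e |: A) z).
have /eqP : d x = 0.
  apply: sum_ge0_eq0 => [z|]; first by rewrite subr_ge0.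
  by move: hA => /oppr_inj hA; rewrite sumrB hA subrr.
rewrite subr_eq0 => /eqP h; have {h} : marginal A x = marginal (e |: A) x.
  apply: ln_inj; rewrite ?posrE ?pos //; apply: (@mulfI _ (p x)) => //.
  by rewrite gt_eqF.
rewrite marginalU1 (marginal_joint A e) (bigD1 (x e)) //= => /eqP.
rewrite -subr_eq0 addrAC subrr add0r => /eqP h.
apply/esym/eqP/negPn/negP => ne; move: h.
rewrite (bigD1 (y e)) //= => h.
have : 0 < joint A e x (y e).
  apply: lt_le_trans py _; rewrite /joint (bigD1 y) /=; first by rewrite lerDl sumr_ge0.
  by rewrite agreeC xy eqxx.
have : 0 <= \sum_(i | (i != x e) && (i != y e)) joint A e x i.
  by apply: sumr_ge0 => *; apply: joint_ge0.
lra.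
Qed.

(** Let t be the inverse of the conditional probability of the value at e given A. Its expectation
    equals that of N, the number of values at e possible given A, and N <= k. As ln (t / k) has
    expectation 0 and is at most t / k - 1, N = k on the support. *)
Lemma entropy_free A e x s : marginal_entropy (e |: A) = marginal_entropy A + ln #|S|%:R ->
  0 < p x -> exists y, [/\ 0 < p y, agree A y x & y e = s].
Proof.
move=> hA px; set k : R := #|S|%:R in hA *.
have k0 : 0 < k by rewrite ltr0n; apply/card_gt0P; exists s.
have pos B z : 0 < p z -> 0 < marginal B z by move/lt_le_trans; apply; apply: marginal_ge.
pose t z := marginal A z / marginal (e |: A) z.
pose N z := \sum_s (joint A e z s != 0)%:R : R.
have tN : \sum_z p z * t z = \sum_z p z * N z.
  transitivity (\sum_z \sum_(y | agree A y z) p z * p y / joint A e y (z e)).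
    apply: eq_bigr => z _; rewrite /t marginalU1 /marginal mulr_suml mulr_sumr.
    apply: eq_bigr => y yz; rewrite mulrA; congr (_ / _).
    by apply: eq_bigl => w; rewrite (agree_congr _ yz).
  rewrite (exchange_big_dep predT) //=; apply: eq_bigr => y _; rewrite /N mulr_sumr.
  rewrite (partition_big (fun z : {ffun E -> S} => z e) predT) //=.
  apply: eq_bigr => u _.
  transitivity (\sum_(z | agree A z y && (z e == u)) p z * (p y / joint A e y u)).
    apply: eq_big => [z|z /andP[_ /eqP <-]]; first by rewrite agreeC.
    by rewrite mulrA.
  rewrite -mulr_suml mulrCA -/(joint A e y u).
  by case: eqP => [->|/eqP h]; rewrite ?mul0r ?divff.
have Nk z : N z <= k.
  rewrite /N /k -sum1_card natr_sum; apply: ler_sum => u _.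
  by case: (_ != _); rewrite ?ler01.
have tln : \sum_z p z * (ln (t z) - ln k) = 0.
  have -> : \sum_z p z * (ln (t z) - ln k) =
     \sum_z (p z * ln (marginal A z) - p z * ln (marginal (e |: A) z) - p z * ln k).
    apply: eq_bigr => z _; have := p_ge0 z; rewrite le_eqVlt => /orP[/eqP <-|pz].
      by rewrite !mul0r !subrr.
    by rewrite /t ln_div ?posrE ?pos //; ring.
  rewrite !sumrB -mulr_suml p_sum1 mul1r.
  by move: hA; rewrite /marginal_entropy; lra.
have le_t z : p z * (ln (t z) - ln k) <= p z * (t z / k) - p z.
  have := p_ge0 z; rewrite le_eqVlt => /orP[/eqP <-|pz]; first by rewrite !mul0r subrr.
  have tz : 0 < t z by rewrite divr_gt0 ?pos.
  rewrite -ln_div ?posrE // -{3}[p z]mulr1 -mulrBr ler_pM2l //.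
  have := @le_ln1Dx _ (t z / k - 1).
  rewrite [1 + _]addrC subrK; apply; have : 0 < t z / k by rewrite divr_gt0.
  by lra.
pose d z := p z - p z * (N z / k).
have /eqP : d x = 0.
  apply: sum_ge0_eq0 => [z|].
    rewrite subr_ge0 -{2}[p z]mulr1 ler_wpM2l // ler_pdivrMr // mul1r; exact: Nk.
  rewrite sumrB subr_le0.
  apply: (@le_trans _ _ (\sum_z p z * (t z / k))).
    by rewrite -subr_ge0 -sumrB -[leLHS]tln; apply: ler_sum => z _; apply: le_t.
  have assoc (f : {ffun E -> S} -> R) : \sum_z p z * (f z / k) = (\sum_z p z * f z) / k.
    by rewrite mulr_suml; apply: eq_bigr => z _; rewrite mulrA.
  by rewrite !assoc tN.
rewrite subr_eq0 => /eqP h.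
have {}h : N x = k.
  have : N x / k = 1.
    by apply: (@mulfI _ (p x)); rewrite ?gt_eqF // mulr1 -h.
  by move/(congr1 (fun u => u * k)); rewrite divfK ?gt_eqF // mul1r.
have ns : joint A e x s != 0.
  apply/eqP => s0; move: h; rewrite /N /k (bigD1 s) //= s0 eqxx add0r => h.
  have : \sum_(i | i != s) ((joint A e x i != 0)%:R : R) <= \sum_(i : S | i != s) (1 : R).
    by apply: ler_sum => u _; case: (_ != _); rewrite ?ler01.
  rewrite h sumr_const ler_nat cardC1; move: k0; rewrite ltr0n.
  by case: #|S| => // n _; rewrite ltnn.
have /existsP[y /andP[/andP[yx /eqP ye] py]] : [exists y, (agree A y x && (y e == s)) && (p y != 0)].
  apply: contraR ns; rewrite negb_exists => /forallP h0; apply/eqP/big1 => y yP.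
  by have := h0 y; rewrite yP /= negbK => /eqP.
by exists y; split=> //; rewrite lt_def py p_ge0.
Qed.

Definition support_set := [set x | 0 < p x].

Lemma support_code (M : matroid E) :
  (forall A, marginal_entropy A = (M A)%:R * ln #|S|%:R) -> matroid_code M support_set.
Proof.
move=> hM; split.
- have /existsP[x px] : [exists x, p x != 0].
    apply: contraT; rewrite negb_exists => /forallP h; move/eqP: p_sum1.
    rewrite big1 => [|x _]; first by rewrite eq_sym oner_eq0.
    by have := h x; rewrite negbK => /eqP.
  by exists x; rewrite inE lt_def px p_ge0.
- move=> A e x y; rewrite !inE => px py /eqP eA xy.
  by apply: (@entropy_det A) px py _; rewrite ?hM ?eA //; apply/agreeP.
- move=> A e x s; rewrite [_ \in support_set]inE => px eA.
  have [|y [py /agreeP yx ye]] := @entropy_free A e x s _ px.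
    by rewrite !hM (notin_cl eA) -addn1 natrD mulrDl mul1r.
  by exists y; rewrite inE.
Qed.

End MarginalEntropy.

(** * Law and entropy of a finite family of random variables *)

Section JointLaw.

Variables (d : measure_display) (T : measurableType d) (R : realType).
Variables (P : probability T R).

Lemma finite_law_ge0 (S : finType) (X : T -> S) s : 0 <= finite_law P X s.
Proof. exact/fine_ge0/measure_ge0. Qed.

Lemma preimage_comp_bigcup (S U : finType) (X : T -> S) (g : S -> U) u :
  ((g \o X) @^-1` [set u] =
    \bigcup_(s in [set` [pred s | g s == u]]) (X @^-1` [set s]))%classic.
Proof.
apply/seteqP; split=> [t /= <-|t /= [s /eqP gs Xs]]; last by rewrite Xs.
by exists (X t) => //=; rewrite inE /= eqxx.
Qed.

Lemma finite_law_comp (S U : finType) (X : T -> S) (g : S -> U) u :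
  finite_random_variable X ->
  finite_law P (g \o X) u = \sum_(s | g s == u) finite_law P X s.
Proof.
move=> mX; apply: EFin_inj; rewrite -sumEFin.
have mg : measurable ((g \o X) @^-1` [set u]%classic).
  by rewrite preimage_comp_bigcup; apply: fin_bigcup_measurable => // s _; apply: mX.
rewrite fineK ?fin_num_measure // preimage_comp_bigcup measure_fin_bigcup //=.
- rewrite -(@bigfs _ _ _ _ (index_enum S)) ?index_enum_uniq // => [|s _]; last by rewrite mem_index_enum.
  by apply: eq_bigr => s _; rewrite fineK ?fin_num_measure //; apply: mX.
- by move=> s s' _ _ [t [/= <- <-]].
Qed.

Lemma finite_law_sum1 (S : finType) (X : T -> S) : finite_random_variable X ->
  \sum_s finite_law P X s = 1.
Proof.
move=> mX; have := finite_law_comp (fun=> tt) tt mX.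
rewrite (eq_bigl predT) => [<-|s]; last exact: eqxx.
rewrite /finite_law (_ : (_ @^-1` _)%classic = classical_sets.setT) ?probability_setT //.
by apply/seteqP; split.
Qed.

Variables (E S : finType) (X : E -> T -> S).
Hypothesis mX : forall e, finite_random_variable (X e).

Definition joint_variable t := [ffun e => X e t].

Lemma joint_measurable : finite_random_variable joint_variable.
Proof.
move=> x; rewrite (_ : (_ @^-1` _)%classic =
  (\bigcap_(e in classical_sets.setT) (X e @^-1` [set x e]))%classic).
  by apply: fin_bigcap_measurable => // e _; apply: mX.
apply/seteqP; split=> [t /= <- e _|t /= h]; first by rewrite /= ffunE.
by apply/ffunP => e; rewrite ffunE; apply: h.
Qed.

Lemma subtuple_entropy (A : {set E}) :
  entropy P (subtuple X A) = marginal_entropy (finite_law P joint_variable) A.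
Proof.
pose res (x : {ffun E -> S}) : {ffun {e : E | e \in A} -> S} := [ffun e => x (val e)].
have resE x y : (res y == res x) = agree A y x.
  apply/eqP/agreeP => [/ffunP h e eA|h]; first by have := h (exist _ e eA); rewrite !ffunE.
  by apply/ffunP => e; rewrite !ffunE h // (valP e).
have subE : subtuple X A = res \o joint_variable.
  by apply/funext => t; apply/ffunP => e; rewrite !ffunE.
rewrite /entropy /marginal_entropy subE; congr (- _).
rewrite (partition_big res predT) //=; apply: eq_bigr => s _.
rewrite {1}(finite_law_comp _ _ joint_measurable) mulr_suml.
apply: eq_bigr => x /eqP <-; congr (_ * ln _).
by rewrite (finite_law_comp _ _ joint_measurable); apply: eq_bigl => y; rewrite resE.
Qed.

End JointLaw.

Lemma mnormalize_fin d (T : measurableType d) (R : realType)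
    (mu : {measure set T -> \bar R}) (P : probability T R) (c : R) A : c != 0 ->
  mu classical_sets.setT = c%:E -> mnormalize mu P A = (mu A * (c^-1)%:E)%E.
Proof. by move=> c0 muT; rewrite /mnormalize muT eqe (negbTE c0). Qed.

(** * Entropic families and codes *)

Section Entropic.

Variables (R : realType) (E : finType) (M : matroid E).

Lemma entropic_code (q : nat) (S' : finType) : #|S'| = q ->
  entropic R q M -> exists C : {set {ffun E -> S'}}, matroid_code M C.
Proof.
move=> cardS' [d [T [P [S [X [cardS mX hX]]]]]].
have mZ := joint_measurable mX.
have codeC : matroid_code M (support_set (finite_law P (joint_variable X))).
  apply: support_code; first exact: finite_law_ge0; first exact: finite_law_sum1.
  by move=> A; rewrite -subtuple_entropy // hX cardS.
have e : #|S| = #|S'| by rewrite cardS.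
pose f (s : S) : S' := enum_val (cast_ord e (enum_rank s)).
pose g (s : S') : S := enum_val (cast_ord (esym e) (enum_rank s)).
have fK : cancel f g by move=> s; rewrite /f /g enum_valK cast_ordK enum_rankK.
have gK : cancel g f by move=> s; rewrite /f /g enum_valK cast_ordKV enum_rankK.
by eexists; apply: (code_map (phi := fun=> f) (psi := fun=> g) codeC).
Qed.

Lemma linear_code_entropic (F : finFieldType) (D : {set {ffun E -> F}}) :
  linear_code M D -> entropic R #|F| M.
Proof.
move=> lD; have [cD _] := lD; have [x0 x0D] := code_inh cD.
pose n := #|D|; have n0 : (0 < n)%N by apply/card_gt0P; exists x0.
pose Z (k : nat) := nth x0 (enum D) k.
(* Up to normalisation, the uniform law on the indices of an enumeration of D; on the discrete space
   [nat] all maps are measurable. *)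
pose mu := msum (fun k : nat => @dirac _ nat k R) n.
pose P := mnormalize mu (@dirac _ nat 0%N R).
have muE (A : set nat) : mu A = (\sum_(k < n) \1_A (k : nat))%:E.
  by rewrite /mu /msum /= -sumEFin.
have muT : mu classical_sets.setT = n%:R%:E.
  rewrite muE; congr EFin; under eq_bigr do rewrite indicE classical_sets.in_setT.
  by rewrite sumr_const card_ord.
pose X e k := Z k e.
have mX e : finite_random_variable (X e) by [].
have law x : finite_law P (joint_variable X) x = (x \in D)%:R / n%:R.
  have XZ : joint_variable X = Z by apply/funext => k; apply/ffunP => e; rewrite ffunE.
  have -> : finite_law P (joint_variable X) x = fine (mu (Z @^-1` [set x])%classic * (n%:R^-1)%:E)%E.
    by rewrite XZ; congr fine; apply: mnormalize_fin; rewrite // pnatr_eq0 -lt0n.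
  rewrite muE /=; congr (_ / _).
  transitivity (\sum_(y <- enum D) (y == x)%:R : R).
    rewrite (big_nth x0) -cardE big_mkord; apply: eq_bigr => k _.
    rewrite indicE; congr _%:R; congr nat_of_bool.
    by apply/idP/eqP => [/set_mem|h]; [|apply/mem_set].
  rewrite big_enum /=; case: (boolP (x \in D)) => xD.
    by rewrite (bigD1 x) //= eqxx big1 ?addr0 // => y /andP[_ /negbTE ->].
  by rewrite big1 // => y yD; case: eqP yD xD => // -> ->.
have q0 : (0 < #|F|)%N by apply/card_gt0P; exists 0.
have marg A x : x \in D -> marginal (finite_law P (joint_variable X)) A x = (#|F| ^ M A)%:R^-1.
  move=> xD; rewrite /marginal; under eq_bigr do rewrite law.
  rewrite -mulr_suml; have cls := linear_code_class A lD xD.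
  have -> : \sum_(y | agree A y x) (y \in D)%:R = #|[set y in D | agree A y x]|%:R :> R.
    rewrite -sum1dep_card natr_sum big_mkcond [RHS]big_mkcond /=.
    by apply: eq_bigr => y _; case: (y \in D); case: (agree A y x).
  rewrite /n -cls natrM invfM mulrA divff ?mul1r // pnatr_eq0.
  by apply: contraTneq n0 => h; rewrite /n -cls h mul0n.
exists _, nat, P, F, X; split=> // A.
rewrite subtuple_entropy // /marginal_entropy.
set c : R := (M A)%:R * ln #|F|%:R.
rewrite -[c]mul1r -(finite_law_sum1 P (joint_measurable mX)) mulr_suml -sumrN.
apply: eq_bigr => x _; case: (boolP (x \in D)) => xD.
  rewrite marg // lnV ?posrE ?ltr0n ?expn_gt0 ?q0 // natrX lnXn ?ltr0n //.
  by rewrite mulrN opprK /c mulr_natl.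
by rewrite law (negbTE xD) !mul0r oppr0.
Qed.

End Entropic.

Theorem theorem1p1 (R : realType) (F : finFieldType) (cardF : #|F| = 4%N)
    (E : finType) (M : matroid E) :
  entropic R 4 M <-> representable F M.
Proof.
split=> [/(entropic_code cardF)[C codeC]|/representable_linear_code[D lD]].
  have [D lD] := code_linear cardF codeC; exact: linear_code_representable lD.
by rewrite -cardF; apply: linear_code_entropic lD.
Qed.
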